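(* For $1\le p<\infty$, $\mathbf{T}_a\in\mathcal{G}(W^{1,p}(-\ell,\ell))$; that is, $\mathbf{T}_a$ is a bounded linear operator from $W^{1,p}(-\ell,\ell)$ to itself that is invertible with bounded inverse.
   Context: Let $\ell>0$, $I=(-\ell,\ell)$, and let $a\in W^{1,\infty}(-\ell,\ell)$ be positive with $a,\frac1a\in L^2(-\ell,\ell)$ and $a(0)=1$. For $\rho\in\mathbb{C}$, $e_a(\rho,\cdot)$ denotes the unique solution of $-\frac1{a^2}(a^2u')'=\rho^2u$ on $I$ with $u(0)=1$, $(a^2u')(0)=i\rho$. It is known that there is a kernel $K_a\in W^{1,\infty}(\Omega)$, $\Omega=(-\ell,\ell)\times(-\ell,\ell)$, such that $e_a(\rho,x)=e^{i\rho x}-i\rho\int_{-x}^{x}K_a(x,t)e^{i\rho t}\,dt$ for all $x\in[-\ell,\ell]$, $\rho\in\mathbb{C}$, and $K_a(x,x)=1-\frac1{a(x)}$, $K_a(x,-x)=0$ for $x\in[-\ell,\ell]$. (The representation determines $K_a$ on $|t|\le|x|$.) The operator $\mathbf{T}_a$ is $\mathbf{T}_au(x):=u(x)-\int_{-x}^xK_a(x,t)u'(t)\,dt$, $-\ell\le x\le\ell$, for $u\in W^{1,p}(-\ell,\ell)$. For $x<0$, $\int_{-x}^x$ is the oriented integral. For a Banach space $X$, $\mathcal{G}(X)$ is the group of bounded invertible operators on $X$ with bounded inverse. *)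

(* Defs.v *)
From HB Require Import structures.
From mathcomp Require Import all_boot all_order all_algebra.
From mathcomp Require Export complex.
From mathcomp Require Export all_classical all_reals all_analysis.

Set Implicit Arguments.
Unset Strict Implicit.
Unset Printing Implicit Defensive.

Import Order.TTheory GRing.Theory Num.Theory.
Import numFieldNormedType.Exports.

Local Open Scope classical_set_scope.
Local Open Scope ring_scope.

Local Notation Re := complex.Re.
Local Notation Im := complex.Im.

(** MathComp-Analysis only integrates real-valued functions and puts no
    topology on [R[i]]: integrals, measurability and continuity of
    complex-valued functions are taken componentwise. *)

Section complex_functions.
Context {R : realType}.

Definition cexp (z : R[i]) : R[i] :=
  ((expR (Re z) * cos (Im z)) +i* (expR (Re z) * sin (Im z)))%C.

Definition cmodulus (z : R[i]) : R := Normc.normc z.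

Definition ccontinuous_on (T : topologicalType) (D : set T) (f : T -> R[i]) :=
  {within D, continuous (fun x => Re (f x))} /\
  {within D, continuous (fun x => Im (f x))}.

Definition cmeasurable_on d (T : measurableType d) (D : set T) (f : T -> R[i]) :=
  measurable_fun D (fun x => Re (f x)) /\ measurable_fun D (fun x => Im (f x)).

Definition cintegral d (T : measurableType d) (mu : {measure set T -> \bar R})
    (D : set T) (f : T -> R[i]) : R[i] :=
  ((\int[mu]_(x in D) Re (f x)) +i* (\int[mu]_(x in D) Im (f x)))%C.

Definition Lp_norm d (T : measurableType d) (mu : {measure set T -> \bar R})
    (D : set T) (p : \bar R) (f : T -> R[i]) : \bar R :=
  'N[mu]_p[(fun x => (cmodulus (f x))%:E) \_ D].

Definition in_Lp d (T : measurableType d) (mu : {measure set T -> \bar R})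
    (D : set T) (p : \bar R) (f : T -> R[i]) :=
  cmeasurable_on D f /\ (Lp_norm mu D p f < +oo)%E.

Definition oriented_integral (x y : R) (f : R -> R[i]) : R[i] :=
  if x <= y then cintegral lebesgue_measure `[x, y] f
  else - cintegral lebesgue_measure `[y, x] f.

End complex_functions.

Section test_functions.
Context {R : realType} (V : normedModType R).

(** In finite dimension this is the class C^n: all iterated directional
    derivatives of order at most [n] exist and are continuous. *)
Fixpoint is_Cn (n : nat) (phi : V -> R) : Prop :=
  continuous phi /\
  if n is m.+1 then
    forall v : V, (forall x, derivable phi x v) /\ is_Cn m (fun x => 'D_v phi x)
  else True.

Definition test_function (D : set V) (phi : V -> R) :=
  [/\ forall n, is_Cn n phi,
      compact (closure [set x | phi x != 0]) &
      closure [set x | phi x != 0] `<=` D].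

End test_functions.

Section sobolev.
Context {R : realType} (l : R).

Local Notation mu := (@lebesgue_measure R).
Local Notation mu2 := (mu \x mu)%E.

Definition Iopen : set R := `]- l, l[.
Definition Iclosed : set R := `[- l, l].
Definition Omega : set (R * R) := Iopen `*` Iopen.
Definition Omega_closed : set (R * R) := Iclosed `*` Iclosed.

Definition in_L1loc (f : R -> R[i]) :=
  locally_integrable Iopen (fun x => Re (f x)) /\
  locally_integrable Iopen (fun x => Im (f x)).

Definition is_weak_deriv (u v : R -> R[i]) :=
  [/\ in_L1loc u, in_L1loc v &
      forall phi : R -> R, test_function Iopen phi ->
        cintegral mu Iopen (fun x => u x * ('D_1 phi x)%:C%C) =
        - cintegral mu Iopen (fun x => v x * (phi x)%:C%C)].

(** Some representative of the weak derivative [u'], which is unique up to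
    equality almost everywhere. *)
Definition weak_deriv (u : R -> R[i]) : R -> R[i] :=
  xget (fun=> 0) [set v | is_weak_deriv u v].

Definition in_W1 (p : \bar R) (u : R -> R[i]) :=
  in_Lp mu Iopen p u /\ exists2 v, in_Lp mu Iopen p v & is_weak_deriv u v.

Definition W1_norm (p : \bar R) (u : R -> R[i]) : \bar R :=
  (Lp_norm mu Iopen p u + Lp_norm mu Iopen p (weak_deriv u))%E.

Definition is_weak_partial (v : R * R) (f g : R * R -> R[i]) :=
  forall phi : R * R -> R, test_function Omega phi ->
    cintegral mu2 Omega (fun z => f z * ('D_v phi z)%:C%C) =
    - cintegral mu2 Omega (fun z => g z * (phi z)%:C%C).

Definition in_W1oo_Omega (f : R * R -> R[i]) :=
  [/\ in_Lp mu2 Omega +oo%E f,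
      (exists2 g, in_Lp mu2 Omega +oo%E g & is_weak_partial (1, 0) f g) &
      (exists2 g, in_Lp mu2 Omega +oo%E g & is_weak_partial (0, 1) f g)].

End sobolev.

Section bounded_operators.
Context {R : realType} (l : R) (p : \bar R).

Local Notation "u =W v" :=
  (u = v %[ae (@lebesgue_measure R) in Iopen l]) (at level 70).

(** The elements of the Banach space [W^{1,p}(-l,l)] are the functions in
    [in_W1 l p] up to [=W]. A map on functions represents an operator on this
    space when it respects [=W], and two such maps represent the same operator
    when their values agree up to [=W]. *)
Definition W1_bounded (T : (R -> R[i]) -> (R -> R[i])) :=
  [/\ forall u, in_W1 l p u -> in_W1 l p (T u),
      forall u v, in_W1 l p u -> in_W1 l p v -> u =W v -> T u =W T v,
      forall (c : R[i]) u v, in_W1 l p u -> in_W1 l p v ->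
        T (fun x => c * u x + v x) =W (fun x => c * T u x + T v x) &
      exists C : R, forall u, in_W1 l p u ->
        (W1_norm l p (T u) <= C%:E * W1_norm l p u)%E].

Definition W1_invertible (T : (R -> R[i]) -> (R -> R[i])) :=
  W1_bounded T /\
  exists S, [/\ W1_bounded S,
    forall u, in_W1 l p u -> S (T u) =W u &
    forall u, in_W1 l p u -> T (S u) =W u].

End bounded_operators.

Section transmutation.
Context {R : realType} (l : R).

(** Functions in [W^{1,oo}] whose values at points matter ([a] and the kernel)
    are identified with their continuous representative on the closed domain. *)
Definition impedance (a : R -> R) :=
  [/\ in_W1 l +oo%E (fun x => (a x)%:C%C) /\
      {within Iclosed l, continuous a},
      forall x, Iopen l x -> 0 < a x,
      in_Lp lebesgue_measure (Iopen l) 2%:E (fun x => (a x)%:C%C),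
      in_Lp lebesgue_measure (Iopen l) 2%:E (fun x => ((a x)^-1)%:C%C) &
      a 0 = 1].

(** [q] is the continuous representative of the quasi-derivative [a^2 u']. *)
Definition is_solution (a : R -> R) (rho : R[i]) (u : R -> R[i]) :=
  ccontinuous_on (Iclosed l) u /\
  exists q q' : R -> R[i],
    [/\ is_weak_deriv l u (weak_deriv l u),
        ccontinuous_on (Iclosed l) q /\
        q = (fun x => (a x ^+ 2)%:C%C * weak_deriv l u x)
          %[ae (@lebesgue_measure R) in Iopen l],
        is_weak_deriv l q q',
        (fun x => - ((a x ^+ 2)^-1)%:C%C * q' x) = (fun x => rho ^+ 2 * u x)
          %[ae (@lebesgue_measure R) in Iopen l] &
        u 0 = 1 /\ q 0 = 'i%C * rho].

(** [K] is the kernel of the integral representation of the solutions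
    [e rho]. *)
Definition is_kernel (a : R -> R) (e : R[i] -> R -> R[i])
    (K : R * R -> R[i]) :=
  [/\ in_W1oo_Omega l K,
      ccontinuous_on (Omega_closed l) K,
      forall (rho : R[i]) (x : R), Iclosed l x ->
        e rho x = cexp ('i%C * rho * x%:C%C) -
          'i%C * rho * oriented_integral (- x) x
            (fun t => K (x, t) * cexp ('i%C * rho * t%:C%C)),
      forall x : R, Iclosed l x -> K (x, x) = (1 - (a x)^-1)%:C%C &
      forall x : R, Iclosed l x -> K (x, - x) = 0].

Definition transmutation (K : R * R -> R[i]) (u : R -> R[i]) : R -> R[i] :=
  fun x => u x - oriented_integral (- x) x
    (fun t => K (x, t) * weak_deriv l u t).

End transmutation.

(* Main.v *)
(** A [W^{1,oo}] kernel that is continuous is absolutely continuous in [x] for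
    almost every [t]. Writing [K (x, t)] as its value at [(|t|, t)] or
    [(- |t|, t)], which is given by the conditions on the two diagonals, plus an
    integral of [g = d_x K], Fubini's theorem turns the correction term of
    [T_a u] into the primitive from [0] to [x] of [(1 - 1/a) u' + G u'], where
    [G v (x)] is the integral of [g (x, t) v (t)] over [t] from [- x] to [x].
    Hence [(T_a u) (0) = u (0)] and [(T_a u)' = u' / a - G u'], and [T_a] is
    invertible as soon as [v |-> v / a - G v] is. As [K (x, x) = 1 - 1/a (x)] is
    bounded, so is [1/a], and [v / a - G v = w] is the Volterra equation
    [v = a w + a G v], solved by Picard iteration. *)

(* The obstacle is to pass from the distributional derivative of [K] on the square to increments of
   the sections [x |-> K (x, t)]. For each test function in [x], Fubini gives an identity valid
   outside a null set of [t] that depends on this function. Hence the explicit smooth plateaus: they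
   tend to indicators of intervals, their derivatives concentrate at the endpoints, and countably
   many of them suffice. Moreover [g] is replaced by a representative that is bounded at every
   point, so that the estimates on [G] hold pointwise.

   The exponent [p] enters only at the end. The Volterra equation is solved for data [w] that are
   merely integrable: [a w] may be unbounded, but [a G] sends [L^1] to bounded functions, so the
   solution is [a w] plus a function bounded by a multiple of the [L^1] norm of [w]. On a bounded
   interval such an estimate passes to every [L^p], and no iteration in [L^p] is needed. *)
Require Import Defs.
From mathcomp Require Import all_boot all_order all_algebra.
From mathcomp Require Import complex all_classical all_reals all_analysis.
From mathcomp Require Import measurable_realfun ess_sup_inf ring lra.

Set Implicit Arguments.
Unset Strict Implicit.
Unset Printing Implicit Defensive.

Import Order.TTheory GRing.Theory Num.Theory.
Import numFieldNormedType.Exports.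

Local Open Scope classical_set_scope.
Local Open Scope ring_scope.

Local Notation Re := complex.Re.
Local Notation Im := complex.Im.

(** * Smooth test functions *)

Section Cn_closure.
Context {R : realType}.

Lemma is_Cn_continuous (V : normedModType R) n (f : V -> R) :
  is_Cn n f -> continuous f.
Proof. by case: n => [|n] []. Qed.

Lemma is_CnW (V : normedModType R) n (f : V -> R) : is_Cn n.+1 f -> is_Cn n f.
Proof.
elim: n f => [|n IHn] f [cf df]; first by split.
by split=> // v; have [fv /IHn] := df v.
Qed.

Lemma is_Cn_cst (V : normedModType R) n (c : R) : is_Cn n (fun _ : V => c).
Proof.
elim: n c => [|n IHn] c; first by split => // x; exact: cst_continuous.
split=> [x|v]; first exact: cst_continuous.
split=> [x|]; first exact: derivable_cst.
rewrite (_ : 'D_v _ = (fun=> 0)); first exact: (IHn 0).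
by apply/funext => x; rewrite derive_cst.
Qed.

Lemma is_CnD (V : normedModType R) n (f g : V -> R) :
  is_Cn n f -> is_Cn n g -> is_Cn n (fun x => f x + g x).
Proof.
elim: n f g => [|n IHn] f g [cf df] [cg dg].
  by split=> // x; apply: cvgD; [exact: cf|exact: cg].
split=> [x|v]; first by apply: cvgD; [exact: cf|exact: cg].
have [dfv Cf] := df v; have [dgv Cg] := dg v.
split=> [x|]; first exact: derivableD.
rewrite (_ : 'D_v _ = (fun x => 'D_v f x + 'D_v g x)); first exact: (IHn).
by apply/funext => x; rewrite -deriveD.
Qed.

Lemma is_CnM (V : normedModType R) n (f g : V -> R) :
  is_Cn n f -> is_Cn n g -> is_Cn n (fun x => f x * g x).
Proof.
elim: n f g => [|n IHn] f g Cf Cg.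
  by case: Cf Cg => cf _ [cg _]; split=> // x; apply: cvgM; [exact: cf|exact: cg].
split=> [x|v].
  by apply: cvgM; [exact: (is_Cn_continuous Cf)|exact: (is_Cn_continuous Cg)].
have [cf /(_ v) [dfv Cfv]] := Cf; have [cg /(_ v) [dgv Cgv]] := Cg.
split=> [x|]; first exact: derivableM.
rewrite (_ : 'D_v _ = (fun x => f x * 'D_v g x + g x * 'D_v f x)).
  by apply: is_CnD; apply: IHn => //; exact: is_CnW.
by apply/funext => x; exact: deriveM.
Qed.

Lemma is_CnV (V : normedModType R) n (f : V -> R) : (forall x, f x != 0) ->
  is_Cn n f -> is_Cn n (fun x => (f x)^-1).
Proof.
move=> f0; elim: n => [|n IHn] Cf.
  by case: Cf => cf _; split=> // x; apply: cvgV => //; exact: cf.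
split=> [x|v]; first by apply: cvgV => //; exact: (is_Cn_continuous Cf).
have [cf /(_ v) [dfv Cfv]] := Cf.
split=> [x|]; first exact: derivableV.
rewrite (_ : 'D_v _ = (fun x => -1 * ((f x)^-1 * (f x)^-1 * 'D_v f x))).
  apply: is_CnM; first exact: is_Cn_cst.
  by apply: is_CnM => //; apply: is_CnM; apply: IHn; exact: is_CnW.
by apply/funext => x; rewrite deriveV// /GRing.scale/= mulN1r mulNr -invfM expr2.
Qed.

(** The difference quotient of [f (c * x + d)] in direction [v] is literally that of [f] in
    direction [c * v], so that no chain rule is needed and [c = 0] is no exception. *)
Lemma is_Cn_affine n (f : R -> R) (c d : R) :
  is_Cn n f -> is_Cn n (fun x => f (c * x + d)).
Proof.
have caff : continuous (fun x : R => c * x + d).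
  by move=> x; apply: cvgD; [apply: cvgMr; exact: cvg_id|exact: cvg_cst].
elim: n f => [|n IHn] f Cf.
  split=> // x; apply: (@continuous_comp _ _ _ (fun x => c * x + d) f).
    exact: caff.
  exact: (is_Cn_continuous Cf).
split=> [x|v].
  apply: (@continuous_comp _ _ _ (fun x => c * x + d) f); first exact: caff.
  exact: (is_Cn_continuous Cf).
have [_ /(_ (c * v)) [dfv Cfv]] := Cf.
have E x : (fun h : R => h^-1 *: (((fun x => f (c * x + d)) \o shift x) (h *: v) -
    f (c * x + d))) =
  (fun h => h^-1 *: ((f \o shift (c * x + d)) (h *: (c * v)) - f (c * x + d))).
  apply/funext => h /=; congr (_ *: (f _ - _)).
  by rewrite /= /GRing.scale /=; ring.
split=> [x|]; first by rewrite /derivable E; exact: dfv.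
rewrite (_ : 'D_v _ = (fun x => 'D_(c * v) f (c * x + d))).
  exact: IHn Cfv.
by apply/funext => x; rewrite /derive E.
Qed.

Lemma is_Cn_fst n (f : R -> R) : is_Cn n f -> is_Cn n (fun z : R * R => f z.1).
Proof.
elim: n f => [|n IHn] f Cf.
  split=> // x; apply: (@continuous_comp _ _ _ fst f); first exact: cvg_fst.
  exact: (is_Cn_continuous Cf).
split=> [x|v].
  apply: (@continuous_comp _ _ _ fst f); first exact: cvg_fst.
  exact: (is_Cn_continuous Cf).
have [_ /(_ v.1) [dfv Cfv]] := Cf.
by split=> [x|]; [exact: dfv|exact: IHn _ Cfv].
Qed.

Lemma is_Cn_snd n (f : R -> R) : is_Cn n f -> is_Cn n (fun z : R * R => f z.2).
Proof.
elim: n f => [|n IHn] f Cf.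
  split=> // x; apply: (@continuous_comp _ _ _ snd f); first exact: cvg_snd.
  exact: (is_Cn_continuous Cf).
split=> [x|v].
  apply: (@continuous_comp _ _ _ snd f); first exact: cvg_snd.
  exact: (is_Cn_continuous Cf).
have [_ /(_ v.2) [dfv Cfv]] := Cf.
by split=> [x|]; [exact: dfv|exact: IHn _ Cfv].
Qed.

End Cn_closure.

Section smooth_step.
Context {R : realType}.

(** Up to linear combinations, this family is stable under differentiation, so
    that all derivatives of [exp (- 1/x)] are handled at once. *)
Definition flat (k : nat) (x : R) : R :=
  if 0 < x then x ^- k * expR (- x^-1) else 0.

Lemma flat_ge0 k x : 0 <= flat k x.
Proof.
rewrite /flat; case: ifPn => // x0.
by rewrite mulr_ge0 ?expR_ge0// invr_ge0 exprn_ge0// ltW.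
Qed.

Lemma flat_gt0 k x : (0 < flat k x) = (0 < x).
Proof.
rewrite /flat; case: ifPn => [x0|]; last by rewrite ltxx.
by rewrite mulr_gt0 ?expR_gt0// invr_gt0 exprn_gt0.
Qed.

Lemma flat_le0 k x : x <= 0 -> flat k x = 0.
Proof. by move=> x0; rewrite /flat ltNge x0. Qed.

(** Keeping only the term of degree [k + 2] of the exponential series at [1/x] bounds [exp (- 1/x)]
    by [(k + 2)! x^(k + 2)]. Two spare powers of [x] are what makes the difference quotient at [0]
    vanish in the limit. *)
Lemma flat_quadratic k x : flat k x <= (k.+2)`!%:R * x ^+ 2.
Proof.
rewrite /flat; case: ifPn => x0; last by rewrite mulr_ge0// sqr_ge0.
have xk0 : 0 < x ^- k.+2 by rewrite invr_gt0 exprn_gt0.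
have kf0 : 0 < (k.+2)`!%:R :> R by rewrite ltr0n fact_gt0.
have H : x ^- k.+2 / (k.+2)`!%:R <= expR x^-1.
  have := @expR_ge1Dxn R x^-1 k.+1; rewrite invr_ge0 => /(_ (ltW x0)).
  by apply: le_trans; rewrite -exprVn lerDr.
rewrite expRN ler_pdivrMr ?expR_gt0//.
have -> : x ^- k = x ^- k.+2 * x ^+ 2.
  by rewrite -[k.+2]addn2 exprD invfM -mulrA mulVf ?mulr1// expf_neq0// gt_eqF.
rewrite mulrAC; apply: ler_wpM2r; first exact: sqr_ge0.
by rewrite -ler_pdivrMl// mulrC.
Qed.

Lemma is_derive_flat (k : nat) (x : R) :
  is_derive x (1 : R) (flat k) (flat k.+2 x - k%:R * flat k.+1 x).
Proof.
have [x0|x0|->] := ltgtP x 0.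
- rewrite !flat_le0 ?ltW// mulr0 subr0.
  apply: (@near_eq_is_derive R R R (cst 0) (flat k)).
    near=> y; rewrite /= flat_le0//; near: y.
  by apply: filterS (lt_nbhsl x0) => y /ltW.
- apply: (@near_eq_is_derive R R R (fun y => y ^- k * expR (- y^-1))).
    by near=> y; rewrite /flat ifT//; near: y; exact: lt_nbhsr.
  have xn0 : x != 0 by rewrite gt_eqF.
  have d1 : is_derive x (1 : R) (fun y : R => y^-1) (- x ^- 2).
    apply: DeriveDef; first exact: derivableV.
    by rewrite deriveV// derive_id /GRing.scale/= mulr1.
  have d2 : is_derive x (1 : R) (fun y : R => y ^- k) (- (k%:R * x ^- k.+1)).
    have dX : is_derive x (1 : R) (fun y : R => y ^+ k) (k%:R * x ^+ k.-1).
      apply: DeriveDef; first exact: exprn_derivable.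
      by rewrite exp_derive /GRing.scale/= mulr1.
    apply: DeriveDef.
      by apply: derivableV; [rewrite expf_neq0|exact: ex_derive].
    rewrite deriveV ?expf_neq0//.
    rewrite derive_val /GRing.scale/= mulNr; congr (- _).
    case: k {dX} => [|k]; first by rewrite !mul0r mulr0.
    rewrite mulrCA; congr (_ * _); rewrite -exprM -mulrC /=.
    have -> : (k.+1 * 2 = k + k.+2)%N by rewrite muln2 -addnn addSnnS.
    by rewrite exprD invfM mulrA mulfV ?mul1r// expf_neq0.
  have d3 : is_derive x (1 : R) (fun y : R => expR (- y^-1)) (expR (- x^-1) * x ^- 2).
    have dN : is_derive x (1 : R) (fun y : R => - y^-1) (x ^- 2).
      by rewrite -[x ^- 2]opprK; exact: is_deriveN.
    exact: (@is_derive1_comp _ expR (fun y => - y^-1)).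
  rewrite /flat x0; apply: is_derive_eq.
  rewrite /GRing.scale/=.
  have -> : x ^- k.+2 = x ^- k * x ^- 2 by rewrite -[k.+2]addn2 exprD invfM.
  move: (x ^- k) (x ^- 2) (x ^- k.+1) (expR _) => A B C E; ring.
- rewrite !flat_le0// mulr0 subr0.
  have H : (fun h : R => h^-1 *: ((flat k \o shift 0) (h *: 1) - flat k 0))
      @ 0^' --> (0 : R).
    rewrite (flat_le0 k (lexx 0)).
    apply/cvgrPdist_le => e e0.
    have [C C0 HC] : exists2 C : R, 0 < C & forall h, flat k h <= C * h ^+ 2.
      by exists (k.+2)`!%:R; [rewrite ltr0n fact_gt0|exact: flat_quadratic].
    near=> h.
    have h0 : h != 0 by near: h; exact: nbhs_dnbhs_neq.
    rewrite sub0r normrN subr0 /= addr0 /GRing.scale/= mulr1 normrM.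
    rewrite (ger0_norm (flat_ge0 _ _)).
    rewrite normfV ler_pdivrMl ?normr_gt0//; apply: (le_trans (HC h)).
    rewrite -real_normK ?num_real// expr2 mulrA mulrC ler_wpM2l//.
    rewrite mulrC -ler_pdivlMr//; near: h.
    apply: dnbhs0_le; exact: divr_gt0.
  by apply: DeriveDef; [apply/cvg_ex; exists 0|exact/cvg_lim].
Unshelve. all: by end_near. Qed.

Lemma is_Cn_flat n k : is_Cn n (flat k).
Proof.
have cf j : continuous (flat j).
  move=> x; apply/differentiable_continuous/derivable1_diffP.
  by have [] := is_derive_flat j x.
elim: n k => [|n IHn] k; first by split.
split=> // v; have df x : differentiable (flat k) x.
  by apply/derivable1_diffP; have [] := is_derive_flat k x.
split=> [x|]; first exact: diff_derivable.
rewrite (_ : 'D_v _ =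
    (fun x => v * (flat k.+2 x + (- k%:R) * flat k.+1 x))).
  apply: is_CnM; first exact: is_Cn_cst.
  by apply: is_CnD => //; apply: is_CnM => //; exact: is_Cn_cst.
apply/funext => x; rewrite deriveE// -[in LHS](mulr1 v) -[v * 1]/(v *: (1 : R)).
rewrite linearZ/= -deriveE//; congr (_ * _).
by have [_ ->] := is_derive_flat k x; rewrite mulNr.
Qed.

(** Smooth transition from 0 on the left of 0 to 1 on the right of 1. The denominator never
    vanishes, as [x] or [1 - x] is positive. *)
Definition step (x : R) : R := flat 0 x / (flat 0 x + flat 0 (1 - x)).

Let step_den x : 0 < flat 0 x + flat 0 (1 - x).
Proof.
have [x0|x0] := ltP 0 x.
  by rewrite ltr_wpDr ?flat_ge0// flat_gt0.
by rewrite ltr_wpDl ?flat_ge0// flat_gt0; lra.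
Qed.

Lemma step_ge0 x : 0 <= step x.
Proof. by rewrite divr_ge0 ?flat_ge0// ltW. Qed.

Lemma step_le1 x : step x <= 1.
Proof. by rewrite ler_pdivrMr// mul1r lerDl flat_ge0. Qed.

Lemma step_le0 x : x <= 0 -> step x = 0.
Proof. by move=> x0; rewrite /step flat_le0// mul0r. Qed.

Lemma step_ge1 x : 1 <= x -> step x = 1.
Proof.
move=> x1; rewrite /step (@flat_le0 _ (1 - x)); last by lra.
by rewrite addr0 divff// gt_eqF// flat_gt0; lra.
Qed.

Lemma is_Cn_step n : is_Cn n step.
Proof.
apply: is_CnM; first exact: is_Cn_flat.
apply: is_CnV => [x|]; first by rewrite gt_eqF.
apply: is_CnD; first exact: is_Cn_flat.
rewrite (_ : (fun x => _) = (fun x => flat 0 (-1 * x + 1))).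
  by apply: is_Cn_affine; exact: is_Cn_flat.
by apply/funext => x; rewrite mulN1r addrC.
Qed.

End smooth_step.

(** * Integrals of complex-valued functions *)

Section complex_arithmetic.
Context {R : realType}.
Implicit Types z w : R[i].

Lemma complex_eq z w : Re z = Re w -> Im z = Im w -> z = w.
Proof. by case: z w => [a b] [c d] /= -> ->. Qed.

Lemma Re_add z w : Re (z + w) = Re z + Re w. Proof. by case: z w => [? ?] []. Qed.
Lemma Im_add z w : Im (z + w) = Im z + Im w. Proof. by case: z w => [? ?] []. Qed.
Lemma Re_opp z : Re (- z) = - Re z. Proof. by case: z. Qed.
Lemma Im_opp z : Im (- z) = - Im z. Proof. by case: z. Qed.
Lemma Re_sub z w : Re (z - w) = Re z - Re w.
Proof. by rewrite Re_add Re_opp. Qed.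
Lemma Im_sub z w : Im (z - w) = Im z - Im w.
Proof. by rewrite Im_add Im_opp. Qed.
Lemma Re_mul z w : Re (z * w) = Re z * Re w - Im z * Im w.
Proof. by case: z w => [? ?] []. Qed.
Lemma Im_mul z w : Im (z * w) = Re z * Im w + Im z * Re w.
Proof. by case: z w => [? ?] []. Qed.
Definition complexE := (Re_add, Im_add, Re_opp, Im_opp, Re_mul, Im_mul).

Lemma cmodulus_ge0 z : 0 <= cmodulus z.
Proof. by case: z => a b; rewrite /cmodulus /= sqrtr_ge0. Qed.

Lemma normr_Re_le z : `|Re z| <= cmodulus z.
Proof.
case: z => a b; rewrite /cmodulus /= -sqrtr_sqr ler_wsqrtr// lerDl.
exact: sqr_ge0.
Qed.

Lemma normr_Im_le z : `|Im z| <= cmodulus z.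
Proof.
case: z => a b; rewrite /cmodulus /= -sqrtr_sqr ler_wsqrtr// lerDr.
exact: sqr_ge0.
Qed.

Lemma cmodulus_le z : cmodulus z <= `|Re z| + `|Im z|.
Proof.
case: z => a b; rewrite /cmodulus /= -[leRHS]ger0_norm ?addr_ge0//.
rewrite -sqrtr_sqr ler_wsqrtr// sqrrD !real_normK ?num_real//.
by rewrite -addrA lerD2l lerDr mulrn_wge0// mulr_ge0.
Qed.

Lemma cmodulusM z w : cmodulus (z * w) = cmodulus z * cmodulus w.
Proof. exact: Normc.normcM. Qed.

Lemma cmodulusD z w : cmodulus (z + w) <= cmodulus z + cmodulus w.
Proof. exact: le_normcD. Qed.

Lemma cmodulusN z : cmodulus (- z) = cmodulus z.
Proof. exact: normcN. Qed.

Lemma cmodulusB z w : cmodulus (z - w) <= cmodulus z + cmodulus w.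
Proof. by rewrite -[in leRHS](cmodulusN w) cmodulusD. Qed.

Lemma cmodulus_real (x : R) : cmodulus x%:C%C = `|x|.
Proof. by rewrite /cmodulus /= expr0n addr0 sqrtr_sqr. Qed.

Lemma cmodulus0 : cmodulus (0 : R[i]) = 0.
Proof. exact: Normc.normc0. Qed.

Lemma cmodulus_eq0 z : cmodulus z = 0 -> z = 0.
Proof. exact: Normc.eq0_normc. Qed.

End complex_arithmetic.

Section cmeasurable.
Context {R : realType} d (T : measurableType d).
Implicit Types (D : set T) (f g : T -> R[i]).

Lemma cmeasurable_cst D c : cmeasurable_on D (fun _ : T => c : R[i]).
Proof. by split; exact: measurable_cst. Qed.

Lemma cmeasurableD D f g : cmeasurable_on D f -> cmeasurable_on D g ->
  cmeasurable_on D (fun x => f x + g x).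
Proof.
move=> [f1 f2] [g1 g2]; split.
- under eq_fun do rewrite Re_add; exact: measurable_funD.
- under eq_fun do rewrite Im_add; exact: measurable_funD.
Qed.

Lemma cmeasurableN D f : cmeasurable_on D f -> cmeasurable_on D (fun x => - f x).
Proof.
move=> [f1 f2]; split.
- by under eq_fun do rewrite Re_opp; exact: measurableT_comp.
- by under eq_fun do rewrite Im_opp; exact: measurableT_comp.
Qed.

Lemma cmeasurableB D f g : cmeasurable_on D f -> cmeasurable_on D g ->
  cmeasurable_on D (fun x => f x - g x).
Proof. by move=> mf mg; apply: cmeasurableD => //; exact: cmeasurableN. Qed.

Lemma cmeasurableM D f g : cmeasurable_on D f -> cmeasurable_on D g ->
  cmeasurable_on D (fun x => f x * g x).
Proof.
move=> [f1 f2] [g1 g2]; split.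
- by under eq_fun do rewrite Re_mul; apply: measurable_funB; exact: measurable_funM.
- by under eq_fun do rewrite Im_mul; apply: measurable_funD; exact: measurable_funM.
Qed.

Lemma cmeasurable_real D (h : T -> R) : measurable_fun D h ->
  cmeasurable_on D (fun x => (h x)%:C%C).
Proof. by move=> mh; split => //=; exact: measurable_cst. Qed.

Lemma measurable_cmodulus D f : cmeasurable_on D f ->
  measurable_fun D (fun x => cmodulus (f x)).
Proof.
move=> [f1 f2]; rewrite (_ : (fun x => _) =
    (fun x => Num.sqrt (Re (f x) ^+ 2 + Im (f x) ^+ 2))); last first.
  by apply/funext => x; rewrite /cmodulus; case: (f x).
apply: (@measurableT_comp _ _ _ _ _ _ (@Num.sqrt R)).
  by apply: continuous_measurable_fun; exact: sqrt_continuous.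
by apply: measurable_funD; exact: measurable_funX.
Qed.

Lemma cmeasurableS D E f : measurable E -> D `<=` E ->
  cmeasurable_on E f -> cmeasurable_on D f.
Proof. by move=> mE DE [f1 f2]; split; exact: measurable_funS DE _. Qed.

(** Extension by zero, to move integrals over [D] to the full space, where the Fubini lemmas below
    are stated. *)
Definition crestrict D f x : R[i] := if x \in D then f x else 0.

Lemma Re_crestrict D f : (fun x => Re (crestrict D f x)) = (fun x => Re (f x)) \_ D.
Proof. by apply/funext => x; rewrite patchE /crestrict; case: ifP. Qed.

Lemma Im_crestrict D f : (fun x => Im (crestrict D f x)) = (fun x => Im (f x)) \_ D.
Proof. by apply/funext => x; rewrite patchE /crestrict; case: ifP. Qed.

Lemma crestrict_in D f x : D x -> crestrict D f x = f x.
Proof. by move=> Dx; rewrite /crestrict mem_set. Qed.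

Lemma crestrict_out D f x : ~ D x -> crestrict D f x = 0.
Proof. by move=> Dx; rewrite /crestrict memNset. Qed.

Lemma cmeasurable_crestrict D f : measurable D -> cmeasurable_on D f ->
  cmeasurable_on setT (crestrict D f).
Proof.
move=> mD [f1 f2]; split; rewrite (Re_crestrict, Im_crestrict);
  exact/(measurable_restrictT _ _).1.
Qed.

Lemma eq_cmeasurable D f g : {in D, f =1 g} -> cmeasurable_on D f ->
  cmeasurable_on D g.
Proof.
move=> fg [f1 f2]; split.
- by apply: eq_measurable_fun f1 => x xD; rewrite fg.
- by apply: eq_measurable_fun f2 => x xD; rewrite fg.
Qed.

End cmeasurable.

Section cintegrable.
Context {R : realType} d (T : measurableType d).
Variable mu : {measure set T -> \bar R}.
Implicit Types (D : set T) (f g : T -> R[i]).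

Definition cintegrable D f :=
  mu.-integrable D (EFin \o (fun x => Re (f x))) /\
  mu.-integrable D (EFin \o (fun x => Im (f x))).

Lemma cintegrable_cmeasurable D f : cintegrable D f -> cmeasurable_on D f.
Proof. by move=> [/measurable_int/measurable_EFinP ? /measurable_int/measurable_EFinP]. Qed.

Lemma le_cintegrable D f (h : T -> R) : measurable D -> cmeasurable_on D f ->
  (forall x, D x -> cmodulus (f x) <= h x) ->
  mu.-integrable D (EFin \o h) -> cintegrable D f.
Proof.
move=> mD [f1 f2] fh ih; split; apply: le_integrable ih => //.
- exact/measurable_EFinP.
- by move=> x Dx; rewrite lee_fin (le_trans (normr_Re_le _))// (le_trans (fh _ Dx)) ?ler_norm.
- exact/measurable_EFinP.
- by move=> x Dx; rewrite lee_fin (le_trans (normr_Im_le _))// (le_trans (fh _ Dx)) ?ler_norm.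
Qed.

Lemma cintegrable_norm D f : measurable D -> cintegrable D f ->
  mu.-integrable D (EFin \o (fun x => cmodulus (f x))).
Proof.
move=> mD fi; have [i1 i2] := fi; have mf := cintegrable_cmeasurable fi.
apply: (@le_integrable _ _ _ _ _ _ _
    ((EFin \o (Num.norm \o (fun x => Re (f x)))) \+ (EFin \o (Num.norm \o (fun x => Im (f x)))))) => //.
- exact/measurable_EFinP/measurable_cmodulus.
- move=> x Dx; rewrite /= lee_fin ger0_norm ?cmodulus_ge0//.
  by rewrite (le_trans (cmodulus_le _))// ler_norm.
- by apply: integrableD => //; exact: integrable_norm.
Qed.

Lemma cintegrableD D f g : measurable D -> cintegrable D f -> cintegrable D g ->
  cintegrable D (fun x => f x + g x).
Proof.
move=> mD [f1 f2] [g1 g2]; split.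
- rewrite (_ : _ \o _ = (EFin \o (fun x => Re (f x))) \+ (EFin \o (fun x => Re (g x)))).
    exact: integrableD.
  by apply/funext => x; rewrite /= Re_add EFinD.
- rewrite (_ : _ \o _ = (EFin \o (fun x => Im (f x))) \+ (EFin \o (fun x => Im (g x)))).
    exact: integrableD.
  by apply/funext => x; rewrite /= Im_add EFinD.
Qed.

Lemma cintegrableN D f : measurable D -> cintegrable D f ->
  cintegrable D (fun x => - f x).
Proof.
move=> mD [f1 f2]; split.
- rewrite (_ : _ \o _ = -%E \o (EFin \o (fun x => Re (f x)))).
    exact: integrableN.
  by apply/funext => x; rewrite /= Re_opp EFinN.
- rewrite (_ : _ \o _ = -%E \o (EFin \o (fun x => Im (f x)))).
    exact: integrableN.
  by apply/funext => x; rewrite /= Im_opp EFinN.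
Qed.

Lemma cintegrableB D f g : measurable D -> cintegrable D f -> cintegrable D g ->
  cintegrable D (fun x => f x - g x).
Proof. by move=> mD fi gi; apply: cintegrableD => //; exact: cintegrableN. Qed.

Lemma cintegrableM_bounded D f g (M : R) : measurable D -> cmeasurable_on D f ->
  (forall x, D x -> cmodulus (f x) <= M) ->
  cintegrable D g -> cintegrable D (fun x => f x * g x).
Proof.
move=> mD mf fM gi; apply: (@le_cintegrable _ _ (fun x => M * cmodulus (g x))) => //.
- by apply: cmeasurableM => //; exact: cintegrable_cmeasurable.
- by move=> x Dx; rewrite cmodulusM ler_wpM2r ?cmodulus_ge0// fM.
- exact: (integrableZl mD M (cintegrable_norm mD gi)).
Qed.

Lemma cintegrableZ D c f : measurable D -> cintegrable D f ->
  cintegrable D (fun x => c * f x).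
Proof.
move=> mD; apply: (@cintegrableM_bounded _ _ _ (cmodulus c)) => //.
Qed.

Lemma cintegrableS D E f : measurable E -> measurable D -> D `<=` E ->
  cintegrable E f -> cintegrable D f.
Proof. by move=> mE mD DE [f1 f2]; split; exact: integrableS DE _. Qed.

Lemma cintegralD D f g : measurable D -> cintegrable D f -> cintegrable D g ->
  cintegral mu D (fun x => f x + g x) = cintegral mu D f + cintegral mu D g.
Proof.
move=> mD [f1 f2] [g1 g2]; rewrite /cintegral; apply: complex_eq.
- by rewrite Re_add/=; under eq_Rintegral do rewrite Re_add; exact: RintegralD.
- by rewrite Im_add/=; under eq_Rintegral do rewrite Im_add; exact: RintegralD.
Qed.

Lemma cintegralZ D c f : measurable D -> cintegrable D f ->
  cintegral mu D (fun x => c * f x) = c * cintegral mu D f.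
Proof.
move=> mD [f1 f2]; rewrite /cintegral; apply: complex_eq.
- rewrite Re_mul/=; under eq_Rintegral do rewrite Re_mul.
  rewrite RintegralB ?RintegralZl//.
    exact: (integrableZl mD _ f1).
  exact: (integrableZl mD _ f2).
- rewrite Im_mul/=; under eq_Rintegral do rewrite Im_mul.
  rewrite RintegralD ?RintegralZl//.
    exact: (integrableZl mD _ f2).
  exact: (integrableZl mD _ f1).
Qed.

Lemma cintegralN D f : measurable D -> cintegrable D f ->
  cintegral mu D (fun x => - f x) = - cintegral mu D f.
Proof.
move=> mD fi; rewrite -mulN1r -cintegralZ//; congr cintegral.
by apply/funext => x; rewrite mulN1r.
Qed.

Lemma cintegralB D f g : measurable D -> cintegrable D f -> cintegrable D g ->
  cintegral mu D (fun x => f x - g x) = cintegral mu D f - cintegral mu D g.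
Proof.
move=> mD fi gi; rewrite cintegralD//; last exact: cintegrableN.
by rewrite cintegralN.
Qed.

Lemma eq_cintegral D f g : {in D, f =1 g} -> cintegral mu D f = cintegral mu D g.
Proof.
move=> fg; congr (_ +i* _)%C; apply: eq_Rintegral => x xD; by rewrite fg.
Qed.

Lemma ae_eq_cintegral D f g : measurable D -> cmeasurable_on D f ->
  cmeasurable_on D g -> ae_eq mu D f g -> cintegral mu D f = cintegral mu D g.
Proof.
move=> mD [f1 f2] [g1 g2] fg; congr (_ +i* _)%C; congr fine; apply: ae_eq_integral => //.
- exact/measurable_EFinP.
- exact/measurable_EFinP.
- by apply: filterS fg => x /[apply] ->.
- exact/measurable_EFinP.
- exact/measurable_EFinP.
- by apply: filterS fg => x /[apply] ->.
Qed.

Lemma cintegral_crestrict D f : cintegral mu D f = cintegral mu setT (crestrict D f).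
Proof. by rewrite /cintegral !(@Rintegral_mkcond _ _ _ mu D) -Re_crestrict -Im_crestrict. Qed.

Lemma cintegrable_crestrict D f : measurable D ->
  cintegrable D f <-> cintegrable setT (crestrict D f).
Proof.
move=> mD; rewrite /cintegrable.
rewrite Re_crestrict Im_crestrict -!restrict_EFin.
by split=> -[f1 f2]; split; apply/(integrable_mkcond _ mD).
Qed.

(** The factor 2 is the price of bounding the real and imaginary parts separately; it is the origin
    of the factors 2 in the later estimates of [prim] and [Gop]. *)
Lemma cmodulus_cintegral_le D f (h : T -> R) : measurable D -> cmeasurable_on D f ->
  (forall x, D x -> cmodulus (f x) <= h x) -> mu.-integrable D (EFin \o h) ->
  cmodulus (cintegral mu D f) <= 2 * \int[mu]_(x in D) h x.
Proof.
move=> mD mf fh ih; have [f1 f2] := le_cintegrable mD mf fh ih.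
rewrite (le_trans (cmodulus_le _))//= mulr2n mulrDl mul1r lerD//.
- rewrite (le_trans (le_normr_Rintegral _ _))//; apply: le_Rintegral => //.
    exact: integrable_norm.
  by move=> x Dx; rewrite (le_trans (normr_Re_le _))// fh.
- rewrite (le_trans (le_normr_Rintegral _ _))//; apply: le_Rintegral => //.
    exact: integrable_norm.
  by move=> x Dx; rewrite (le_trans (normr_Im_le _))// fh.
Qed.

Lemma Rintegral_dominated_cvg D (f_ : (T -> R)^nat) (f g : T -> R) :
  measurable D -> (forall n, measurable_fun D (f_ n)) -> measurable_fun D f ->
  (forall x, D x -> f_ n x @[n --> \oo] --> f x) ->
  mu.-integrable D (EFin \o g) -> (forall n x, D x -> `|f_ n x| <= g x) ->
  \int[mu]_(x in D) f_ n x @[n --> \oo] --> \int[mu]_(x in D) f x.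
Proof.
move=> mD mf_ mf ff gi fg.
have gi' : mu.-integrable D (EFin \o (fun x => `|g x|)) by exact: integrable_norm.
have h3 : {ae mu, forall x, D x -> (EFin \o f_ n) x @[n --> \oo] --> (EFin \o f) x}.
  by apply/nearW => x Dx; apply/fine_cvgP; split; [exact: nearW|exact: ff].
have h5 : {ae mu, forall x n, D x -> (`|(EFin \o f_ n) x| <= (EFin \o g) x)%E}.
  by apply/nearW => x n Dx; rewrite /= lee_fin fg.
have h1 n : measurable_fun D (EFin \o f_ n) by exact/measurable_EFinP.
have h2 : measurable_fun D (EFin \o f) by exact/measurable_EFinP.
have [fi _ H] := dominated_convergence mD h1 h2 h3 gi h5.
apply: fine_cvg; rewrite fineK//; exact: integrable_fin_num.
Qed.

End cintegrable.

Section cintegral_limits.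
Context {R : realType} d (T : measurableType d).
Variable mu : {measure set T -> \bar R}.

Lemma cintegral_dominated_cvg (D : set T) (f_ : nat -> T -> R[i]) (f : T -> R[i])
    (g : T -> R) :
  measurable D -> (forall n, cmeasurable_on D (f_ n)) -> cmeasurable_on D f ->
  (forall x, D x -> Re (f_ n x) @[n --> \oo] --> Re (f x)) ->
  (forall x, D x -> Im (f_ n x) @[n --> \oo] --> Im (f x)) ->
  mu.-integrable D (EFin \o g) -> (forall n x, D x -> cmodulus (f_ n x) <= g x) ->
  Re (cintegral mu D (f_ n)) @[n --> \oo] --> Re (cintegral mu D f) /\
  Im (cintegral mu D (f_ n)) @[n --> \oo] --> Im (cintegral mu D f).
Proof.
move=> mD mf_ mf ReC ImC gi fg; split.
- apply: (@Rintegral_dominated_cvg _ _ _ _ _ _ _ g) => //.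
  + by move=> n; have [] := mf_ n.
  + by case: mf.
  + by move=> n x Dx; rewrite (le_trans (normr_Re_le _))// fg.
- apply: (@Rintegral_dominated_cvg _ _ _ _ _ _ _ g) => //.
  + by move=> n; have [] := mf_ n.
  + by case: mf.
  + by move=> n x Dx; rewrite (le_trans (normr_Im_le _))// fg.
Qed.

End cintegral_limits.

(** * Fubini's theorem for real and complex integrals *)

Section Rintegral_fubini.
Context {R : realType} d1 d2 (T1 : measurableType d1) (T2 : measurableType d2).
Variable m1 : {sigma_finite_measure set T1 -> \bar R}.
Variable m2 : {sigma_finite_measure set T2 -> \bar R}.
Variable f : T1 * T2 -> R.
Hypothesis fi : (m1 \x m2)%E.-integrable setT (EFin \o f).

(** The inner integral may be infinite for a null set of [x]. There [fine] returns 0, which can only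
    decrease the absolute value, so integrability follows by domination. *)
Lemma integrable_Rintegral1 :
  m1.-integrable setT (EFin \o (fun x => \int[m2]_y f (x, y))).
Proof.
have iF := integrable_fubini_F fi.
apply: (le_integrable measurableT _ _ iF).
  apply/measurable_EFinP; apply: measurableT_comp => //.
  exact: measurable_int iF.
by move=> x _ /=; rewrite /fubini_F /Rintegral; case: (integral _ _ _) => //= *;
  rewrite ?normr0 ?leey.
Qed.

Lemma Rintegral_fubini1 :
  \int[m1]_x \int[m2]_y f (x, y) = \int[(m1 \x m2)%E]_z f z.
Proof.
rewrite /Rintegral -(integral12_prod_meas1 fi); congr fine.
have iF := integrable_fubini_F fi.
apply: ae_eq_integral => //.
- exact: measurable_int integrable_Rintegral1.
- exact: measurable_int iF.
- by have := integrable_ae measurableT iF; apply: filterS => x /[apply] /fineK.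
Qed.

Lemma integrable_fubini_G : m2.-integrable setT (fubini_G m1 (EFin \o f)).
Proof.
have mf := measurable_int _ fi; have maf : measurable_fun setT (abse \o (EFin \o f)).
  exact: measurableT_comp.
apply/integrableP; split; first exact: (measurable_fubini_G fi).
apply: le_lt_trans ((integrable21ltyP m1 m2 mf).1 fi).
apply: ge0_le_integral => //.
- by apply: measurableT_comp => //; exact: (measurable_fubini_G fi).
- apply: (measurable_fun_fubini_tonelli_G (abse \o (EFin \o f))) => // z.
  exact: abse_ge0.
- move=> y _; apply: le_abse_integral => //.
  exact: measurableT_comp.
Qed.

Lemma integrable_Rintegral2 :
  m2.-integrable setT (EFin \o (fun y => \int[m1]_x f (x, y))).
Proof.
have iF := integrable_fubini_G.
apply: (le_integrable measurableT _ _ iF).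
  apply/measurable_EFinP; apply: measurableT_comp => //.
  exact: measurable_int iF.
by move=> x _ /=; rewrite /fubini_G /Rintegral; case: (integral _ _ _) => //= *;
  rewrite ?normr0 ?leey.
Qed.

Lemma Rintegral_fubini2 :
  \int[m2]_y \int[m1]_x f (x, y) = \int[(m1 \x m2)%E]_z f z.
Proof.
rewrite /Rintegral -(integral21_prod_meas1 fi); congr fine.
have iF := integrable_fubini_G.
apply: ae_eq_integral => //.
- exact: measurable_int integrable_Rintegral2.
- exact: measurable_int iF.
- by have := integrable_ae measurableT iF; apply: filterS => x /[apply] /fineK.
Qed.

End Rintegral_fubini.

Section cintegral_fubini.
Context {R : realType} d1 d2 (T1 : measurableType d1) (T2 : measurableType d2).
Variable m1 : {sigma_finite_measure set T1 -> \bar R}.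
Variable m2 : {sigma_finite_measure set T2 -> \bar R}.
Variable f : T1 * T2 -> R[i].
Hypothesis fi : cintegrable (m1 \x m2)%E setT f.

Lemma cintegrable_fubini1 :
  cintegrable m1 setT (fun x => cintegral m2 setT (fun y => f (x, y))).
Proof.
case: fi => f1 f2; split.
  exact: (integrable_Rintegral1 f1).
exact: (integrable_Rintegral1 f2).
Qed.

Lemma cintegrable_fubini2 :
  cintegrable m2 setT (fun y => cintegral m1 setT (fun x => f (x, y))).
Proof.
case: fi => f1 f2; split.
  exact: (integrable_Rintegral2 f1).
exact: (integrable_Rintegral2 f2).
Qed.

Lemma cintegral_fubini1 :
  cintegral m1 setT (fun x => cintegral m2 setT (fun y => f (x, y))) =
  cintegral (m1 \x m2)%E setT f.
Proof.
case: fi => f1 f2; congr (_ +i* _)%C.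
  exact: Rintegral_fubini1.
exact: Rintegral_fubini1.
Qed.

Lemma cintegral_fubini2 :
  cintegral m2 setT (fun y => cintegral m1 setT (fun x => f (x, y))) =
  cintegral (m1 \x m2)%E setT f.
Proof.
case: fi => f1 f2; congr (_ +i* _)%C.
  exact: Rintegral_fubini2.
exact: Rintegral_fubini2.
Qed.

End cintegral_fubini.

(** * Smooth approximations of indicators of intervals *)

Section plateau.
Context {R : realType}.
Implicit Types c x l : R.

(** Rises from 0 at [x0] to 1 at [x0 + c^-1]. As [c] grows, its derivative becomes an approximate
    identity at [x0], acting from the right. *)
Definition ramp c x0 x : R := step (c * x + - (c * x0)).

Definition plateau c x0 x1 x : R := ramp c x0 x + -1 * ramp c x1 x.

Lemma ramp_le0 c x0 x : 0 < c -> x <= x0 -> ramp c x0 x = 0.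
Proof. by move=> c0 xx0; rewrite /ramp step_le0// -mulrBr pmulr_rle0// subr_le0. Qed.

Lemma ramp_ge1 c x0 x : 0 < c -> x0 + c^-1 <= x -> ramp c x0 x = 1.
Proof.
move=> c0 xx0; rewrite /ramp step_ge1// -mulrBr -ler_pdivrMl// mulr1.
by rewrite lerBrDl.
Qed.

Lemma is_Cn_ramp n c x0 : is_Cn n (ramp c x0).
Proof. by apply: (@is_Cn_affine _ n (@step R)); exact: is_Cn_step. Qed.

Lemma is_Cn_plateau n c x0 x1 : is_Cn n (plateau c x0 x1).
Proof.
apply: is_CnD; first exact: is_Cn_ramp.
by apply: is_CnM; [exact: is_Cn_cst|exact: is_Cn_ramp].
Qed.

Lemma normr_plateau_le1 c x0 x1 x : `|plateau c x0 x1 x| <= 1.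
Proof.
rewrite /plateau /ramp ler_norml.
have := step_ge0 (c * x + - (c * x0)); have := step_le1 (c * x + - (c * x0)).
have := step_ge0 (c * x + - (c * x1)); have := step_le1 (c * x + - (c * x1)).
by move: (step _) (step _) => u v; lra.
Qed.

Lemma plateau_out c x0 x1 x : 0 < c -> x0 <= x1 ->
  x \notin `[x0, x1 + c^-1] -> plateau c x0 x1 x = 0.
Proof.
move=> c0 x01; rewrite in_itv/= negb_and -!ltNge => /orP[H|H].
  by rewrite /plateau !ramp_le0 ?mulr0 ?addr0//; lra.
by rewrite /plateau !ramp_ge1//; lra.
Qed.

(** Each ramp vanishes at its starting point and is eventually 1 to the right of it: hence an
    interval open at [x0] and closed at [x1]. The shift by [N] lets later uses start from plateaus
    steep enough to be supported in the open interval. *)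
Lemma plateau_cvg N x0 x1 x : x0 <= x1 ->
  plateau (n + N).+1%:R x0 x1 x @[n --> \oo] --> (\1_(`]x0, x1]) x : R).
Proof.
move=> x01.
have H y : y < x -> \forall n \near \oo, ramp (n + N).+1%:R y x = 1.
  move=> yx; near=> n; rewrite ramp_ge1// ?ltr0n// -lerBrDl.
  rewrite (@le_trans _ _ n.+1%:R^-1)//.
    by rewrite lef_pV2 ?posrE ?ltr0n// ler_nat ltnS leq_addr.
  by apply/ltW; near: n; apply: near_infty_natSinv_lt (PosNum _); rewrite subr_gt0.
have [xx0|xx0] := leP x x0.
  apply: cvg_near_cst; near=> n; rewrite /plateau !ramp_le0 ?ltr0n// ?(le_trans xx0)//.
  by rewrite mulr0 addr0 indicE memNset//= in_itv/= ltNge xx0.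
have [xx1|xx1] := leP x x1.
  apply: cvg_near_cst; near=> n; rewrite /plateau (@ramp_le0 _ x1) ?ltr0n// mulr0 addr0.
  rewrite indicE mem_set//= ?in_itv/= ?xx0//; near: n; exact: H.
apply: cvg_near_cst; near=> n; rewrite /plateau.
rewrite indicE memNset ?mulr0n; last by rewrite /= in_itv/= => /andP[_]; rewrite leNgt xx1.
rewrite (near (H _ xx0) n)// (near (H _ xx1) n)//; lra.
Unshelve. all: by end_near. Qed.

Lemma support_plateau c x0 x1 : 0 < c -> x0 <= x1 ->
  closure [set x | plateau c x0 x1 x != 0] `<=` `[x0, x1 + c^-1].
Proof.
move=> c0 x01; rewrite closureE => x; apply; split; first exact: interval_closed.
move=> y /= y0; apply: contra_neqT y0; exact: plateau_out.
Qed.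

Lemma test_function_plateau l c x0 x1 : 0 < c -> x0 <= x1 ->
  - l < x0 -> x1 + c^-1 < l -> test_function (Iopen l) (plateau c x0 x1).
Proof.
move=> c0 x01 lx0 x1l; have sub := support_plateau c0 x01; split.
- by move=> n; exact: is_Cn_plateau.
- apply: subclosed_compact sub => //; last exact: segment_compact.
  exact: closed_closure.
- move=> x /sub; rewrite /Iopen/= !in_itv/= => /andP[? ?]; apply/andP; split.
    exact: lt_le_trans lx0 _.
  exact: le_lt_trans x1l.
Qed.

End plateau.

Section test_functions.
Context {R : realType}.
Implicit Types l : R.

Lemma test_function_continuous (V : normedModType R) D (phi : V -> R) :
  test_function D phi -> continuous phi.
Proof. by move=> [/(_ 0%N)[]]. Qed.

Lemma test_function_derivable (V : normedModType R) D (phi : V -> R) v :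
  test_function D phi -> (forall x, derivable phi x v) /\ continuous ('D_v phi).
Proof. by move=> [/(_ 1%N)[_ /(_ v)[? []]]]. Qed.

Lemma test_function_out (V : normedModType R) D (phi : V -> R) x :
  test_function D phi -> ~ D x -> phi x = 0.
Proof.
move=> [_ _ sD] Dx; apply/eqP/negPn/negP => px; apply: Dx; apply: sD.
exact: subset_closure.
Qed.

Lemma continuous_bounded_itv (f : R -> R) a b : {within `[a, b], continuous f} ->
  exists M : R, forall x, x \in `[a, b] -> `|f x| <= M.
Proof.
move=> cf; have [ab|ba] := leP a b; last first.
  exists 0 => x; rewrite in_itv/= => /andP[ax xb].
  by have := le_lt_trans (le_trans ax xb) ba; rewrite ltxx.
have [c _ Hc] := EVT_max ab cf; have [d _ Hd] := EVT_min ab cf.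
exists (Num.max (f c) (- f d)) => x xab.
rewrite ler_norml le_max Hc// andbT lerNl le_max lerN2 orbC Hd//.
Qed.

Lemma test_function_tensor l (phi psi : R -> R) :
  test_function (Iopen l) phi -> test_function (Iopen l) psi ->
  test_function (Omega l) (fun z : R * R => phi z.1 * psi z.2).
Proof.
move=> [Cphi kphi sphi] [Cpsi kpsi spsi].
set A := closure [set x | phi x != 0]; set B := closure [set x | psi x != 0].
have sub : closure [set z : R * R | phi z.1 * psi z.2 != 0] `<=` A `*` B.
  rewrite closureE => z; apply; split.
    rewrite (_ : A `*` B = fst @^-1` A `&` snd @^-1` B)//; apply: closedI.
      by apply: closed_comp; [move=> *; exact: cvg_fst|exact: closed_closure].
    by apply: closed_comp; [move=> *; exact: cvg_snd|exact: closed_closure].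
  move=> y /=; rewrite mulf_eq0 negb_or => /andP[y1 y2].
  by split; exact: subset_closure.
split.
- by move=> n; apply: is_CnM; [exact: is_Cn_fst|exact: is_Cn_snd].
- apply: subclosed_compact sub => //; first exact: closed_closure.
  exact: compact_setX.
- by move=> z /sub [z1 z2]; split; [exact: sphi|exact: spsi].
Qed.

Lemma derive_tensor l (phi psi : R -> R) (z : R * R) :
  test_function (Iopen l) phi -> test_function (Iopen l) psi ->
  'D_(1, 0) (fun z : R * R => phi z.1 * psi z.2) z = 'D_1 phi z.1 * psi z.2.
Proof.
move=> tphi tpsi; have [dphi _] := test_function_derivable (1 : R) tphi.
have [dpsi _] := test_function_derivable (0 : R) tpsi.
have E := @deriveM R (R * R)%type (phi \o fst) (psi \o snd) z (1, 0).
have -> : (fun z : R * R => phi z.1 * psi z.2) = (phi \o fst) * (psi \o snd) by [].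
rewrite E; [|exact: dphi|exact: dpsi].
have -> : 'D_(1, 0) (phi \o fst) z = 'D_1 phi z.1 by [].
have -> : 'D_(1, 0) (psi \o snd) z = 'D_0 psi z.2 by [].
by rewrite derive0 scaler0 add0r /GRing.scale/= mulrC.
Qed.

End test_functions.

(** * The fundamental lemma of the calculus of variations *)

Section fundamental_lemma.
Context {R : realType} (l : R).
Local Notation mu := (@lebesgue_measure R).

Lemma ae_imply (P Q : R -> Prop) :
  (forall x, P x -> Q x) -> {ae mu, forall x, P x} -> {ae mu, forall x, Q x}.
Proof. by move=> PQ; exact: (@filterS _ _ (ae_filter_ringOfSetsType mu)). Qed.

Lemma ae_imply2 (P Q S : R -> Prop) : (forall x, P x -> Q x -> S x) ->
  {ae mu, forall x, P x} -> {ae mu, forall x, Q x} -> {ae mu, forall x, S x}.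
Proof. by move=> PQ; exact: (@filterS2 _ _ (ae_filter_ringOfSetsType mu)). Qed.

Lemma measurable_Iopen : measurable (Iopen l).
Proof. exact: measurable_itv. Qed.

Lemma subset_itv_Iopen x0 x1 : - l < x0 -> x1 < l -> `[x0, x1] `<=` Iopen l.
Proof.
move=> lx0 x1l y; rewrite /Iopen/= !in_itv/= => /andP[? ?]; apply/andP; split.
  exact: lt_le_trans lx0 _.
exact: le_lt_trans x1l.
Qed.

Lemma locally_integrable_itv f x0 x1 : locally_integrable (Iopen l) f ->
  - l < x0 -> x1 < l -> mu.-integrable `[x0, x1] (EFin \o f).
Proof.
move=> [mf _ kf] lx0 x1l; have s := subset_itv_Iopen lx0 x1l.
apply/integrableP; split.
  apply/measurable_EFinP; apply: measurable_funS mf => //; exact: measurable_Iopen.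
by apply: kf => //; exact: segment_compact.
Qed.

Lemma Rintegral_sub (D E : set R) (f : R -> R) : E `<=` D ->
  (forall x, D x -> ~ E x -> f x = 0) ->
  \int[mu]_(x in D) f x = \int[mu]_(x in E) f x.
Proof.
move=> ED f0; rewrite Rintegral_mkcond [RHS]Rintegral_mkcond.
apply: eq_Rintegral => x _; rewrite !patchE.
case: ifPn => [/set_mem xD|xD]; case: ifPn => //.
  by move=> /negP xE; apply: f0 => // /mem_set.
by move=> /set_mem /ED /mem_set; rewrite (negbTE xD).
Qed.

(** Dominated convergence with majorant [|f|]. All plateaus of index at least [N] live on the fixed
    segment from [x0] to [x1 + 1 / (N + 1)], where the locally integrable [f] is integrable. *)
Lemma Rintegral_plateau_cvg N x0 x1 (f : R -> R) :
  locally_integrable (Iopen l) f -> x0 <= x1 -> - l < x0 -> x1 + N.+1%:R^-1 < l ->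
  \int[mu]_(x in Iopen l) (f x * plateau (n + N).+1%:R x0 x1 x) @[n --> \oo] -->
  \int[mu]_(x in `]x0, x1]) f x.
Proof.
move=> lf x01 lx0 x1l; set b := x1 + N.+1%:R^-1.
have bi := locally_integrable_itv lf lx0 x1l.
have mf : measurable_fun `[x0, b] f by apply/measurable_EFinP; exact: measurable_int bi.
have mp n : measurable_fun `[x0, b] (plateau (n + N).+1%:R x0 x1).
  apply: measurable_funS (@measurableT _ _) _ _ => //.
  by apply: continuous_measurable_fun; exact/(is_Cn_continuous (is_Cn_plateau 0 _ _ _)).
rewrite (_ : (fun n => _) =
    (fun n => \int[mu]_(x in `[x0, b]) (f x * plateau (n + N).+1%:R x0 x1 x))).
  rewrite (_ : \int[mu]_(x in `]x0, x1]) f x =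
      \int[mu]_(x in `[x0, b]) (f x * \1_(`]x0, x1]) x)).
    apply: (@Rintegral_dominated_cvg _ _ _ mu _
      (fun n x => f x * plateau (n + N).+1%:R x0 x1 x)
      (fun x => f x * \1_(`]x0, x1]) x) (fun x => `|f x|)) => //.
    - by move=> n; apply: measurable_funM; [exact: mf|exact: mp].
    - by apply: measurable_funM => //; exact: measurable_indic.
    - by move=> x _; apply: cvgMr; exact: plateau_cvg.
    - exact: integrable_norm.
    - by move=> n x _; rewrite normrM ler_piMr// normr_plateau_le1.
  rewrite [RHS](@Rintegral_sub _ `]x0, x1]).
  - by apply: eq_Rintegral => x xx; rewrite indicE xx mulr1.
  - move=> x; rewrite /= !in_itv/= => /andP[/ltW -> H]; rewrite (le_trans H)// lerDl.
    by rewrite invr_ge0 ler0n.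
  - by move=> x _ xx; rewrite indicE memNset// mulr0.
apply/funext => n; apply: Rintegral_sub; first exact: subset_itv_Iopen.
move=> x _ xb; rewrite plateau_out ?mulr0// ?ltr0n//; apply/negP => H; apply: xb.
move: H; rewrite /= !in_itv/= => /andP[-> H]; rewrite (le_trans H)// lerD2l.
by rewrite lef_pV2 ?posrE ?ltr0n// ler_nat ltnS leq_addl.
Qed.

(** Plateaus show that [f] has integral 0 over every interval compactly contained in [Iopen l], so
    that its primitives are constant; by Lebesgue differentiation [f] vanishes almost everywhere. *)
Lemma test_functions_separate (f : R -> R) : locally_integrable (Iopen l) f ->
  (forall phi, test_function (Iopen l) phi ->
    \int[mu]_(x in Iopen l) (f x * phi x) = 0) ->
  {ae mu, forall x, Iopen l x -> f x = 0}.
Proof.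
move=> lf fphi.
have f0 x0 x1 : - l < x0 -> x0 <= x1 -> x1 < l -> \int[mu]_(x in `]x0, x1]) f x = 0.
  move=> lx0 x01 x1l; have [N NP] := ltr_add_invr x1l.
  have := Rintegral_plateau_cvg lf x01 lx0 NP.
  rewrite (_ : (fun n => _) = cst 0); first by move=> /cvg_lim <-//; rewrite lim_cst.
  apply/funext => n; apply: fphi; apply: test_function_plateau => //.
  apply: le_lt_trans NP; rewrite lerD2l.
  by rewrite lef_pV2 ?posrE ?ltr0n// ler_nat ltnS leq_addl.
(* As [f] is only locally integrable, the interval is exhausted by segments [[- c, c]]; outside such
   a segment [f] is replaced by 0 to obtain a primitive on the whole line. *)
have H k : {ae mu, forall x, `|x| < l - k.+1%:R^-1 -> f x = 0}.
  set c := l - k.+1%:R^-1.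
  have cl : c < l by rewrite /c ltrBlDr ltrDl invr_gt0 ltr0n.
  have lc : - l < - c by rewrite ltrN2.
  have fi := locally_integrable_itv lf lc cl.
  have fJ : locally_integrable setT (f \_ `[- c, c]) by exact: integrable_locally.
  have iJ y : mu.-integrable [set` Interval (BRight (- c)) (BRight y)]
      (EFin \o (f \_ `[- c, c])).
    apply: (@integrableS _ _ _ _ setT) => //.
    rewrite -restrict_EFin.
    by apply: (integrable_mkcond _ _).1 fi.
  have := FTC1 iJ fJ; apply: ae_imply => x Fx xc.
  move: xc; rewrite ltr_norml => /andP[cx xc].
  have [_] := Fx cx; rewrite patchE mem_set/=; last by rewrite in_itv/= !ltW.
  (* The derivative of the primitive is [f x] at this point, and the primitive is identically 0 near
     it. *)
  move<-; rewrite derive1E (@near_eq_derive _ _ _ _ (cst 0)) ?derive_cst//.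
  near=> y.
  have yc : y < c by near: y; exact: lt_nbhsl.
  have cy : - c < y by near: y; exact: lt_nbhsr.
  have E z : z \in [set` `]- c, y]] -> (f \_ `[- c, c]) z = f z.
    move=> /set_mem/=; rewrite in_itv/= => /andP[cz zy].
    by rewrite patchE mem_set//= in_itv/= (ltW cz) (le_trans zy)// ltW.
  etransitivity; first exact: (eq_Rintegral mu E).
  rewrite f0//; first exact: ltW.
  exact: lt_trans cl.
have := ae_foralln H; apply: ae_imply => x Hx.
rewrite /Iopen/= in_itv/= -ltr_norml => xl.
have [k kP] := ltr_add_invr xl; apply: (Hx k); by rewrite ltrBrDr.
Unshelve. all: by end_near. Qed.

End fundamental_lemma.

(** * Kernels with a bounded weak derivative *)

Section ramp_derivative.
Context {R : realType}.
Local Notation mu := (@lebesgue_measure R).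
Implicit Types c x l : R.

Lemma derivable_ramp c x0 x : derivable (ramp c x0) x 1.
Proof. by have [_ /(_ 1) []] := @is_Cn_ramp R 1 c x0. Qed.

Lemma continuous_ramp c x0 : continuous (ramp c x0).
Proof. exact: is_Cn_continuous (is_Cn_ramp 0 c x0). Qed.

Lemma continuous_derive_ramp c x0 : continuous ('D_1 (ramp c x0)).
Proof. by have [_ /(_ 1) [_ []]] := @is_Cn_ramp R 1 c x0. Qed.

Lemma derive_ramp_out c x0 x : 0 < c -> x \notin `[x0, x0 + c^-1] ->
  'D_1 (ramp c x0) x = 0.
Proof.
move=> c0; rewrite in_itv/= negb_and -!ltNge => /orP[H|H].
  rewrite (@near_eq_derive R R R _ (cst 0)) ?derive_cst//.
  near=> y; rewrite /= ramp_le0//; apply/ltW; near: y; exact: lt_nbhsl.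
rewrite (@near_eq_derive R R R _ (cst 1)) ?derive_cst//.
near=> y; rewrite /= ramp_ge1//; apply/ltW; near: y; exact: lt_nbhsr.
Unshelve. all: by end_near. Qed.

Lemma derive_ramp c x0 x :
  'D_1 (ramp c x0) x = 'D_1 (@step R) (c * x + - (c * x0)) * c.
Proof.
have d1 : is_derive x (1 : R) (fun x : R => c * x + - (c * x0)) c.
  have d2 : is_derive x (1 : R) (c \*: (id : R -> R)) (c *: (1 : R)).
    exact: is_deriveZ.
  have d3 := is_deriveD d2 (is_derive_cst (- (c * x0) : R) x (1 : R)).
  by apply: is_derive_eq d3 _; rewrite addr0 /GRing.scale/= mulr1.
have d2 : is_derive (c * x + - (c * x0)) (1 : R) (@step R)
    ('D_1 (@step R) (c * x + - (c * x0))).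
  by apply: DeriveDef => //; have [_ /(_ 1) []] := @is_Cn_step R 1.
by have [_ ->] := @is_derive1_comp _ (@step R) _ x _ _ d2 d1.
Qed.

(** [B] bounds the derivative of [step] on [[0, 1]]; rescaling multiplies it by [c]. This matches
    the width [c^-1] of the support and keeps the [L^1] norm of the derivative bounded. *)
Lemma normr_derive_ramp_le : exists B : R, 0 <= B /\
  forall c x0 x, 0 < c -> `|'D_1 (ramp c x0) x| <= B * c.
Proof.
have [B HB] : exists B : R, forall x, x \in `[0, 1] -> `|'D_1 (@step R) x| <= B.
  apply: continuous_bounded_itv; apply: continuous_subspaceT.
  by have [_ /(_ 1) [_ []]] := @is_Cn_step R 1.
have B0 : 0 <= B.
  by apply: le_trans (HB 0 _) => //; rewrite in_itv/= lexx ler01.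
exists B; split => // c x0 x c0.
have [xin|xout] := boolP (x \in `[x0, x0 + c^-1]); last first.
  by rewrite derive_ramp_out// normr0 mulr_ge0// ltW.
rewrite derive_ramp normrM (gtr0_norm c0) ler_wpM2r// ?(ltW c0)//; apply: HB.
move: xin; rewrite !in_itv/= => /andP[x1 x2].
rewrite -mulrBr pmulr_rge0// subr_ge0 x1/= -ler_pdivlMl// mulr1.
by rewrite lerBlDl.
Qed.

Lemma Rintegral_derive_ramp c x0 : 0 < c ->
  \int[mu]_(x in `[x0, x0 + c^-1]) ('D_1 (ramp c x0) x) = 1.
Proof.
move=> c0; have x01 : x0 < x0 + c^-1 by rewrite ltrDl invr_gt0.
rewrite /Rintegral (continuous_FTC2 (F := ramp c x0))//.
- by rewrite /= ramp_ge1// ramp_le0// subr0.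
- exact/continuous_subspaceT/continuous_derive_ramp.
- split.
  + by move=> x _; exact: derivable_ramp.
  + exact/cvg_at_right_filter/continuous_ramp.
  + exact/cvg_at_left_filter/continuous_ramp.
- by move=> x _; rewrite derive1E.
Qed.

(** The derivative of the ramp has integral 1 over its support, which shrinks to [x0], and [k] is
    continuous from the right there. *)
Lemma ramp_approximate_identity (N : nat) (k : R -> R) x0 b : x0 + N.+1%:R^-1 <= b ->
  {within `[x0, b], continuous k} ->
  \int[mu]_(x in `[x0, x0 + (n + N).+1%:R^-1])
    (k x * 'D_1 (ramp (n + N).+1%:R x0) x) @[n --> \oo] --> k x0.
Proof.
move=> x0b ck; have [B [B0 HB]] := normr_derive_ramp_le.
have N0 n : 0 < (n + N).+1%:R^-1 :> R by rewrite invr_gt0 ltr0n.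
have x0lt : x0 < b by apply: lt_le_trans x0b; rewrite ltrDl invr_gt0 ltr0n.
have [_ /cvgrPdist_le ck0 _] := (continuous_within_itvP k x0lt).1 ck.
apply/cvgrPdist_le => e e0.
(* The final bound is [e / (B + 1)] times [B c] times the length [c^-1], hence at most [e]; adding 1
   covers [B = 0]. *)
have e1 : 0 < e / (B + 1) by rewrite divr_gt0// ltr_wpDl.
have [d /= d0 Hd] := ck0 _ e1.
near=> n.
set c := (n + N).+1%:R; have c0 : 0 < c by rewrite ltr0n.
have cd : c^-1 < d.
  rewrite (@le_lt_trans _ _ n.+1%:R^-1)//.
    by rewrite lef_pV2 ?posrE ?ltr0n// ler_nat ltnS leq_addr.
  by near: n; exact: near_infty_natSinv_lt (PosNum d0).
set J : set (measurableTypeR R) := [set` `[x0, x0 + c^-1]].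
have subJ : J `<=` `[x0, b].
  apply: subset_itvl; rewrite bnd_simp (le_trans _ x0b)// lerD2l.
  by rewrite lef_pV2 ?posrE ?ltr0n// ler_nat ltnS leq_addl.
have cD : {within J, continuous ('D_1 (ramp c x0))}.
  exact/continuous_subspaceT/continuous_derive_ramp.
have ckJ : {within J, continuous k} by exact: continuous_subspaceW ck.
have ckD : {within J, continuous (fun x => k x * 'D_1 (ramp c x0) x)}.
  by move=> x; apply: cvgM; [exact: ckJ|exact: cD].
have ckx : {within J, continuous (fun x => k x0 * 'D_1 (ramp c x0) x)}.
  by move=> x; apply: cvgM; [exact: cvg_cst|exact: cD].
have cpt (f : R -> R) : {within J, continuous f} -> mu.-integrable J (EFin \o f).
  by move=> cf; apply: continuous_compact_integrable => //; exact: segment_compact.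
have iD := cpt _ cD; have ikD := cpt _ ckD; have ikx := cpt _ ckx.
have mJ : measurable J by exact: measurable_itv.
have -> : k x0 - \int[mu]_(x in J) (k x * 'D_1 (ramp c x0) x) =
    \int[mu]_(x in J) (k x0 * 'D_1 (ramp c x0) x - k x * 'D_1 (ramp c x0) x).
  rewrite (@RintegralB _ _ _ mu J (fun x => k x0 * 'D_1 (ramp c x0) x)
    (fun x => k x * 'D_1 (ramp c x0) x) mJ ikx ikD).
  rewrite (@RintegralZl _ _ _ mu J ('D_1 (ramp c x0)) (k x0) mJ iD).
  by rewrite Rintegral_derive_ramp// mulr1.
have iB : mu.-integrable J (EFin \o (fun x => k x0 * 'D_1 (ramp c x0) x -
    k x * 'D_1 (ramp c x0) x)) by exact: (integrableB mJ ikx ikD).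
apply: le_trans (le_normr_Rintegral mJ iB) _.
apply: (@le_trans _ _ (\int[mu]_(x in J) (e / (B + 1) * (B * c)))).
  apply: le_Rintegral => //.
  - exact: (integrable_norm iB).
  - apply: continuous_compact_integrable; first exact: segment_compact.
    exact/continuous_subspaceT/cst_continuous.
  - move=> x; rewrite /J /= in_itv/= => /andP[x1 x2].
    rewrite -mulrBl normrM ler_pM//; last exact: HB.
    have [->|xx0] := eqVneq x x0; first by rewrite subrr normr0 ltW.
    apply: Hd => /=; last by rewrite lt_neqAle eq_sym xx0.
    rewrite ler0_norm ?subr_le0// opprB (le_lt_trans _ cd)//.
    by rewrite lerBlDl.
have muJ : mu [set` `[x0, x0 + c^-1]] = (c^-1)%:E.
  rewrite lebesgue_measure_itv/= lte_fin ltrDl invr_gt0 c0.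
  by rewrite -EFinB addrAC subrr add0r.
rewrite Rintegral_cst// [fine _](_ : _ = c^-1); last first.
  by rewrite -[RHS]/(fine (c^-1)%:E) -muJ.
rewrite -!mulrA mulfV ?gt_eqF// mulr1.
by rewrite ler_piMr ?(ltW e0)// ler_pdivrMl ?mulr1 ?lerDl// ltr_wpDl.
Unshelve. all: by end_near. Qed.

End ramp_derivative.

(** * From weak derivatives to increments of continuous functions *)

Section weak_increment.
Context {R : realType} (l : R).
Local Notation mu := (@lebesgue_measure R).

(** The derivative of a plateau tends to the difference of the Dirac masses at [x0] and [x1], and
    the plateau itself to the indicator of []x0, x1]]. The claim is the limit of the weak identity
    [H]. *)
Lemma plateau_weak_increment (k h : R -> R) N x0 x1 :
  {within Iclosed l, continuous k} -> locally_integrable (Iopen l) h ->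
  - l < x0 -> x0 <= x1 -> x1 + N.+1%:R^-1 < l ->
  (forall n, \int[mu]_(x in Iopen l) (k x * 'D_1 (plateau (n + N).+1%:R x0 x1) x) =
    - \int[mu]_(x in Iopen l) (h x * plateau (n + N).+1%:R x0 x1 x)) ->
  k x1 - k x0 = \int[mu]_(x in `]x0, x1]) h x.
Proof.
move=> ck lh lx0 x01 x1l H.
have N0 n : 0 < (n + N).+1%:R^-1 :> R by rewrite invr_gt0 ltr0n.
have nN n : (n + N).+1%:R^-1 <= N.+1%:R^-1 :> R.
  by rewrite lef_pV2 ?posrE ?ltr0n// ler_nat ltnS leq_addl.
have Hh := Rintegral_plateau_cvg lh x01 lx0 x1l.
have sub y : x0 <= y -> y <= x1 ->
    \int[mu]_(x in Iopen l) (k x * 'D_1 (ramp (n + N).+1%:R y) x) @[n --> \oo] --> k y.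
  move=> x0y yx1.
  rewrite (_ : (fun n => _) = (fun n =>
     \int[mu]_(x in `[y, y + (n + N).+1%:R^-1]) (k x * 'D_1 (ramp (n + N).+1%:R y) x))).
    apply: (@ramp_approximate_identity R N k y (y + N.+1%:R^-1)) => //.
    apply: continuous_subspaceW ck => x; rewrite /Iclosed/= !in_itv/= => /andP[yx xy].
    rewrite (le_trans (ltW lx0) (le_trans x0y yx)) (le_trans xy)//.
    by rewrite (le_trans _ (ltW x1l))// lerD2r.
  apply/funext => n; apply: Rintegral_sub.
    apply: subset_itv_Iopen; first exact: lt_le_trans lx0 _.
    by apply: le_lt_trans x1l; exact: lerD.
  move=> x _ /negP xn; rewrite derive_ramp_out ?mulr0// ?ltr0n//.
have ikD c y : mu.-integrable (Iopen l) (EFin \o (fun x => k x * 'D_1 (ramp c y) x)).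
  apply: (@integrableS _ _ R mu (Iclosed l) (Iopen l)).
  - exact: measurable_itv.
  - exact: measurable_itv.
  - exact: subset_itv_oo_cc.
  - apply: continuous_compact_integrable; first exact: segment_compact.
    move=> x; apply: cvgM; first exact: ck.
    exact/continuous_subspaceT/continuous_derive_ramp.
have S : \int[mu]_(x in Iopen l) (k x * 'D_1 (plateau (n + N).+1%:R x0 x1) x)
    @[n --> \oo] --> k x0 - k x1.
  rewrite (_ : (fun n => _) = (fun n =>
     \int[mu]_(x in Iopen l) (k x * 'D_1 (ramp (n + N).+1%:R x0) x) -
     \int[mu]_(x in Iopen l) (k x * 'D_1 (ramp (n + N).+1%:R x1) x))).
    by apply: cvgB; apply: sub.
  apply/funext => n; rewrite -RintegralB//; last exact: measurable_Iopen.
  apply: eq_Rintegral => x _; rewrite -mulrBr; congr (_ * _).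
  rewrite (_ : plateau _ x0 x1 = ramp (n + N).+1%:R x0 - ramp (n + N).+1%:R x1).
    by rewrite deriveB//; exact: derivable_ramp.
  by apply/funext => y; rewrite /plateau mulN1r.
have S' : \int[mu]_(x in Iopen l) (k x * 'D_1 (plateau (n + N).+1%:R x0 x1) x)
    @[n --> \oo] --> - \int[mu]_(x in `]x0, x1]) h x.
  by under eq_fun do rewrite H; exact: cvgN.
by rewrite -[LHS]opprB -(cvg_lim _ S)// (cvg_lim _ S')// opprK.
Qed.

End weak_increment.

Section increments.
Context {R : realType} (l : R).
Local Notation mu := (@lebesgue_measure R).

Lemma bounded_integrable_itv (h : R -> R) (M : R) (i : interval R) :
  measurable_fun [set: measurableTypeR R] h -> (forall x, `|h x| <= M) ->
  (mu [set` i] < +oo)%E -> mu.-integrable [set` i] (EFin \o h).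
Proof.
move=> mh hM mui.
apply: (@measurable_bounded_integrable _ (measurableTypeR R) R mu h _
  (measurable_itv i) mui).
- exact: measurable_funS mh.
- by exists M; split; [exact: num_real|move=> y My z _ /=; rewrite (le_trans (hM z))// ltW].
Qed.

(** Testing with rational endpoints shows that [k] minus a primitive of [h] is constant on the
    rational points of the interval; continuity extends this to all points. *)
Lemma increment_of_plateau (k h : R -> R) (M : R) :
  {within Iclosed l, continuous k} -> measurable_fun [set: measurableTypeR R] h ->
  (forall x, `|h x| <= M) ->
  (forall (q0 q1 : rat) (m : nat), - l < ratr q0 -> ratr q0 <= ratr q1 :> R ->
    ratr q1 + m.+1%:R^-1 < l ->
    \int[mu]_(x in Iopen l) (k x * 'D_1 (plateau m.+1%:R (ratr q0) (ratr q1)) x) =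
    - \int[mu]_(x in Iopen l) (h x * plateau m.+1%:R (ratr q0) (ratr q1) x)) ->
  forall x0 x1, - l < x0 -> x0 <= x1 -> x1 < l ->
    k x1 - k x0 = \int[mu]_(x in `]x0, x1]) h x.
Proof.
move=> ck mh hM H x0 x1 lx0 x01 x1l.
have itvfin (a b : R) (s t : bool) :
    (mu [set` Interval (BSide s a) (BSide t b)] < +oo)%E.
  rewrite lebesgue_measure_itv/=; case: ifPn => // _; exact: ltry.
have ll : - l < l by apply: lt_le_trans lx0 (le_trans x01 (ltW x1l)).
have ih : mu.-integrable `[- l, l] (EFin \o h) by exact: bounded_integrable_itv.
have lh : locally_integrable (Iopen l) h.
  apply: open_integrable_locally; first exact: interval_open.
  exact: bounded_integrable_itv.
pose P x := \int[mu]_(t in `[- l, x]) h t.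
have P_sub u v : - l <= u -> u <= v -> P v - P u = \int[mu]_(x in `]u, v]) h x.
  move=> lu uv; rewrite /P (@Rintegral_itvB _ h (BLeft (- l)) (BRight v) u)//.
  exact: bounded_integrable_itv.
have cP : {within `[- l, l], continuous P}.
  by apply: parameterized_integral_continuous => //; exact: ltW.
pose F x := k x - P x.
have cF x : - l < x -> x < l -> {for x, continuous F}.
  move=> lx xl; have xI : x \in `]- l, l[ by rewrite in_itv/= lx.
  have [ckI _ _] := (continuous_within_itvP _ ll).1 ck.
  have [cPI _ _] := (continuous_within_itvP _ ll).1 cP.
  by apply: cvgB; [exact: ckI|exact: cPI].
have Fq (q0 q1 : rat) : - l < ratr q0 -> ratr q0 <= ratr q1 :> R -> ratr q1 < l ->
    F (ratr q0) = F (ratr q1).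
  move=> lq0 q01 q1l; have [N NP] := ltr_add_invr q1l.
  suff : k (ratr q1) - k (ratr q0) = P (ratr q1) - P (ratr q0) by rewrite /F; lra.
  rewrite P_sub ?(ltW lq0)//; apply: (@plateau_weak_increment _ l _ _ N) => // n.
  apply: H => //; apply: le_lt_trans NP; rewrite lerD2l.
  by rewrite lef_pV2 ?posrE ?ltr0n// ler_nat ltnS leq_addl.
have [q qI] : exists q : rat, (ratr q : R) \in `]- l, l[ by exact: rat_in_itvoo.
have Fc x : - l < x -> x < l -> F x = F (ratr q).
  (* If the values at [x] and at the reference rational differed, they would still differ at a
     rational close to [x]. *)
  move=> lx xl; apply/eqP; rewrite -subr_eq0; apply/negPn/negP => Fx.
  have : F y - F (ratr q) @[y --> x] --> F x - F (ratr q).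
    by apply: cvgB; [exact: cF|exact: cvg_cst].
  move=> /cvgr_neq0 /(_ Fx) [d /= d0 Hd].
  have [r] : exists r : rat, (ratr r : R) \in `]Num.max (- l) (x - d), Num.min l (x + d)[.
    apply: rat_in_itvoo; rewrite lt_min !gt_max ll/=; apply/and3P; split => //; lra.
  rewrite in_itv/= lt_min gt_max => /andP[/andP[lr xr] /andP[rl rx]].
  have := Hd (ratr r); rewrite /= ltr_norml => /(_ _)/negP; apply.
    by apply/andP; split; lra.
  move: qI; rewrite in_itv/= => /andP[lq ql].
  rewrite subr_eq0; have [rq|/ltW qr] := leP (ratr r : R) (ratr q).
    by rewrite (Fq r q)//.
  by rewrite -(Fq q r).
have : F x0 = F x1.
  by rewrite !Fc// ?(le_lt_trans x01)// (lt_le_trans lx0).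
rewrite -P_sub ?(ltW lx0)// /F; lra.
Qed.

End increments.

(** * Sections of functions on the square *)

Section fubini_separate.
Context {R : realType} (l : R).
Local Notation mu := (@lebesgue_measure R).
Local Notation mu2 := (mu \x mu)%E.

Local Notation MR := (measurableTypeR R).
Local Notation OmegaR := (Omega l : set (MR * MR)).

Lemma measurable_Omega : measurable OmegaR.
Proof. by apply: measurableX; exact: measurable_itv. Qed.

Lemma mu2_Omega_lty : (mu2 (Omega l) < +oo)%E.
Proof.
rewrite /Omega (product_measure1E mu mu (measurable_itv _) (measurable_itv _)).
rewrite [X in (X * X)%E](_ : _ = mu (Iopen l))// /Iopen lebesgue_measure_itv/=.
by case: ifPn => _; rewrite ?mule0// -EFinB -EFinM ltry.
Qed.

Lemma bounded_integrable_Omega (f : R * R -> R) (M : R) :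
  measurable_fun OmegaR f -> (forall z, Omega l z -> `|f z| <= M) ->
  mu2.-integrable (Omega l) (EFin \o f).
Proof.
move=> mf fM; apply: measurable_bounded_integrable => //.
- exact: measurable_Omega.
- exact: mu2_Omega_lty.
- by exists M; split; [exact: num_real|move=> y My z Oz /=; rewrite (le_trans (fM z Oz))// ltW].
Qed.

(** By Fubini the hypothesis says that [t |-> \int W (x, t) dx] is orthogonal to all test functions
    of one variable. The bound [M] makes all the integrals finite. *)
Lemma fubini_separate (W : R * R -> R) (M : R) :
  measurable_fun OmegaR W -> (forall z, Omega l z -> `|W z| <= M) ->
  (forall psi, test_function (Iopen l) psi ->
    \int[mu2]_(z in Omega l) (W z * psi z.2) = 0) ->
  {ae mu, forall t, Iopen l t -> \int[mu]_(x in Iopen l) W (x, t) = 0}.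
Proof.
move=> mW WM HW.
have mO := measurable_Omega.
have mWO : measurable_fun [set: MR * MR] (W \_ (Omega l)) by exact: (measurable_restrictT W mO).1 mW.
have M0 z : `|(W \_ (Omega l)) z| <= `|M|.
  rewrite patchE; case: ifPn => [/set_mem /WM/le_trans -> //|_]; first exact: ler_norm.
  by rewrite normr0.
have WE x t : Iopen l t -> (W \_ (Omega l)) (x, t) = ((fun x => W (x, t)) \_ (Iopen l)) x.
  move=> It; rewrite !patchE; case: ifPn => [/set_mem[/= Ix _]|xO].
    by rewrite mem_set.
  by case: ifPn => // /set_mem Ix; case/negP: xO; exact/mem_set.
pose w t := \int[mu]_x (W \_ (Omega l)) (x, t).
have iWO : mu2.-integrable setT (EFin \o (W \_ (Omega l))).
  rewrite -restrict_EFin; apply: (integrable_mkcond _ mO).1.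
  exact: bounded_integrable_Omega mW WM.
have iw : mu.-integrable setT (EFin \o w) := integrable_Rintegral2 iWO.
have isec t : mu.-integrable setT (EFin \o (fun x => (W \_ (Omega l)) (x, t))).
  have -> : (EFin \o (fun x => (W \_ (Omega l)) (x, t))) =
      (EFin \o (fun x => (W \_ (Omega l)) (x, t))) \_ (Iopen l).
    apply/funext => x; rewrite !patchE; case: ifPn => //= xI.
    by rewrite patchE memNset// => -[/mem_set]; rewrite (negbTE xI).
  have mI : measurable (Iopen l : set MR) by exact: measurable_itv.
  apply: (integrable_mkcond _ mI).1.
  apply: (@bounded_integrable_itv R _ `|M| `]- l, l[) => //.
    exact: (measurable_fun_pair1 (T1 := MR) (T2 := MR) (f := W \_ (Omega l))).
  rewrite lebesgue_measure_itv/=; case: ifPn => // _; exact: ltry.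
suff : {ae mu, forall t, Iopen l t -> w t = 0}.
  apply: ae_imply => t wt It; rewrite -(wt It) /w Rintegral_mkcond.
  by apply: eq_Rintegral => x _; rewrite WE.
apply: test_functions_separate => [|psi tpsi].
  apply: open_integrable_locally; first exact: interval_open.
  by apply: (@integrableS _ _ R mu setT) => //; exact: measurable_itv.
have cpsi := test_function_continuous tpsi.
have mpsi : measurable_fun [set: measurableTypeR R] psi.
  exact: continuous_measurable_fun.
have [B HB] : exists B : R, forall x, x \in `[- l, l] -> `|psi x| <= B.
  by apply: continuous_bounded_itv; exact: continuous_subspaceT.
have mpsi2 : measurable_fun [set: MR * MR] (fun z => psi z.2).
  exact: (measurableT_comp mpsi measurable_snd).
have ->: \int[mu]_(t in Iopen l) (w t * psi t) =
    \int[mu]_t \int[mu]_x (((fun z => W z * psi z.2) \_ (Omega l)) (x, t)).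
  rewrite Rintegral_mkcond; apply: eq_Rintegral => t _; rewrite patchE.
  case: ifPn => [/set_mem It|It].
    rewrite /w -(@RintegralZr _ _ _ mu setT _ (psi t) measurableT (isec t)).
    by apply: eq_Rintegral => x _; rewrite !patchE; case: ifPn => //; rewrite mul0r.
  rewrite /Rintegral integral0_eq// => x _.
  by rewrite patchE memNset// => -[_ /mem_set]; rewrite (negbTE It).
have iWp : mu2.-integrable setT (EFin \o ((fun z => W z * psi z.2) \_ (Omega l))).
  rewrite -restrict_EFin; apply: (integrable_mkcond _ mO).1.
  apply: (@bounded_integrable_Omega _ (M * B)).
    by apply: measurable_funM => //; exact: measurable_funS mpsi2.
  move=> z Oz; rewrite normrM ler_pM// ?WM// HB//; case: Oz => _.
  exact: subset_itv_oo_cc.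
rewrite (Rintegral_fubini2 iWp) -Rintegral_mkcond; exact: HW.
Qed.

End fubini_separate.

Section kernel_increments.
Context {R : realType} (l : R).
Local Notation mu := (@lebesgue_measure R).
Local Notation mu2 := (mu \x mu)%E.
Local Notation MR := (measurableTypeR R).
Local Notation OmegaR := (Omega l : set (MR * MR)).

Lemma continuous_section (k : R * R -> R) t : Iclosed l t ->
  {within Omega_closed l, continuous k} ->
  {within Iclosed l, continuous (fun x => k (x, t))}.
Proof.
move=> It /subspace_continuousP ck; apply/subspace_continuousP => x Ix.
have Oxt : Omega_closed l (x, t) by split.
have := ck _ Oxt; apply: cvg_comp => A /= [[U V]/= [Ux Vt] UVA].
apply: filterS Ux => y Uy Iy; apply: UVA; last by split.
by split => //=; exact: nbhs_singleton Vt.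
Qed.

Lemma continuous_bounded_square (k : R * R -> R) :
  {within Omega_closed l, continuous k} ->
  exists M : R, forall z, Omega_closed l z -> `|k z| <= M.
Proof.
move=> ck; have cO : compact (Omega_closed l).
  by apply: compact_setX; exact: segment_compact.
have [N [_ HN]] := compact_bounded (continuous_compact ck cO).
by exists (N + 1) => z Oz; apply: (HN _ (ltr_pwDr ltr01 (lexx _))); exists z.
Qed.

Lemma measurable_fst_comp (f : R -> R) : continuous f ->
  measurable_fun OmegaR (fun z => f z.1).
Proof.
move=> cf; apply: (@measurable_funS _ _ _ _ setT) => //.
apply: (measurableT_comp _ measurable_fst); exact: continuous_measurable_fun.
Qed.

Lemma measurable_snd_comp (f : R -> R) : continuous f ->
  measurable_fun OmegaR (fun z => f z.2).
Proof.
move=> cf; apply: (@measurable_funS _ _ _ _ setT) => //.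
apply: (measurableT_comp _ measurable_snd); exact: continuous_measurable_fun.
Qed.

(** With [phi] fixed, the free factor [psi] localises the identity on the square to almost every
    [t]. The exceptional null set depends on [phi]. *)
Lemma weak_sections (k g : R * R -> R) (Mk Mg : R) (phi : R -> R) :
  measurable_fun OmegaR k -> (forall z, Omega l z -> `|k z| <= Mk) ->
  measurable_fun OmegaR g -> (forall z, Omega l z -> `|g z| <= Mg) ->
  test_function (Iopen l) phi ->
  (forall psi, test_function (Iopen l) psi ->
    \int[mu2]_(z in Omega l) (k z * ('D_1 phi z.1 * psi z.2)) =
    - \int[mu2]_(z in Omega l) (g z * (phi z.1 * psi z.2))) ->
  {ae mu, forall t, Iopen l t ->
    \int[mu]_(x in Iopen l) (k (x, t) * 'D_1 phi x) =
    - \int[mu]_(x in Iopen l) (g (x, t) * phi x)}.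
Proof.
move=> mk kM mg gM tphi H; have mO := @measurable_Omega R l.
have cphi := test_function_continuous tphi.
have [_ cdphi] := test_function_derivable (1 : R) tphi.
have [B HB] : exists B : R, forall x, x \in `[- l, l] -> `|phi x| <= B.
  by apply: continuous_bounded_itv; exact: continuous_subspaceT.
have [D HD] : exists D : R, forall x, x \in `[- l, l] -> `|'D_1 phi x| <= D.
  by apply: continuous_bounded_itv; exact: continuous_subspaceT.
have bk z : Omega l z -> `|k z * 'D_1 phi z.1| <= Mk * D.
  move=> Oz; rewrite normrM ler_pM// ?kM// HD//; case: Oz => + _.
  exact: subset_itv_oo_cc.
have bg z : Omega l z -> `|g z * phi z.1| <= Mg * B.
  move=> Oz; rewrite normrM ler_pM// ?gM// HB//; case: Oz => + _.
  exact: subset_itv_oo_cc.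
pose W z := k z * 'D_1 phi z.1 + g z * phi z.1.
have mkp : measurable_fun OmegaR (fun z => k z * 'D_1 phi z.1).
  by apply: measurable_funM => //; exact: (measurable_fst_comp cdphi).
have mgp : measurable_fun OmegaR (fun z => g z * phi z.1).
  by apply: measurable_funM => //; exact: (measurable_fst_comp cphi).
have mI : measurable (Iopen l : set MR) by exact: measurable_itv.
have muI : (mu (Iopen l) < +oo)%E.
  rewrite /Iopen lebesgue_measure_itv/=; case: ifPn => // _; exact: ltry.
have isec (f : R * R -> R) (C : R) t : measurable_fun OmegaR f ->
    (forall z, Omega l z -> `|f z| <= C) -> Iopen l t ->
    mu.-integrable (Iopen l) (EFin \o (fun x => f (x, t))).
  move=> mf fC It.
  apply: (@measurable_bounded_integrable _ MR R mu (fun x => f (x, t)) _ mI muI).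
    apply: (@eq_measurable_fun _ _ MR _ _ (fun x => (f \_ (Omega l)) (x, t))).
      by move=> x /set_mem xI; rewrite patchE mem_set.
    apply: (@measurable_funS _ _ MR _ setT) => //.
    apply: (measurable_fun_pair1 (T1 := MR) (T2 := MR) (f := f \_ (Omega l))).
    exact: (measurable_restrictT f mO).1.
  by exists C; split; [exact: num_real|move=> y Cy x xI /=; rewrite (le_trans (fC _ _))// ltW].
have : {ae mu, forall t, Iopen l t -> \int[mu]_(x in Iopen l) W (x, t) = 0}.
  apply: (@fubini_separate R l W (Mk * D + Mg * B)).
  - exact: measurable_funD.
  - by move=> z Oz; rewrite (le_trans (ler_normD _ _))// lerD// ?bk ?bg.
  - move=> psi tpsi; have cpsi := test_function_continuous tpsi.
    have [E HE] : exists E : R, forall x, x \in `[- l, l] -> `|psi x| <= E.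
      by apply: continuous_bounded_itv; exact: continuous_subspaceT.
    have bpsi z : Omega l z -> `|psi z.2| <= E.
      by move=> [_ Oz]; apply: HE; exact: subset_itv_oo_cc.
    have i1 : mu2.-integrable (Omega l) (EFin \o (fun z => k z * ('D_1 phi z.1 * psi z.2))).
      apply: (@bounded_integrable_Omega _ _ _ (Mk * D * E)).
        by apply: measurable_funM => //; apply: measurable_funM; [exact: (measurable_fst_comp cdphi)|exact: (measurable_snd_comp cpsi)].
      by move=> z Oz; rewrite mulrA normrM ler_pM// ?bk ?bpsi.
    have i2 : mu2.-integrable (Omega l) (EFin \o (fun z => g z * (phi z.1 * psi z.2))).
      apply: (@bounded_integrable_Omega _ _ _ (Mg * B * E)).
        by apply: measurable_funM => //; apply: measurable_funM; [exact: (measurable_fst_comp cphi)|exact: (measurable_snd_comp cpsi)].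
      by move=> z Oz; rewrite mulrA normrM ler_pM// ?bg ?bpsi.
    rewrite (_ : (fun z => _) = (fun z => k z * ('D_1 phi z.1 * psi z.2) +
        g z * (phi z.1 * psi z.2))); last by apply/funext => z; rewrite /W; ring.
    by rewrite (@RintegralD _ _ _ mu2 OmegaR _ _ mO i1 i2) H// addNr.
apply: ae_imply => t + It => /(_ It).
rewrite (@RintegralD _ _ _ mu (Iopen l) _ _ mI (isec _ _ t mkp bk It)
  (isec _ _ t mgp bg It)).
by move/eqP; rewrite addr_eq0 => /eqP.
Qed.

(** Plateaus with rational endpoints form a countable family of test functions,
    so a single null set of parameters [t] works for all [x0] and [x1]. *)
Lemma ae_increment (k g : R * R -> R) (Mg : R) :
  {within Omega_closed l, continuous k} -> measurable_fun OmegaR k ->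
  measurable_fun [set: MR * MR] g -> (forall z, `|g z| <= Mg) ->
  (forall phi psi, test_function (Iopen l) phi -> test_function (Iopen l) psi ->
    \int[mu2]_(z in Omega l) (k z * ('D_1 phi z.1 * psi z.2)) =
    - \int[mu2]_(z in Omega l) (g z * (phi z.1 * psi z.2))) ->
  {ae mu, forall t, Iopen l t -> forall x0 x1, - l < x0 -> x0 <= x1 -> x1 < l ->
    k (x1, t) - k (x0, t) = \int[mu]_(x in `]x0, x1]) g (x, t)}.
Proof.
move=> ck mk mg gM H; have [Mk HMk] := continuous_bounded_square ck.
have kM z : Omega l z -> `|k z| <= Mk.
  by move=> [z1 z2]; apply: HMk; split; exact: subset_itv_oo_cc.
have mgO : measurable_fun OmegaR g by exact: measurable_funS mg.
(* Natural numbers encode the triples [(q0, q1, m)], so that a countable intersection of full sets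
   can be taken. Codes of no triple, and triples whose plateau need not be supported in the
   interval, carry no condition. *)
pose P (i : nat) (t : R) := if unpickle i is Some (q0, q1, m) then
    - l < ratr q0 -> ratr q0 <= ratr q1 :> R -> ratr q1 + m.+1%:R^-1 < l ->
    \int[mu]_(x in Iopen l) (k (x, t) * 'D_1 (plateau m.+1%:R (ratr q0) (ratr q1)) x) =
    - \int[mu]_(x in Iopen l) (g (x, t) * plateau m.+1%:R (ratr q0) (ratr q1) x)
  else True.
have HP i : {ae mu, forall t, Iopen l t -> P i t}.
  rewrite /P; case: (unpickle i) => [[[q0 q1] m]|]; last exact: aeW.
  have [h|h] := pselect [/\ - l < ratr q0, ratr q0 <= ratr q1 :> R & ratr q1 + m.+1%:R^-1 < l].
    have [h1 h2 h3] := h.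
    have tp : test_function (Iopen l) (plateau m.+1%:R (ratr q0) (ratr q1)).
      by apply: test_function_plateau => //; rewrite ltr0n.
    have := weak_sections mk kM mgO (fun z _ => gM z) tp (fun psi => H _ psi tp).
    by apply: ae_imply => t + It => /(_ It).
  by apply: aeW => t It h1 h2 h3; exfalso; apply: h.
have := ae_foralln HP; apply: ae_imply => t HPt It.
apply: (@increment_of_plateau R l (fun x => k (x, t)) (fun x => g (x, t)) Mg).
- by apply: continuous_section => //; exact: subset_itv_oo_cc.
- exact: (measurable_fun_pair1 (T1 := MR) (T2 := MR)).
- by move=> x; exact: gM.
- move=> q0 q1 m; have := HPt (pickle (q0, q1, m)) It.
  by rewrite /P pickleK.
Qed.

(** The representative is [g0] set to 0 outside the square and wherever its modulus exceeds the
    essential bound; it is then measurable and bounded on the whole plane without exceptional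
    points. *)
Lemma essentially_bounded_representative (g0 : R * R -> R[i]) :
  in_Lp mu2 (Omega l) +oo%E g0 ->
  exists g (M : R), [/\ cmeasurable_on [set: MR * MR] g,
    forall z, cmodulus (g z) <= M & ae_eq mu2 (Omega l) g0 g].
Proof.
move=> [mg0]; rewrite /Lp_norm unlock => fin; have mO := @measurable_Omega R l.
have [M [M0 HM]] : exists M : R, 0 <= M /\
    {ae mu2, forall z, Omega l z -> cmodulus (g0 z) <= M}.
  move: fin; case: ifPn => [_|].
    set E := ess_sup _ _ => fin; exists `|fine E|; split=> //.
    have := ess_sup_ge mu2 (abse \o (fun x => (cmodulus (g0 x))%:E) \_ (Omega l)).
    apply: filterS => z + Oz; rewrite -/E /= patchE mem_set//= => H.
    rewrite -lee_fin; apply: le_trans (le_trans H _).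
      by rewrite lee_fin ler_norm.
    move: fin; case: (E) => //= [r _|_]; last exact: leNye.
    by rewrite lee_fin ler_norm.
  (* The infinity norm is 0 by convention if the plane is a null set, but then every property holds
     almost everywhere. *)
  rewrite -leNgt => m0 _; exists 0; split=> //.
  exists setT; split => //.
  by apply/eqP; rewrite eq_le m0 measure_ge0.
pose G := crestrict (Omega l) g0.
have mG : cmeasurable_on [set: MR * MR] G by exact: cmeasurable_crestrict.
pose A := [set z : MR * MR | cmodulus (G z) <= M].
have mA : measurable A.
  rewrite (_ : A = setT `&` (fun z => cmodulus (G z)) @^-1` `]-oo, M]).
    exact: measurable_cmodulus.
  by apply/seteqP; split => [z|z []]; rewrite /A/= in_itv/=.
exists (crestrict A G), M; split.
- apply: cmeasurable_crestrict => //; exact: cmeasurableS mG.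
- move=> z; rewrite /crestrict; case: ifPn => [/set_mem//|_].
  by rewrite cmodulus0.
- apply: (@filterS _ _ (ae_filter_ringOfSetsType mu2) _ _ _ HM) => z {}HM Oz; rewrite crestrict_in /G ?crestrict_in//.
  by rewrite /A/= /G crestrict_in// HM.
Qed.

(** Only products [phi (x) * psi (t)] are tested. As they are real, the weak identity splits into
    one for the real part and one for the imaginary part of [K]. *)
Lemma kernel_increments (K : R * R -> R[i]) : in_W1oo_Omega l K ->
  ccontinuous_on (Omega_closed l) K ->
  exists g (M : R), [/\ cmeasurable_on [set: MR * MR] g, forall z, cmodulus (g z) <= M &
    {ae mu, forall t, Iopen l t -> forall x0 x1, - l < x0 -> x0 <= x1 -> x1 < l ->
      K (x1, t) - K (x0, t) = cintegral mu `]x0, x1] (fun s => g (s, t))}].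
Proof.
move=> [[mK _] [g0 Lg0 wp] _] [cK1 cK2].
have [g [M [mg gM gg0]]] := essentially_bounded_representative Lg0.
exists g, M; split => //.
have mO := @measurable_Omega R l.
have mtens phi psi : test_function (Iopen l) phi -> test_function (Iopen l) psi ->
    measurable_fun OmegaR (fun z => phi z.1 * psi z.2).
  move=> /test_function_continuous cphi /test_function_continuous cpsi.
  apply: measurable_funM; first exact: measurable_fst_comp.
  exact: measurable_snd_comp.
have E phi psi : test_function (Iopen l) phi -> test_function (Iopen l) psi ->
    cintegral mu2 (Omega l) (fun z => K z * ('D_1 phi z.1 * psi z.2)%:C%C) =
    - cintegral mu2 (Omega l) (fun z => g z * (phi z.1 * psi z.2)%:C%C).
  move=> tphi tpsi; have := wp _ (test_function_tensor tphi tpsi).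
  rewrite (_ : (fun z => K z * _) = (fun z => K z * ('D_1 phi z.1 * psi z.2)%:C%C)).
    move=> ->; congr (- _); apply: ae_eq_cintegral => //.
    + apply: cmeasurableM; first by case: Lg0.
      exact: (cmeasurable_real (mtens _ _ tphi tpsi)).
    + apply: cmeasurableM; first exact: cmeasurableS mg.
      exact: (cmeasurable_real (mtens _ _ tphi tpsi)).
    + by apply: filterS gg0 => z /[apply] ->.
  by apply/funext => z; rewrite (derive_tensor _ tphi tpsi).
have ReE phi psi (tphi : test_function (Iopen l) phi) (tpsi : test_function (Iopen l) psi) :
    \int[mu2]_(z in Omega l) (Re (K z) * ('D_1 phi z.1 * psi z.2)) =
    - \int[mu2]_(z in Omega l) (Re (g z) * (phi z.1 * psi z.2)).
  have /(congr1 (@complex.Re R)) := E _ _ tphi tpsi; rewrite Re_opp /=.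
  under eq_Rintegral do rewrite Re_mul/= mulr0 subr0.
  by under [X in _ = - X -> _]eq_Rintegral do rewrite Re_mul/= mulr0 subr0.
have ImE phi psi (tphi : test_function (Iopen l) phi) (tpsi : test_function (Iopen l) psi) :
    \int[mu2]_(z in Omega l) (Im (K z) * ('D_1 phi z.1 * psi z.2)) =
    - \int[mu2]_(z in Omega l) (Im (g z) * (phi z.1 * psi z.2)).
  have /(congr1 (@complex.Im R)) := E _ _ tphi tpsi; rewrite Im_opp /=.
  under eq_Rintegral do rewrite Im_mul/= mulr0 add0r.
  by under [X in _ = - X -> _]eq_Rintegral do rewrite Im_mul/= mulr0 add0r.
have [mK1 mK2] := mK; have [mg1 mg2] := mg.
have gM1 z : `|Re (g z)| <= M by rewrite (le_trans (normr_Re_le _)).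
have gM2 z : `|Im (g z)| <= M by rewrite (le_trans (normr_Im_le _)).
have I1 := ae_increment cK1 mK1 mg1 gM1 ReE.
have I2 := ae_increment cK2 mK2 mg2 gM2 ImE.
apply: ae_imply2 I1 I2 => t H1 H2 It x0 x1 lx0 x01 x1l.
by apply: complex_eq; rewrite !complexE; [exact: H1|exact: H2].
Qed.

End kernel_increments.

(** * Weak derivatives and primitives *)

Section weak_derivative.
Context {R : realType} (l : R).
Local Notation mu := (@lebesgue_measure R).
Local Notation mu2 := (mu \x mu)%E.
Local Notation MR := (measurableTypeR R).
Local Notation IR := (Iopen l : set MR).

Lemma measurable_IR : measurable IR. Proof. exact: measurable_itv. Qed.
Hint Resolve measurable_IR : core.

Lemma mu_IR_lty : (mu IR < +oo)%E.
Proof.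
have : (mu [set` `](- l)%R, l[%R] < +oo)%E; last by [].
rewrite lebesgue_measure_itv/=; case: ifPn => // _; exact: ltry.
Qed.

Lemma Iopen_sub_closed x : Iopen l x -> x \in `[- l, l].
Proof. exact: subset_itv_oo_cc. Qed.

Lemma continuous_bounded_Iopen (f : R -> R) : continuous f ->
  exists B : R, 0 <= B /\ forall x, Iopen l x -> `|f x| <= B.
Proof.
move=> cf; have [B HB] : exists B : R, forall x, x \in `[- l, l] -> `|f x| <= B.
  by apply: continuous_bounded_itv; exact: continuous_subspaceT.
exists `|B|; split => // x /Iopen_sub_closed /HB /le_trans; apply; exact: ler_norm.
Qed.

Lemma cintegrable_L1loc (u : R -> R[i]) : cintegrable mu IR u -> in_L1loc l u.
Proof.
by move=> [u1 u2]; split; apply: open_integrable_locally => //; exact: interval_open.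
Qed.

Lemma cintegrableM_real (u : R -> R[i]) (f : R -> R) :
  cintegrable mu IR u -> continuous f -> cintegrable mu IR (fun x => u x * (f x)%:C%C).
Proof.
move=> ui cf; have [B [B0 HB]] := continuous_bounded_Iopen cf.
rewrite (_ : (fun x => _) = (fun x => (f x)%:C%C * u x)); last first.
  by apply/funext => x; rewrite mulrC.
apply: (@cintegrableM_bounded _ _ _ mu IR _ _ B) => //.
  apply: cmeasurable_real; apply: (@measurable_funS _ _ _ _ setT) => //.
  exact: continuous_measurable_fun.
by move=> x /HB; rewrite cmodulus_real.
Qed.

(** [f] need not be integrable up to the endpoints, but it is on the compact support of [phi], where
    [phi] is bounded. *)
Lemma integrable_test (f phi : R -> R) : locally_integrable (Iopen l) f ->
  test_function (Iopen l) phi -> mu.-integrable IR (EFin \o (fun x => f x * phi x)).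
Proof.
move=> [mf oI kf] tphi; have [_ cS sS] := tphi.
set S : set MR := closure _ in cS sS.
have mS : measurable S by exact: compact_measurable.
have cphi := test_function_continuous tphi.
have [B [B0 HB]] := continuous_bounded_Iopen cphi.
have iS : mu.-integrable S (EFin \o f).
  apply/integrableP; split; last exact: kf.
  apply/measurable_EFinP; apply: measurable_funS mf => //.
have iSp : mu.-integrable S ((EFin \o f) \* (EFin \o phi))%E.
  apply: integrableMl => //.
    apply: (@measurable_funS _ _ _ _ setT) => //; exact: continuous_measurable_fun.
  by exists B; split; [exact: num_real|move=> y By x /sS Sx /=; rewrite (le_trans (HB x Sx))// ltW].
apply/integrable_mkcond => //.
rewrite (_ : _ \_ _ = ((EFin \o f) \* (EFin \o phi))%E \_ S).
  exact: (integrable_mkcond _ mS).1 iSp.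
apply/funext => x; rewrite !patchE.
case: ifPn => [/set_mem xI|xI]; case: ifPn => //=.
  move=> /negP xS; suff -> : phi x = 0 by rewrite mulr0.
  apply/eqP/negPn/negP => px; apply: xS; apply/mem_set; exact: subset_closure.
by move=> /set_mem /sS /mem_set; rewrite (negbTE xI).
Qed.

Lemma weak_deriv_unique (u v w : R -> R[i]) : is_weak_deriv l u v ->
  is_weak_deriv l u w -> ae_eq mu IR v w.
Proof.
move=> [_ [v1 v2] vP] [_ [w1 w2] wP].
have E phi (tphi : test_function (Iopen l) phi) :
    cintegral mu (Iopen l) (fun x => v x * (phi x)%:C%C) =
    cintegral mu (Iopen l) (fun x => w x * (phi x)%:C%C).
  by apply: oppr_inj; rewrite -vP// wP.
have H1 : {ae mu, forall x, Iopen l x -> Re (v x) - Re (w x) = 0}.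
  apply: test_functions_separate => [|phi tphi]; first exact: locally_integrableB.
  under eq_Rintegral do rewrite mulrBl.
  rewrite (@RintegralB _ _ _ mu IR _ _ measurable_IR
    (integrable_test v1 tphi) (integrable_test w1 tphi)).
  have /(congr1 (@complex.Re R))/= := E _ tphi.
  under eq_Rintegral do rewrite Re_mul/= mulr0 subr0.
  under [X in _ = X -> _]eq_Rintegral do rewrite Re_mul/= mulr0 subr0.
  by move=> ->; rewrite subrr.
have H2 : {ae mu, forall x, Iopen l x -> Im (v x) - Im (w x) = 0}.
  apply: test_functions_separate => [|phi tphi]; first exact: locally_integrableB.
  under eq_Rintegral do rewrite mulrBl.
  rewrite (@RintegralB _ _ _ mu IR _ _ measurable_IR
    (integrable_test v2 tphi) (integrable_test w2 tphi)).
  have /(congr1 (@complex.Im R))/= := E _ tphi.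
  under eq_Rintegral do rewrite Im_mul/= mulr0 add0r.
  under [X in _ = X -> _]eq_Rintegral do rewrite Im_mul/= mulr0 add0r.
  by move=> ->; rewrite subrr.
apply: ae_imply2 H1 H2 => x H1 H2 Ix.
by apply: complex_eq; apply/eqP; rewrite -subr_eq0; apply/eqP; [exact: H1|exact: H2].
Qed.

Lemma weak_derivP (u v : R -> R[i]) : is_weak_deriv l u v ->
  is_weak_deriv l u (weak_deriv l u).
Proof. by move=> uv; apply: (@xgetPex _ _ [set v | is_weak_deriv l u v]); exists v. Qed.

Lemma weak_deriv_eq (u v : R -> R[i]) : is_weak_deriv l u v ->
  ae_eq mu IR (weak_deriv l u) v.
Proof. by move=> uv; exact: (weak_deriv_unique (weak_derivP uv) uv). Qed.

(** Integrability of [u'] and [v'] is assumed because almost everywhere equality does not by itself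
    carry measurability over. *)
Lemma is_weak_deriv_ae (u u' v v' : R -> R[i]) : cintegrable mu IR u' ->
  cintegrable mu IR v' -> ae_eq mu IR u u' -> ae_eq mu IR v v' ->
  is_weak_deriv l u v -> is_weak_deriv l u' v'.
Proof.
move=> ui vi uu' vv' [[mu1 mu2] [mv1 mv2] uv].
split; [exact: cintegrable_L1loc|exact: cintegrable_L1loc|].
move=> phi tphi; have [_ cd] := test_function_derivable (1 : R) tphi.
have cphi := test_function_continuous tphi.
have mreal (f : R -> R) : continuous f -> cmeasurable_on IR (fun x => (f x)%:C%C).
  move=> cf; apply: cmeasurable_real; apply: (@measurable_funS _ _ _ _ setT) => //.
  exact: continuous_measurable_fun.
have mu_ : cmeasurable_on IR u by split; [case: mu1|case: mu2].
have mv_ : cmeasurable_on IR v by split; [case: mv1|case: mv2].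
have := uv _ tphi.
rewrite (@ae_eq_cintegral _ _ _ mu IR (fun x => u x * _) (fun x => u' x * ('D_1 phi x)%:C%C)) //.
- move=> ->; congr (- _); apply: ae_eq_cintegral => //.
  + by apply: cmeasurableM => //; exact: mreal.
  + by apply: cmeasurableM; [exact: cintegrable_cmeasurable vi|exact: mreal].
  + by apply: ae_imply vv' => x /[apply] ->.
- by apply: cmeasurableM => //; exact: mreal.
- by apply: cmeasurableM; [exact: cintegrable_cmeasurable ui|exact: mreal].
- by apply: ae_imply uu' => x /[apply] ->.
Qed.

Lemma is_weak_derivD (u v u' v' : R -> R[i]) :
  cintegrable mu IR u -> cintegrable mu IR v ->
  cintegrable mu IR u' -> cintegrable mu IR v' ->
  is_weak_deriv l u v -> is_weak_deriv l u' v' ->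
  is_weak_deriv l (fun x => u x + u' x) (fun x => v x + v' x).
Proof.
move=> ui vi ui' vi' [_ _ uv] [_ _ uv'].
split; [by apply: cintegrable_L1loc; exact: cintegrableD|
        by apply: cintegrable_L1loc; exact: cintegrableD|].
move=> phi tphi; have [_ cd] := test_function_derivable (1 : R) tphi.
have cphi := test_function_continuous tphi.
rewrite (_ : (fun x => (u x + u' x) * _) =
  (fun x => u x * ('D_1 phi x)%:C%C + u' x * ('D_1 phi x)%:C%C)); last first.
  by apply/funext => x; rewrite mulrDl.
rewrite (_ : (fun x => (v x + v' x) * _) =
  (fun x => v x * (phi x)%:C%C + v' x * (phi x)%:C%C)); last first.
  by apply/funext => x; rewrite mulrDl.
have I1 := cintegrableM_real ui cd; have I2 := cintegrableM_real ui' cd.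
have I3 := cintegrableM_real vi cphi; have I4 := cintegrableM_real vi' cphi.
rewrite (cintegralD measurable_IR I1 I2) (cintegralD measurable_IR I3 I4).
by rewrite opprD uv// uv'.
Qed.

Lemma is_weak_derivZ (c : R[i]) (u v : R -> R[i]) :
  cintegrable mu IR u -> cintegrable mu IR v ->
  is_weak_deriv l u v -> is_weak_deriv l (fun x => c * u x) (fun x => c * v x).
Proof.
move=> ui vi [_ _ uv].
split; [by apply: cintegrable_L1loc; exact: cintegrableZ|
        by apply: cintegrable_L1loc; exact: cintegrableZ|].
move=> phi tphi; have [_ cd] := test_function_derivable (1 : R) tphi.
have cphi := test_function_continuous tphi.
rewrite (_ : (fun x => c * u x * _) = (fun x => c * (u x * ('D_1 phi x)%:C%C))); last first.
  by apply/funext => x; rewrite mulrA.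
rewrite (_ : (fun x => c * v x * _) = (fun x => c * (v x * (phi x)%:C%C))); last first.
  by apply/funext => x; rewrite mulrA.
rewrite (cintegralZ _ measurable_IR (cintegrableM_real ui cd)).
by rewrite (cintegralZ _ measurable_IR (cintegrableM_real vi cphi)) uv// mulrN.
Qed.

End weak_derivative.

Section primitive.
Context {R : realType} (l : R).
Local Notation mu := (@lebesgue_measure R).
Local Notation mu2 := (mu \x mu)%E.
Local Notation MR := (measurableTypeR R).
Local Notation IR := (Iopen l : set MR).
Local Notation OmegaR := (Omega l : set (MR * MR)).
Hint Resolve measurable_IR : core.

Lemma crestrict_Omega_section1 (F : R * R -> R[i]) x : Iopen l x ->
  (fun s => crestrict OmegaR F (x, s)) = crestrict IR (fun s => F (x, s)).
Proof.
move=> Ix; apply/funext => s; have [Is|Is] := pselect (Iopen l s).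
  by rewrite !crestrict_in.
by rewrite !crestrict_out// => -[].
Qed.

Lemma crestrict_Omega_section2 (F : R * R -> R[i]) s : Iopen l s ->
  (fun x => crestrict OmegaR F (x, s)) = crestrict IR (fun x => F (x, s)).
Proof.
move=> Is; apply/funext => x; have [Ix|Ix] := pselect (Iopen l x).
  by rewrite !crestrict_in.
by rewrite !crestrict_out// => -[].
Qed.

Lemma cintegral0 (D : set MR) : cintegral mu D (fun=> 0) = 0 :> R[i].
Proof. by rewrite /cintegral /Rintegral /= !integral0_eq. Qed.

Lemma cintegral_section1 (F : R * R -> R[i]) :
  (fun x => cintegral mu setT (fun s => crestrict OmegaR F (x, s))) =
  crestrict IR (fun x => cintegral mu IR (fun s => F (x, s))).
Proof.
apply/funext => x; have [Ix|Ix] := pselect (Iopen l x).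
  by rewrite [RHS]crestrict_in// (crestrict_Omega_section1 _ Ix) -cintegral_crestrict.
rewrite [RHS]crestrict_out// -[RHS](cintegral0 setT); congr cintegral.
by apply/funext => s; rewrite crestrict_out// => -[].
Qed.

Lemma cintegral_section2 (F : R * R -> R[i]) :
  (fun s => cintegral mu setT (fun x => crestrict OmegaR F (x, s))) =
  crestrict IR (fun s => cintegral mu IR (fun x => F (x, s))).
Proof.
apply/funext => s; have [Is|Is] := pselect (Iopen l s).
  by rewrite [RHS]crestrict_in// (crestrict_Omega_section2 _ Is) -cintegral_crestrict.
rewrite [RHS]crestrict_out// -[RHS](cintegral0 setT); congr cintegral.
by apply/funext => x; rewrite crestrict_out// => -[].
Qed.

Lemma cintegrable_Omega_section1 (F : R * R -> R[i]) :
  cintegrable mu2 setT (crestrict OmegaR F) ->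
  cintegrable mu IR (fun x => cintegral mu IR (fun s => F (x, s))).
Proof.
move=> Fi; apply/cintegrable_crestrict => //; rewrite -cintegral_section1.
exact: cintegrable_fubini1.
Qed.

Lemma cintegral_fubini_Omega (F : R * R -> R[i]) :
  cintegrable mu2 setT (crestrict OmegaR F) ->
  cintegral mu IR (fun x => cintegral mu IR (fun s => F (x, s))) =
  cintegral mu IR (fun s => cintegral mu IR (fun x => F (x, s))).
Proof.
move=> Fi; rewrite [LHS]cintegral_crestrict [RHS]cintegral_crestrict.
rewrite -cintegral_section1 -cintegral_section2.
by rewrite (cintegral_fubini1 Fi) (cintegral_fubini2 Fi).
Qed.

(** Majorant on the square for a bounded kernel times an integrable function of the second variable;
    Tonelli applies as the interval has finite length. *)
Lemma integrable_indic_tensor (H : R -> R) (M : R) : 0 <= M -> (forall t, 0 <= H t) ->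
  mu.-integrable setT (EFin \o H) ->
  mu2.-integrable setT (EFin \o (fun z => M * (\1_IR z.1 * H z.2))).
Proof.
move=> M0 H0 iH.
have mH : measurable_fun [set: MR] H by apply/measurable_EFinP; exact: (measurable_int mu iH).
suff i : mu2.-integrable setT (EFin \o (fun z => \1_IR z.1 * H z.2)).
  exact: (integrableZl measurableT M i).
have m2 : measurable_fun [set: MR * MR] (EFin \o (fun z => \1_IR z.1 * H z.2)).
  apply/measurable_EFinP; apply: measurable_funM.
    by apply: (measurableT_comp _ measurable_fst); exact: measurable_indic.
  exact: (measurableT_comp mH measurable_snd).
apply: (integrable12ltyP mu mu m2).2.
have iHfin : (\int[mu]_y (H y)%:E < +oo)%E.
  have /integrableP[_] := iH; under eq_integral do rewrite /= ger0_norm//.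
  by [].
rewrite (_ : (fun x => _) = (fun x => (\1_IR x)%:E * \int[mu]_y (H y)%:E)%E); last first.
  apply/funext => x; rewrite -ge0_integralZl//=.
  - apply: eq_integral => y _; rewrite -EFinM ger0_norm// mulr_ge0//.
  - exact/measurable_EFinP.
  - by move=> y _; rewrite lee_fin.
rewrite ge0_integralZr//=; last 2 first.
- by apply/measurable_EFinP; apply: measurable_indic; exact: measurable_IR.
- by apply: integral_ge0 => y _; rewrite lee_fin.
rewrite integral_indic//; last exact: measurable_IR.
rewrite setIT; apply: lte_mul_pinfty => //.
rewrite ge0_fin_numE//; exact: mu_IR_lty.
Qed.

(** The integrability needed for every exchange of integrals below, with [b] built from [psig], from
    the derivative of a test function or from [kap]. *)
Lemma bounded_kernel_cintegrable (b : R * R -> R[i]) (h : R -> R[i]) (M : R) :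
  cmeasurable_on OmegaR b -> (forall z, Omega l z -> cmodulus (b z) <= M) ->
  cintegrable mu IR h -> cintegrable mu2 setT (crestrict OmegaR (fun z => b z * h z.2)).
Proof.
move=> mb bM hi; have mO := @measurable_Omega R l.
have mh := cintegrable_cmeasurable hi.
pose H t := cmodulus (crestrict IR h t).
have iH : mu.-integrable setT (EFin \o H).
  by apply: cintegrable_norm => //; apply: (cintegrable_crestrict mu h _).1.
have i2 := integrable_indic_tensor (normr_ge0 M) (fun t => cmodulus_ge0 (crestrict IR h t)) iH.
apply: (le_cintegrable measurableT _ _ i2).
  apply: cmeasurable_crestrict => //; apply: cmeasurableM => //.
  apply: (@eq_cmeasurable _ _ _ OmegaR (fun z => crestrict IR h z.2)).
    by move=> z /set_mem[_ Iz]; rewrite crestrict_in.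
  have [m1 m2] : cmeasurable_on setT (crestrict IR h) by exact: cmeasurable_crestrict.
  split; apply: (@measurable_funS _ _ _ _ setT) => //.
    exact: (measurableT_comp m1 measurable_snd).
  exact: (measurableT_comp m2 measurable_snd).
move=> z _; have [Oz|Oz] := pselect (Omega l z); last first.
  by rewrite crestrict_out// cmodulus0 !mulr_ge0// cmodulus_ge0.
rewrite crestrict_in//; have [Oz1 Oz2] := Oz.
rewrite indicE mem_set// mul1r crestrict_in// cmodulusM ler_wpM2r ?cmodulus_ge0//.
by rewrite (le_trans (bM _ Oz))// ler_norm.
Qed.

(** Signed indicator function: [\int psig x s * h s ds] is the integral of [h] from [0]
    to [x], with the orientation of the interval when [x < 0]. *)
Definition psig (x s : R) : R := (if s < x then 1 else 0) - (if s < 0 then 1 else 0).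

Definition prim (h : R -> R[i]) (x : R) : R[i] :=
  cintegral mu IR (fun s => (psig x s)%:C%C * h s).

Lemma normr_psig_le x s : `|psig x s| <= 1.
Proof.
by rewrite /psig; do 2 case: ifP => _; rewrite ?subrr ?subr0 ?sub0r ?normrN ?normr0 ?normr1.
Qed.

Lemma measurable_psig : measurable_fun [set: MR * MR] (fun z => psig z.1 z.2).
Proof.
apply: measurable_funB; apply: measurable_fun_ifT => //.
- by apply: measurable_fun_ltr; [exact: measurable_snd|exact: measurable_fst].
- by apply: measurable_fun_ltr; [exact: measurable_snd|exact: measurable_cst].
Qed.

Lemma cintegrable_psig (h : R -> R[i]) x : cintegrable mu IR h ->
  cintegrable mu IR (fun s => (psig x s)%:C%C * h s).
Proof.
move=> hi; apply: (@cintegrableM_bounded _ _ _ mu IR _ _ 1) => //.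
  apply: cmeasurable_real; apply: (@measurable_funS _ _ _ _ setT) => //.
  exact: (measurable_fun_pair2 (T1 := MR) (T2 := MR) (f := fun z => psig z.1 z.2) x
    measurable_psig).
by move=> s _; rewrite cmodulus_real normr_psig_le.
Qed.

Lemma primD (h k : R -> R[i]) x : cintegrable mu IR h -> cintegrable mu IR k ->
  prim (fun s => h s + k s) x = prim h x + prim k x.
Proof.
move=> hi ki; rewrite /prim -cintegralD//; [|exact: cintegrable_psig|exact: cintegrable_psig].
by congr cintegral; apply/funext => s; rewrite mulrDr.
Qed.

Lemma primZ c (h : R -> R[i]) x : cintegrable mu IR h ->
  prim (fun s => c * h s) x = c * prim h x.
Proof.
move=> hi; rewrite /prim -cintegralZ//; last exact: cintegrable_psig.
by congr cintegral; apply/funext => s; rewrite mulrCA.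
Qed.

Lemma ae_eq_prim (h k : R -> R[i]) x : cintegrable mu IR h -> cintegrable mu IR k ->
  ae_eq mu IR h k -> prim h x = prim k x.
Proof.
move=> hi ki hk; apply: ae_eq_cintegral => //.
- exact/cintegrable_cmeasurable/cintegrable_psig.
- exact/cintegrable_cmeasurable/cintegrable_psig.
- by apply: ae_imply hk => s /[apply] ->.
Qed.

Lemma cmodulus_prim_le (h : R -> R[i]) x : cintegrable mu IR h ->
  cmodulus (prim h x) <= 2 * \int[mu]_(s in IR) cmodulus (h s).
Proof.
move=> hi; apply: cmodulus_cintegral_le => //.
- exact/cintegrable_cmeasurable/cintegrable_psig.
- move=> s _; rewrite cmodulusM cmodulus_real ler_piMl ?cmodulus_ge0//.
  exact: normr_psig_le.
- exact: cintegrable_norm.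
Qed.

Lemma cintegrable_prim (h : R -> R[i]) : cintegrable mu IR h ->
  cintegrable mu IR (prim h).
Proof.
move=> hi; apply: (@cintegrable_Omega_section1 (fun z => (psig z.1 z.2)%:C%C * h z.2)).
apply: (@bounded_kernel_cintegrable (fun z => (psig z.1 z.2)%:C%C) _ 1) => //.
  apply: cmeasurable_real; apply: (@measurable_funS _ _ _ _ setT) => //.
  exact: measurable_psig.
by move=> z _; rewrite cmodulus_real normr_psig_le.
Qed.

Lemma test_function_end (phi : R -> R) : test_function (Iopen l) phi ->
  phi (- l) = 0 /\ phi l = 0.
Proof.
move=> tphi; split; apply: (test_function_out tphi); rewrite /Iopen/= in_itv/=.
  by rewrite ltxx.
by rewrite ltxx andbF.
Qed.

Lemma Rintegral_test_tail (phi : R -> R) s : test_function (Iopen l) phi ->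
  - l <= s -> s < l -> \int[mu]_(x in `]s, l[) ('D_1 phi x) = - phi s.
Proof.
move=> tphi ls sl; have [dphi cd] := test_function_derivable (1 : R) tphi.
have cphi := test_function_continuous tphi.
have i1 : mu.-integrable `[s, l] (EFin \o 'D_1 phi).
  apply: continuous_compact_integrable; first exact: segment_compact.
  exact: continuous_subspaceT.
have i2 : mu.-integrable `]s, l[ (EFin \o 'D_1 phi).
  apply: (@integrableS _ _ R mu [set` `[s, l]] [set` `]s, l[]) => //.
  - exact: subset_itv_oo_cc.
have i3 : mu.-integrable `[s, l[ (EFin \o 'D_1 phi).
  apply: (@integrableS _ _ R mu [set` `[s, l]] [set` `[s, l[]) => //.
  - exact: subset_itv_co_cc.
rewrite Rintegral_itv_obnd_cbnd// Rintegral_itv_bndo_bndc//.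
rewrite /Rintegral (continuous_FTC2 (F := phi))//.
- by have [_ pl] := test_function_end tphi; rewrite pl /= sub0r.
- exact: continuous_subspaceT.
- split; [by move=> x _; exact: dphi|exact/cvg_at_right_filter/cphi|exact/cvg_at_left_filter/cphi].
- by move=> x _; rewrite derive1E.
Qed.

(** As a function of [x], [psig x s] is the indicator of [s < x] minus a constant. The constant
    contributes nothing, since [phi] vanishes at both endpoints; the indicator gives
    [phi l - phi s]. *)
Lemma Rintegral_psig_test (phi : R -> R) s : test_function (Iopen l) phi ->
  Iopen l s -> \int[mu]_(x in IR) (psig x s * 'D_1 phi x) = - phi s.
Proof.
move=> tphi; rewrite /Iopen/= in_itv/= => /andP[ls sl].
have [dphi cd] := test_function_derivable (1 : R) tphi.
have iD : mu.-integrable IR (EFin \o 'D_1 phi).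
  apply: (@integrableS _ _ R mu (Iclosed l) IR) => //.
  - exact: measurable_itv.
  - exact: subset_itv_oo_cc.
  - apply: continuous_compact_integrable; first exact: segment_compact.
    exact: continuous_subspaceT.
have i1 : mu.-integrable IR (EFin \o (fun x => (if s < x then 1 else 0) * 'D_1 phi x)).
  apply: (le_integrable _ _ _ iD) => //.
    apply/measurable_EFinP; apply: measurable_funM.
      by apply: measurable_fun_if => //; apply: measurable_fun_ltr => //; exact: measurable_cst.
    by apply: (@measurable_funS _ _ _ _ setT) => //; exact: continuous_measurable_fun.
  by move=> x _; rewrite lee_fin; case: ifP => _; rewrite ?mul1r// mul0r normr0.
rewrite (_ : (fun x => _) = (fun x => (if s < x then 1 else 0) * 'D_1 phi x -
    (if s < 0 then 1 else 0) * 'D_1 phi x)); last first.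
  by apply/funext => x; rewrite -mulrBl.
have i2 : mu.-integrable IR (EFin \o (fun x => (if s < 0 then 1 else 0) * 'D_1 phi x)).
  exact: (integrableZl _ _ iD).
rewrite (@RintegralB _ _ _ mu IR _ _ (measurable_IR l) i1 i2).
rewrite (@RintegralZl _ _ _ mu IR _ _ (measurable_IR l) iD).
rewrite [X in _ - _ * X](_ : _ = 0); last first.
  have := Rintegral_test_tail tphi (lexx _) (lt_trans ls sl).
  by have [-> _] := test_function_end tphi; rewrite oppr0.
rewrite mulr0 subr0 -(Rintegral_test_tail tphi (ltW ls) sl).
rewrite (@Rintegral_sub _ IR `]s, l[).
- by apply: eq_Rintegral => x /set_mem/=; rewrite in_itv/= => /andP[-> _]; rewrite mul1r.
- by apply: subset_itvr; rewrite bnd_simp ltW.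
- move=> x; rewrite /Iopen/= !in_itv/= => /andP[_ ->]; rewrite andbT => /negP/negbTE ->.
  by rewrite mul0r.
Qed.

(** Writing [prim] as an integral over a fixed interval with kernel [psig] turns integration by
    parts into Fubini's theorem followed by [Rintegral_psig_test]. *)
Lemma is_weak_deriv_prim (h : R -> R[i]) : cintegrable mu IR h ->
  is_weak_deriv l (prim h) h.
Proof.
move=> hi; split; [exact/cintegrable_L1loc/cintegrable_prim|exact: cintegrable_L1loc|].
move=> phi tphi; have [dphi cd] := test_function_derivable (1 : R) tphi.
have cphi := test_function_continuous tphi.
have [B [B0 HB]] := continuous_bounded_Iopen l cd.
pose b (z : R * R) : R[i] := (psig z.1 z.2 * 'D_1 phi z.1)%:C%C.
have Fi : cintegrable mu2 setT (crestrict OmegaR (fun z => b z * h z.2)).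
  apply: (@bounded_kernel_cintegrable b _ B) => //.
    apply: cmeasurable_real; apply: measurable_funM.
      apply: (@measurable_funS _ _ _ _ setT) => //; exact: measurable_psig.
    exact: (measurable_fst_comp cd).
  move=> z [Iz _]; rewrite /b cmodulus_real normrM -[leRHS]mul1r ler_pM// ?normr_psig_le//.
  exact: HB.
have -> : cintegral mu (Iopen l) (fun x => prim h x * ('D_1 phi x)%:C%C) =
    cintegral mu IR (fun x => cintegral mu IR (fun s => b (x, s) * h s)).
  congr cintegral; apply/funext => x.
  rewrite /prim mulrC -(cintegralZ _ (measurable_IR l) (cintegrable_psig x hi)).
  congr cintegral; apply/funext => s; rewrite /b/= mulrA; congr (_ * _).
  by rewrite mulrC rmorphM.
rewrite (cintegral_fubini_Omega Fi) /=.
rewrite -(cintegralN (measurable_IR l) (cintegrableM_real hi cphi)).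
apply: eq_cintegral => s /set_mem Is; rewrite -mulrN.
have -> : (fun x => b (x, s) * h s) = (fun x => h s * b (x, s)).
  by apply/funext => x; rewrite mulrC.
have bi : cintegrable mu IR (fun x => b (x, s)).
  apply: (@le_cintegrable _ _ _ mu IR _ (fun=> B)) => //.
  - apply: cmeasurable_real; apply: measurable_funM.
      apply: (@measurable_funS _ _ _ _ setT) => //.
      exact: (measurable_fun_pair1 (T1 := MR) (T2 := MR) (f := fun z => psig z.1 z.2) s
        measurable_psig).
    by apply: (@measurable_funS _ _ _ _ setT) => //; exact: continuous_measurable_fun.
  - move=> x Ix; rewrite /b cmodulus_real normrM -[leRHS]mul1r ler_pM// ?normr_psig_le//.
    exact: HB.
  - apply: (@bounded_integrable_itv _ _ `|B| `]- l, l[) => //.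
    exact: mu_IR_lty.
rewrite (cintegralZ (h s) (measurable_IR l) bi); congr (_ * _).
apply: complex_eq => /=.
  by rewrite (Rintegral_psig_test tphi Is).
by rewrite /Rintegral integral0_eq//= oppr0.
Qed.

End primitive.

(** * The transmutation operator as a primitive *)

Section transmutation_primitive.
Context {R : realType} (l : R).
Local Notation mu := (@lebesgue_measure R).
Local Notation mu2 := (mu \x mu)%E.
Local Notation MR := (measurableTypeR R).
Local Notation IR := (Iopen l : set MR).
Local Notation OmegaR := (Omega l : set (MR * MR)).
Local Notation mI := (measurable_IR l).

Lemma ae_neq (c : R) : {ae mu, forall s, s != c}.
Proof.
exists [set c]; split => //; first exact: lebesgue_measure_set1.
by move=> s /= /negP/negPn/eqP.
Qed.

(** The analogue of [psig] for the oriented integral from [- s] to [s]. *)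
Definition orient (s t : R) : R :=
  if `|t| <= `|s| then if 0 <= s then 1 else -1 else 0.

Lemma normr_orient_le s t : `|orient s t| <= 1.
Proof. by rewrite /orient; do 2?case: ifP => _; rewrite ?normrN ?normr0 ?normr1. Qed.

Lemma measurable_orient : measurable_fun [set: MR * MR] (fun z => orient z.1 z.2).
Proof.
apply: measurable_fun_ifT => //.
  apply: measurable_fun_ler; apply: measurableT_comp => //.
apply: measurable_fun_ifT => //.
by apply: measurable_fun_ler; [exact: measurable_cst|exact: measurable_fst].
Qed.

(** For [x < 0] both factors are -1 where they do not vanish, so the product is an indicator in
    either case: that of the segment joining [|t|] or [- |t|] to [x]. The excluded values of [s] are
    those where strict and large inequalities disagree. *)
Lemma psig_orient x s t : s != x -> s != 0 -> s != `|t| -> s != - `|t| ->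
  psig x s * orient s t =
  (if 0 <= x then (`|t| < s <= x)%R else (x < s <= - `|t|)%R)%:R.
Proof.
move=> sx s0 st snt; rewrite /psig /orient; have := normr_ge0 t.
move: st snt; set T := `|t| => st snt T0.
have [x0|x0] := leP 0 x; have [s0'|s0'|s00] := ltgtP s 0;
  try by rewrite s00 eqxx in s0.
- rewrite (lt_le_trans s0' x0) subrr mul0r.
  by rewrite (_ : (T < s) = false)//; apply/negbTE; rewrite -leNgt (le_trans (ltW s0')).
- rewrite subr0 gtr0_norm//; have -> : (s < x) = (s <= x) by rewrite lt_neqAle sx.
  have -> : (T <= s) = (T < s) by rewrite [RHS]lt_neqAle eq_sym st.
  by case: (T < s); case: (s <= x); rewrite /= ?mulr1 ?mulr0.
- rewrite ltr0_norm//; have -> : (s < x) = ~~ (x < s).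
    by rewrite -leNgt lt_neqAle sx.
  have -> : (T <= - s) = (s <= - T) by rewrite lerNr.
  by case: (x < s); case: (s <= - T);
    rewrite /= ?subrr ?sub0r ?mulr0 ?mul0r ?mulrNN ?mulr1.
- rewrite (_ : (s < x) = false); last by apply/negbTE; rewrite -leNgt ltW// (lt_trans x0).
  rewrite subrr mul0r (_ : (s <= - T) = false) ?andbF//.
  by apply/negbTE; rewrite -ltNge (le_lt_trans _ s0')// oppr_le0.
Qed.

(** For either sign of [x] the domain is [[- |x|, |x|]]; the orientation only contributes a sign. *)
Lemma oriented_integralE (f : R -> R[i]) x : Iopen l x -> cintegrable mu IR f ->
  oriented_integral (- x) x f = cintegral mu IR (fun t => (orient x t)%:C%C * f t).
Proof.
move=> Ix fi.
have sub : `[- `|x|, `|x|] `<=` IR.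
  move: Ix; rewrite /Iopen/= in_itv/= -ltr_norml => xl.
  by apply: subset_itv_Iopen => //; rewrite ltrN2.
have mJ : measurable ([set` `[- `|x|, `|x|]] : set MR) by exact: measurable_itv.
have E (c : R) : c = orient x 0 ->
    (fun t => (orient x t)%:C%C * f t) =
    crestrict (`[- `|x|, `|x|] : set MR) (fun t => c%:C%C * f t).
  move=> ->; apply/funext => t; rewrite /crestrict /orient normr0 normr_ge0 /=.
  rewrite -[in LHS]/(`|t| <= `|x|) ler_norml.
  by case: ifPn => h; [rewrite mem_set|rewrite memNset ?mul0r//=; apply/negP].
have crestrictI (h : R -> R[i]) :
    crestrict IR (crestrict (`[- `|x|, `|x|] : set MR) h) =
    crestrict (`[- `|x|, `|x|] : set MR) h.
  apply/funext => t; have [It|It] := pselect (Iopen l t); first by rewrite crestrict_in.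
  rewrite [LHS]crestrict_out// crestrict_out// => /sub; exact: It.
rewrite (E _ erefl) [RHS]cintegral_crestrict crestrictI -cintegral_crestrict.
rewrite (cintegralZ _ mJ (cintegrableS mI mJ sub fi)).
rewrite /oriented_integral /orient normr0 normr_ge0.
have -> : (- x <= x) = (0 <= x) by apply/idP/idP; lra.
case: ifPn => [x0|]; first by rewrite ger0_norm// mul1r.
by rewrite -ltNge => x0; rewrite ltr0_norm// opprK rmorphN mulN1r.
Qed.

Section kernel.
Variables (K g : R * R -> R[i]) (M : R) (a : R -> R) (Mk : R).
Hypothesis mg : cmeasurable_on [set: MR * MR] g.
Hypothesis gM : forall z, cmodulus (g z) <= M.
Hypothesis incr : {ae mu, forall t, Iopen l t -> forall x0 x1,
  - l < x0 -> x0 <= x1 -> x1 < l ->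
  K (x1, t) - K (x0, t) = cintegral mu `]x0, x1] (fun s => g (s, t))}.
Hypothesis diag : forall x, Iclosed l x -> K (x, x) = (1 - (a x)^-1)%:C%C.
Hypothesis antidiag : forall x, Iclosed l x -> K (x, - x) = 0.

Definition kap (z : R * R) : R[i] := (orient z.1 z.2)%:C%C * g z.

Definition Gop (v : R -> R[i]) (s : R) : R[i] :=
  cintegral mu IR (fun t => kap (s, t) * v t).

Lemma cmodulus_kap_le z : cmodulus (kap z) <= M.
Proof.
rewrite /kap cmodulusM cmodulus_real (le_trans _ (gM z))//.
by rewrite ler_piMl ?cmodulus_ge0// normr_orient_le.
Qed.

Lemma measurable_kap : cmeasurable_on [set: MR * MR] kap.
Proof. by apply: cmeasurableM => //; exact: cmeasurable_real measurable_orient. Qed.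

Lemma measurable_pair1_kap t : cmeasurable_on [set: MR] (fun s => kap (s, t)).
Proof.
have [m1 m2] := measurable_kap; split.
  exact: (measurable_fun_pair1 (T1 := MR) (T2 := MR) (f := fun z => Re (kap z)) t m1).
exact: (measurable_fun_pair1 (T1 := MR) (T2 := MR) (f := fun z => Im (kap z)) t m2).
Qed.

Lemma measurable_pair2_kap s : cmeasurable_on [set: MR] (fun t => kap (s, t)).
Proof.
have [m1 m2] := measurable_kap; split.
  exact: (measurable_fun_pair2 (T1 := MR) (T2 := MR) (f := fun z => Re (kap z)) s m1).
exact: (measurable_fun_pair2 (T1 := MR) (T2 := MR) (f := fun z => Im (kap z)) s m2).
Qed.

Lemma cintegrable_kap (v : R -> R[i]) s : cintegrable mu IR v ->
  cintegrable mu IR (fun t => kap (s, t) * v t).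
Proof.
move=> vi; apply: (@cintegrableM_bounded _ _ _ mu IR _ _ M) => //; first exact: mI.
  exact: cmeasurableS (measurable_pair2_kap s).
by move=> t _; exact: cmodulus_kap_le.
Qed.

Lemma cintegrable_Gop (v : R -> R[i]) : cintegrable mu IR v -> cintegrable mu IR (Gop v).
Proof.
move=> vi; apply: (@cintegrable_Omega_section1 _ l (fun z => kap z * v z.2)).
apply: (@bounded_kernel_cintegrable _ _ kap _ M) => //.
  exact: cmeasurableS measurable_kap.
by move=> z _; exact: cmodulus_kap_le.
Qed.

(** If [|t| <= |x|], the increment is taken from [|t|] or [- |t|], on the side of [x]. That starting
    point lies on the diagonal when [t] and [x] have the same sign, which is when [psig x t] does
    not vanish, and on the antidiagonal, where [K] is 0, otherwise. If [|t| > |x|], all terms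
    vanish. *)
Lemma kernel_psig x : Iopen l x -> {ae mu, forall t, Iopen l t ->
  (orient x t)%:C%C * K (x, t) = (psig x t)%:C%C * (1 - (a t)^-1)%:C%C +
    cintegral mu IR (fun s => (psig x s)%:C%C * kap (s, t))}.
Proof.
move=> Ix; apply: ae_imply2 incr (ae_neq x) => t + tx It => /(_ It) inc.
(* The value [t = x] has been excluded because [psig] uses a strict inequality: for [x >= 0] it is 0
   there although [(x, x)] is on the diagonal. *)
move: (Ix) (It); rewrite /Iopen/= !in_itv/= => /andP[lx xl] /andP[lt tl].
have tIc : Iclosed l t by exact: subset_itv_oo_cc.
have ntIc : Iclosed l (- t) by rewrite /Iclosed/= in_itv/=; apply/andP; split; lra.
(* By [psig_orient], this is up to finitely many points the set of [s] where [psig x s * orient s t]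
   is 1. *)
pose J : set MR := [set s | if 0 <= x then `|t| < s <= x else x < s <= - `|t|].
have mJ : measurable J.
  rewrite /J; case: (0 <= x).
    rewrite (_ : [set _ | _] = [set` `]`|t|, x]]); first exact: measurable_itv.
    by apply/seteqP; split => s /=; rewrite in_itv.
  rewrite (_ : [set _ | _] = [set` `]x, - `|t|]]); first exact: measurable_itv.
  by apply/seteqP; split => s /=; rewrite in_itv.
have JI : J `<=` IR.
  move=> s; rewrite /J/= /Iopen/= in_itv/=; have := normr_ge0 t.
  by move=> T0; case: ifPn => _ /andP[h1 h2]; apply/andP; split; lra.
have mgt : cmeasurable_on [set: MR] (fun s => g (s, t)).
  have [m1 m2] := mg; split.
    exact: (measurable_fun_pair1 (T1 := MR) (T2 := MR) (f := fun z => Re (g z)) t m1).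
  exact: (measurable_fun_pair1 (T1 := MR) (T2 := MR) (f := fun z => Im (g z)) t m2).
have -> : cintegral mu IR (fun s => (psig x s)%:C%C * kap (s, t)) =
    cintegral mu J (fun s => g (s, t)).
  rewrite [RHS]cintegral_crestrict.
  rewrite (_ : crestrict J _ = crestrict IR (crestrict J (fun s => g (s, t)))); last first.
    apply/funext => s; have [Is|Is] := pselect (Iopen l s); first by rewrite [RHS]crestrict_in.
    by rewrite [RHS]crestrict_out// crestrict_out// => /JI; exact: Is.
  rewrite -cintegral_crestrict; apply: ae_eq_cintegral; first exact: mI.
  - apply: cmeasurableM; last exact: cmeasurableS (measurable_pair1_kap t).
    apply: cmeasurable_real; apply: (@measurable_funS _ _ _ _ setT) => //.
    exact: (measurable_fun_pair2 (T1 := MR) (T2 := MR) (f := fun z => psig z.1 z.2) x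
      measurable_psig).
  - apply: (@cmeasurableS _ _ _ _ setT) => //; apply: cmeasurable_crestrict => //.
    exact: cmeasurableS mgt.
  - have N1 := ae_neq x; have N2 := ae_neq 0.
    have N3 := ae_neq `|t|; have N4 := ae_neq (- `|t|).
    have N12 := ae_imply2 (fun s h1 h2 => conj h1 h2) N1 N2.
    have N34 := ae_imply2 (fun s h1 h2 => conj h1 h2) N3 N4.
    apply: ae_imply2 N12 N34 => s [n1 n2] [n3 n4] _.
    rewrite /kap/= mulrA -rmorphM/= psig_orient//.
    have [sJ|sJ] := pselect (J s).
      by rewrite crestrict_in//; move: sJ; rewrite /J/= => ->; rewrite mul1r.
    rewrite crestrict_out//.
    have -> : (if 0 <= x then `|t| < s <= x else x < s <= - `|t|) = false.
      by apply/negbTE/negP => h; exact: sJ.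
    by rewrite mul0r.
have T0 := normr_ge0 t.
rewrite /orient /psig; have [x0|x0] := leP 0 x.
- rewrite (ger0_norm x0); have [tx'|xt] := leP `|t| x.
    have -> : J = [set` `]`|t|, x]].
      by apply/seteqP; split => s; rewrite /J/= x0 in_itv.
    rewrite -(inc _ _ _ tx' xl) ?(lt_le_trans _ T0)//; last by lra.
    rewrite mul1r; have [t0|t0] := ltP t 0.
      rewrite ltr0_norm// -[X in K (- t, X)]opprK antidiag// subr0.
      by rewrite (lt_le_trans t0 x0) subrr mul0r add0r.
    rewrite ger0_norm// diag// subr0.
    have -> : t < x by rewrite lt_neqAle tx/= -(ger0_norm t0).
    by rewrite mul1r addrC subrK.
  have -> : J = set0.
    apply/seteqP; split => s //; rewrite /J/= x0 => /andP[h1 h2]; move: xt; rewrite ltNge => /negP; apply.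
    exact: ltW (lt_le_trans h1 h2).
  rewrite mul0r (_ : cintegral _ set0 _ = 0); last first.
    by rewrite /cintegral !Rintegral_set0.
  rewrite addr0; move: xt; rewrite ltr_normr => /orP[xt|xt].
    by rewrite !ltNge (ltW xt) (le_trans x0 (ltW xt))/= subrr mul0r.
  have t0 : t < 0 by lra.
  by rewrite t0 (lt_le_trans t0 x0) subrr mul0r.
- rewrite (ltr0_norm x0); have [tx'|xt] := leP `|t| (- x).
    have xt : x <= - `|t| by lra.
    have -> : J = [set` `]x, - `|t|]].
      by apply/seteqP; split => s; rewrite /J/= leNgt x0 in_itv.
    rewrite -(inc _ _ lx xt); last by lra.
    rewrite rmorphN mulN1r; have [t0|t0] := ltP t 0.
      rewrite ltr0_norm// opprK diag//.
      have -> : (t < x) = false by apply/negbTE; rewrite -leNgt; move: tx'; rewrite ltr0_norm//; lra.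
      by rewrite sub0r rmorphN mulN1r addrA addNr add0r.
    rewrite ger0_norm// -[X in K (- t, X)]opprK antidiag// sub0r.
    have -> : (t < x) = false by apply/negbTE; rewrite -leNgt; lra.
    by rewrite subrr mul0r add0r.
  have -> : J = set0.
    apply/seteqP; split => s //; rewrite /J/= leNgt x0 => /andP[h1 h2]; move: xt.
    by rewrite ltNge => /negP; apply; lra.
  rewrite mul0r (_ : cintegral _ set0 _ = 0); last first.
    by rewrite /cintegral !Rintegral_set0.
  rewrite addr0; move: xt; rewrite ltr_normr => /orP[xt|xt].
    have t0 : 0 <= t by lra.
    by rewrite !ltNge t0 (le_trans (ltW x0) t0)/= subrr mul0r.
  have tx0 : t < x by lra.
  by rewrite tx0 (lt_trans tx0 x0) subrr mul0r.
Qed.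

Hypothesis mK : cmeasurable_on OmegaR K.
Hypothesis KM : forall z, Omega_closed l z -> cmodulus (K z) <= Mk.
Hypothesis ma : cmeasurable_on IR (fun x => ((a x)^-1)%:C%C).

(** The coefficient is bounded because it is the restriction of the bounded kernel [K] to the
    diagonal. *)
Lemma cintegrable_coef (v : R -> R[i]) : cintegrable mu IR v ->
  cintegrable mu IR (fun t => (1 - (a t)^-1)%:C%C * v t).
Proof.
move=> vi; apply: (@cintegrableM_bounded _ _ _ mu IR _ _ Mk) => //; first exact: mI.
  rewrite (_ : (fun t => _) = (fun t => 1 - ((a t)^-1)%:C%C)).
    by apply: cmeasurableB => //; exact: cmeasurable_cst.
  by apply/funext => t; rewrite rmorphB.
move=> t It; have tI : Iclosed l t by exact: subset_itv_oo_cc.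
by rewrite -diag//; apply: KM.
Qed.

(** Multiply [kernel_psig] by [v t], integrate in [t] and exchange the two integrals in the last
    term. *)
Lemma oriented_kernel_integral (v : R -> R[i]) x : Iopen l x -> cintegrable mu IR v ->
  oriented_integral (- x) x (fun t => K (x, t) * v t) =
  prim l (fun t => (1 - (a t)^-1)%:C%C * v t + Gop v t) x.
Proof.
move=> Ix vi.
have mKx : cmeasurable_on IR (fun t => K (x, t)).
  have [m1 m2] : cmeasurable_on [set: MR * MR] (crestrict OmegaR K).
    by apply: cmeasurable_crestrict => //; exact: measurable_Omega.
  apply: (@eq_cmeasurable _ _ _ _ (fun t => crestrict OmegaR K (x, t))).
    by move=> t /set_mem It; rewrite crestrict_in.
  split; apply: (@measurable_funS _ _ _ _ setT) => //.
    exact: (measurable_fun_pair2 (T1 := MR) (T2 := MR) (f := fun z => Re (crestrict OmegaR K z)) x m1).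
  exact: (measurable_fun_pair2 (T1 := MR) (T2 := MR) (f := fun z => Im (crestrict OmegaR K z)) x m2).
have iKv : cintegrable mu IR (fun t => K (x, t) * v t).
  apply: (@cintegrableM_bounded _ _ _ mu IR _ _ Mk) => //; first exact: mI.
  by move=> t It; apply: KM; split; exact: subset_itv_oo_cc.
rewrite oriented_integralE//.
have ci := cintegrable_coef vi.
pose b (z : R * R) := (psig x z.1)%:C%C * kap z.
have mpsig : measurable_fun [set: MR] (psig x).
  exact: (measurable_fun_pair2 (T1 := MR) (T2 := MR) (f := fun z => psig z.1 z.2) x
      measurable_psig).
have Fi : cintegrable mu2 setT (crestrict OmegaR (fun z => b z * v z.2)).
  apply: (@bounded_kernel_cintegrable _ _ b _ M) => //.
    apply: (@cmeasurableS _ _ _ _ setT) => //; apply: cmeasurableM; last exact: measurable_kap.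
    apply: cmeasurable_real; exact: (measurableT_comp mpsig measurable_fst).
  move=> z _; rewrite /b cmodulusM cmodulus_real -[leRHS]mul1r.
  by rewrite ler_pM ?cmodulus_ge0// ?normr_psig_le// cmodulus_kap_le.
have bi t : cintegrable mu IR (fun s => b (s, t)).
  apply: (@le_cintegrable _ _ _ mu IR _ (fun=> M)).
  - exact: mI.
  - apply: cmeasurableM; last exact: cmeasurableS (measurable_pair1_kap t).
    by apply: cmeasurable_real; apply: (@measurable_funS _ _ _ _ setT).
  - move=> s _; rewrite /b cmodulusM cmodulus_real -[leRHS]mul1r.
    by rewrite ler_pM ?cmodulus_ge0// ?normr_psig_le// cmodulus_kap_le.
  - apply: (@bounded_integrable_itv _ _ `|M| `]- l, l[) => //.
    exact: mu_IR_lty.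
rewrite primD//; last exact: cintegrable_Gop.
have Gi := cintegrable_Gop vi.
have -> : prim l (Gop v) x =
    cintegral mu IR (fun t => cintegral mu IR (fun s => b (s, t)) * v t).
  rewrite (_ : (fun t => _ * v t) = (fun t => cintegral mu IR (fun s => b (s, t) * v t))).
    rewrite -(cintegral_fubini_Omega Fi) /prim; congr cintegral; apply/funext => s.
    rewrite /Gop -(cintegralZ _ mI (cintegrable_kap s vi)); congr cintegral.
    by apply/funext => t; rewrite /b/= mulrA.
  apply/funext => t; rewrite mulrC -(cintegralZ _ mI (bi t)); congr cintegral.
  by apply/funext => s; rewrite mulrC.
have bvi : cintegrable mu IR (fun t => cintegral mu IR (fun s => b (s, t)) * v t).
  have := cintegrable_fubini2 Fi; rewrite cintegral_section2 => H.
  have := (cintegrable_crestrict mu (fun t => cintegral mu IR (fun s => b (s, t) * v t)) mI).2 H.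
  rewrite (_ : (fun t => cintegral _ _ _) =
    (fun t => cintegral mu IR (fun s => b (s, t)) * v t)) //.
  apply/funext => t; rewrite [RHS]mulrC -(cintegralZ _ mI (bi t)); congr cintegral.
  by apply/funext => s; rewrite mulrC.
rewrite /prim -cintegralD//; [|exact: mI|exact: cintegrable_psig].
apply: ae_eq_cintegral; first exact: mI.
- apply: cmeasurableM; last exact: cintegrable_cmeasurable iKv.
  apply: cmeasurable_real; apply: (@measurable_funS _ _ _ _ setT) => //.
  exact: (measurable_fun_pair2 (T1 := MR) (T2 := MR) (f := fun z => orient z.1 z.2) x
      measurable_orient).
- apply: cintegrable_cmeasurable; apply: cintegrableD; [exact: mI| |exact: bvi].
  exact: cintegrable_psig.
- have := kernel_psig Ix; apply: ae_imply => t + It => /(_ It) E.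
  by rewrite mulrA E mulrDl !mulrA.
Qed.

Lemma transmutationE (u : R -> R[i]) x : Iopen l x ->
  cintegrable mu IR (weak_deriv l u) ->
  transmutation l K u x = u x -
    prim l (fun t => (1 - (a t)^-1)%:C%C * weak_deriv l u t + Gop (weak_deriv l u) t) x.
Proof. by move=> Ix ui; rewrite /transmutation oriented_kernel_integral. Qed.

End kernel.

End transmutation_primitive.

(** * The Volterra equation *)

Section volterra.
Context {R : realType} (l : R).
Local Notation mu := (@lebesgue_measure R).
Local Notation MR := (measurableTypeR R).
Local Notation IR := (Iopen l : set MR).
Local Notation mI := (measurable_IR l).

Lemma cvg_of_geometric_increments (u : nat -> R) (C : R) : 0 <= C ->
  (forall n, `|u n.+1 - u n| <= C * 2^-1 ^+ n) -> cvgn u.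
Proof.
move=> C0 H.
have H1 : cvgn (series (telescope u)).
  apply: normed_cvg.
  apply: (@series_le_cvg _ _ (geometric C 2^-1)).
  - by move=> n /=.
  - by move=> n /=; rewrite mulr_ge0// exprn_ge0// invr_ge0.
  - by move=> n /=; exact: H.
  - apply: is_cvg_geometric_series; rewrite ger0_norm ?invr_ge0//.
    by rewrite invf_lt1// ltr1n.
have -> : u = (fun n => u 0%N + series (telescope u) n).
  by apply/funext => n; rewrite telescopeK addrC subrK.
by apply: is_cvgD => //; exact: is_cvg_cst.
Qed.

(** The weight has a corner at 0, so it is first bounded by the smooth function [2 cosh (lam t)],
    whose primitive is explicit. *)
Lemma Rintegral_exp_weight (lam r : R) : 0 < lam -> 0 < r ->
  \int[mu]_(t in `[- r, r]) expR (lam * `|t|) <= 2 * expR (lam * r) / lam.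
Proof.
move=> lam0 r0; have rr : - r < r by lra.
pose f t := expR (lam * t) + expR (- (lam * t)).
pose F t := (expR (lam * t) - expR (- (lam * t))) / lam.
have dF (t : R) : is_derive t (1 : R) F (f t).
  have d0 : is_derive t (1 : R) (lam \*: (id : R -> R)) (lam *: (1 : R)) by exact: is_deriveZ.
  have d1 : is_derive t (1 : R) (fun t : R => lam * t) lam.
    by apply: is_derive_eq d0 _; rewrite /GRing.scale/= mulr1.
  have d2 : is_derive t (1 : R) (fun t : R => - (lam * t)) (- lam) by exact: is_deriveN.
  have e1 : is_derive t (1 : R) (fun t => expR (lam * t)) (expR (lam * t) * lam).
    exact: (@is_derive1_comp _ expR).
  have e2 : is_derive t (1 : R) (fun t => expR (- (lam * t))) (expR (- (lam * t)) * - lam).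
    exact: (@is_derive1_comp _ expR (fun t => - (lam * t))).
  have e3 := is_deriveB e1 e2.
  have e4 := is_deriveM e3 (is_derive_cst (lam^-1) t (1 : R)).
  apply: is_derive_eq e4 _; rewrite scaler0 add0r /GRing.scale/= /f.
  by field; rewrite gt_eqF.
have cf : continuous f.
  move=> t; apply: cvgD.
    apply: (@continuous_comp _ _ _ (fun t => lam * t) expR); last exact: continuous_expR.
    by apply: cvgMr; exact: cvg_id.
  apply: (@continuous_comp _ _ _ (fun t => - (lam * t)) expR); last exact: continuous_expR.
  by apply: cvgN; apply: cvgMr; exact: cvg_id.
have cF t : {for t, continuous F}.
  by apply/differentiable_continuous/derivable1_diffP; exact: (@ex_derive _ _ _ _ _ _ _ (dF t)).
have If : \int[mu]_(t in `[- r, r]) f t = F r - F (- r).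
  rewrite /Rintegral (continuous_FTC2 (F := F))//.
  - exact: continuous_subspaceT.
  - split; [by move=> t _; exact: (@ex_derive _ _ _ _ _ _ _ (dF t))| |].
      exact/cvg_at_right_filter/cF.
    exact/cvg_at_left_filter/cF.
  - by move=> t _; rewrite derive1E; exact: (@derive_val _ _ _ _ _ _ _ (dF t)).
have cg : continuous (fun t : R => expR (lam * `|t|)).
  move=> t; apply: (@continuous_comp _ _ _ (fun t => lam * `|t|) expR); last exact: continuous_expR.
  by apply: cvgMr; exact: norm_continuous.
apply: (@le_trans _ _ (\int[mu]_(t in `[- r, r]) f t)).
  apply: le_Rintegral.
  - exact: measurable_itv.
  - apply: continuous_compact_integrable; first exact: segment_compact.
    exact: continuous_subspaceT.
  - apply: continuous_compact_integrable; first exact: segment_compact.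
    exact: continuous_subspaceT.
  - move=> t _; rewrite /f; have [t0|t0] := leP 0 t.
      by rewrite ger0_norm// lerDl expR_ge0.
    by rewrite ltr0_norm// mulrN lerDr expR_ge0.
rewrite If /F -mulrBl ler_pM2r ?invr_gt0//.
have := expR_ge0 (- (lam * r)); rewrite mulrN opprK.
by move: (expR _) (expR _) => x y; lra.
Qed.

Variables (g : R * R -> R[i]) (M : R) (a : R -> R) (A : R).
Hypothesis mg : cmeasurable_on [set: MR * MR] g.
Hypothesis gM : forall z, cmodulus (g z) <= M.
Hypothesis ma : measurable_fun IR a.
Hypothesis aA : forall x, Iopen l x -> `|a x| <= A.

Local Notation G := (Gop l g).
Definition Vop (v : R -> R[i]) (x : R) : R[i] := (a x)%:C%C * G v x.

(* For the norm [sup |v| / weight], the operator [Vop] is a contraction of ratio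
   [1/2]: the integral of [weight] over [[- r, r]] is at most [2 weight (r) / lam]. *)
Let C := 2 * `|A| * M + 1.
Let lam := 4 * C.
Let weight (x : R) := expR (lam * `|x|).

Let M0 : 0 <= M. Proof. exact: le_trans (cmodulus_ge0 _) (gM (0, 0)). Qed.
Let C_gt0 : 0 < C. Proof. by rewrite ltr_wpDl// !mulr_ge0. Qed.
Let lam_gt0 : 0 < lam. Proof. by rewrite mulr_gt0. Qed.
Let weight_ge1 x : 1 <= weight x.
Proof. by rewrite -[leLHS]expR0 ler_expR mulr_ge0// ltW. Qed.
Let weight_ge0 x : 0 <= weight x.
Proof. exact: expR_ge0. Qed.
Let weight_le x : Iopen l x -> weight x <= expR (lam * l).
Proof.
rewrite /Iopen/= in_itv/= -ltr_norml => xl.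
by rewrite ler_expR ler_wpM2l// ltW.
Qed.

Let bounded_weight (N : R) : mu.-integrable IR (EFin \o (fun t => N * weight t)).
Proof.
apply: (@integrableS _ _ R mu (Iclosed l) IR).
- exact: measurable_itv.
- exact: mI.
- exact: subset_itv_oo_cc.
- apply: continuous_compact_integrable; first exact: segment_compact.
  apply: continuous_subspaceT => t; apply: cvgMr.
  apply: (@continuous_comp _ _ _ (fun t => lam * `|t|) expR); last exact: continuous_expR.
  by apply: cvgMr; exact: norm_continuous.
Qed.

Lemma cintegrable_Vop v : cintegrable mu IR v -> cintegrable mu IR (Vop v).
Proof.
move=> vi.
apply: (@cintegrableM_bounded _ _ _ mu IR (fun x => (a x)%:C%C) (G v) A).
- exact: mI.
- exact: cmeasurable_real.
- by move=> x Ix; rewrite cmodulus_real aA.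
- exact: (cintegrable_Gop mg gM).
Qed.

Lemma VopB v w x : cintegrable mu IR v -> cintegrable mu IR w ->
  Vop (fun t => v t - w t) x = Vop v x - Vop w x.
Proof.
move=> vi wi; rewrite /Vop -mulrBr; congr (_ * _); rewrite /Gop.
rewrite -(cintegralB mI (cintegrable_kap mg gM x vi) (cintegrable_kap mg gM x wi)).
by congr cintegral; apply/funext => t; rewrite mulrBr.
Qed.

Lemma Re_Vop v x : Re (Vop v x) = a x * Re (G v x).
Proof. by rewrite /Vop Re_mul [Im _%:C%C]/= mul0r subr0. Qed.

Lemma Im_Vop v x : Im (Vop v x) = a x * Im (G v x).
Proof. by rewrite /Vop Im_mul [Im _%:C%C]/= mul0r addr0. Qed.

Lemma ae_eq_Vop v w x : cintegrable mu IR v -> cintegrable mu IR w ->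
  ae_eq mu IR v w -> Vop v x = Vop w x.
Proof.
move=> vi wi vw; congr (_ * _); apply: ae_eq_cintegral; first exact: mI.
- exact: cintegrable_cmeasurable (cintegrable_kap mg gM x vi).
- exact: cintegrable_cmeasurable (cintegrable_kap mg gM x wi).
- by apply: ae_imply vw => t /[apply] ->.
Qed.

(** Used to start the iteration: for [v] merely integrable, [Vop v] is already bounded, and the
    weighted estimates apply from then on. *)
Lemma cmodulus_Vop_le_norm1 v x : cintegrable mu IR v -> Iopen l x ->
  cmodulus (Vop v x) <= C * \int[mu]_(t in IR) cmodulus (v t).
Proof.
move=> vi Ix; rewrite /Vop cmodulusM cmodulus_real.
have I0 : 0 <= \int[mu]_(t in IR) cmodulus (v t).
  by apply: Rintegral_ge0 => t _; exact: cmodulus_ge0.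
have iv := cintegrable_norm mI vi.
have H : cmodulus (G v x) <= 2 * (M * \int[mu]_(t in IR) cmodulus (v t)).
  rewrite -(RintegralZl M mI iv); apply: cmodulus_cintegral_le; first exact: mI.
  - exact: cintegrable_cmeasurable (cintegrable_kap mg gM x vi).
  - move=> t _; rewrite cmodulusM ler_wpM2r ?cmodulus_ge0//.
    exact: cmodulus_kap_le gM _.
  - exact: (integrableZl mI M iv).
apply: (@le_trans _ _ (`|A| * (2 * (M * \int[mu]_(t in IR) cmodulus (v t))))).
  apply: ler_pM => //; first exact: cmodulus_ge0.
  by rewrite (le_trans (aA Ix))// ler_norm.
move: (\int[mu]_(t in IR) cmodulus (v t)) I0 => I I0.
have -> : C * I = `|A| * (2 * (M * I)) + I by rewrite /C; ring.
by rewrite lerDl.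
Qed.

(** The Volterra structure enters here: the integral defining [G v x] only sees [|t| <= |x|], where
    integrating the exponential weight gains a factor [1 / lam]. *)
Lemma cmodulus_Vop_le_weight v x (N : R) : 0 <= N -> cintegrable mu IR v -> Iopen l x ->
  (forall t, Iopen l t -> cmodulus (v t) <= N * weight t) ->
  cmodulus (Vop v x) <= (N / 2) * weight x.
Proof.
move=> N0 vi Ix vN; rewrite /Vop cmodulusM cmodulus_real.
(* At [x = 0] the integral runs over a single point; it is treated apart because
   [Rintegral_exp_weight] needs [0 < r]. *)
have [x0|x0] := eqVneq x 0.
  have -> : G v x = 0.
    rewrite /Gop -(cintegral0 IR).
    apply: ae_eq_cintegral; first exact: mI.
    - exact: cintegrable_cmeasurable (cintegrable_kap mg gM x vi).
    - exact: cmeasurable_cst.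
    - have := @ae_neq R 0; apply: ae_imply => t t0 _.
      by rewrite /kap /orient/= x0 normr0 normr_le0 (negbTE t0) !mul0r.
  by rewrite cmodulus0 mulr0 !mulr_ge0// expR_ge0.
have r0 : 0 < `|x| by rewrite normr_gt0.
have sub : `[- `|x|, `|x|] `<=` IR.
  move: Ix; rewrite /Iopen/= in_itv/= -ltr_norml => xl.
  by apply: subset_itv_Iopen => //; rewrite ltrN2.
have mJ : measurable ([set` `[- `|x|, `|x|]] : set MR) by exact: measurable_itv.
pose h (t : R) := (if `|t| <= `|x| then 1 else 0) * (M * (N * weight t)).
have ih : mu.-integrable IR (EFin \o h).
  apply: (le_integrable mI _ _ (integrableZl mI M (bounded_weight N))).
    apply/measurable_EFinP; apply: measurable_funM.
      apply: (@measurable_funS _ _ MR _ setT) => //; apply: measurable_fun_ifT => //.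
      apply: measurable_fun_ler; last exact: measurable_cst.
      by apply: continuous_measurable_fun; exact: norm_continuous.
    by apply/measurable_EFinP; exact: (measurable_int mu (integrableZl mI M (bounded_weight N))).
  move=> t _; rewrite lee_fin /h; case: ifP => _; first by rewrite mul1r.
  by rewrite mul0r normr0.
have H : cmodulus (G v x) <= 2 * (M * N * (2 * weight x / lam)).
  apply: (@le_trans _ _ (2 * \int[mu]_(t in IR) h t)).
    apply: cmodulus_cintegral_le; first exact: mI.
    - exact: cintegrable_cmeasurable (cintegrable_kap mg gM x vi).
    - move=> t It; rewrite cmodulusM /kap cmodulusM cmodulus_real /h -mulrA.
      apply: ler_pM => //; first by rewrite mulr_ge0 ?cmodulus_ge0.
        by rewrite /orient/=; do 2?case: ifP; rewrite ?normrN ?normr1 ?normr0.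
      by apply: ler_pM; rewrite ?cmodulus_ge0// vN.
    - exact: ih.
  rewrite ler_pM2l// (@Rintegral_sub _ _ _ _ sub); last first.
    move=> t _; rewrite /h /= in_itv/= -ler_norml => /negP/negbTE ->.
    by rewrite mul0r.
  rewrite (_ : \int[mu]_(t in _) _ = \int[mu]_(t in `[- `|x|, `|x|]) (M * N * weight t)).
    rewrite RintegralZl//.
      by apply: ler_wpM2l; [rewrite mulr_ge0|exact: Rintegral_exp_weight].
    have := bounded_weight 1; move/(integrableS mI mJ sub); congr (_.-integrable _ _).
    by apply/funext => t /=; rewrite mul1r.
  apply: eq_Rintegral => t /set_mem; rewrite /h /= in_itv/= -ler_norml => ->.
  by rewrite mul1r mulrA.
apply: (@le_trans _ _ (`|A| * (2 * (M * N * (2 * weight x / lam))))).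
  apply: ler_pM => //; first exact: cmodulus_ge0.
  by rewrite (le_trans (aA Ix))// ler_norm.
(* One factor 2 comes from the complex integral and one from the two halves of [[- |x|, |x|]];
   [lam = 4 C] absorbs both and leaves the ratio [1/2]. The summand 1 in [C] allows the division
   when [A] or [M] is 0. *)
have -> : `|A| * (2 * (M * N * (2 * weight x / lam))) =
    (2 * `|A| * M / C) * (N / 2 * weight x).
  by rewrite /lam; field; rewrite gt_eqF.
rewrite ler_piMl ?mulr_ge0 ?divr_ge0 ?expR_ge0//.
by rewrite ler_pdivrMr// mul1r /C lerDl.
Qed.

Section solve.
Variable w : R -> R[i].
Hypothesis wi : cintegrable mu IR w.

Let v0 x := (a x)%:C%C * w x.
Let N0 := C * \int[mu]_(t in IR) cmodulus (v0 t).

Let v0i : cintegrable mu IR v0.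
Proof.
apply: (@cintegrableM_bounded _ _ _ mu IR (fun x => (a x)%:C%C) w A).
- exact: mI.
- exact: cmeasurable_real.
- by move=> x Ix; rewrite cmodulus_real aA.
- exact: wi.
Qed.

Let N0_ge0 : 0 <= N0.
Proof. by rewrite mulr_ge0 ?(ltW C_gt0)// Rintegral_ge0// => t _; exact: cmodulus_ge0. Qed.

Fixpoint picard (n : nat) : R -> R[i] :=
  if n is n'.+1 then fun x => v0 x + Vop (picard n') x else v0.

Let si n : cintegrable mu IR (picard n).
Proof. by elim: n => [//|n IHn]; apply: cintegrableD; [exact: mI|exact: v0i|exact: cintegrable_Vop]. Qed.

(** The first increment is [Vop v0], controlled by the [L^1] norm of [v0]; each further one is [Vop]
    of its predecessor and gains a factor [1/2]. *)
Let sdiff n x : Iopen l x ->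
  cmodulus (picard n.+1 x - picard n x) <= N0 * 2^-1 ^+ n * weight x.
Proof.
elim: n x => [|n IHn] x Ix.
  rewrite /= addrC addKr expr0 mulr1 (le_trans (cmodulus_Vop_le_norm1 v0i Ix))//.
  by rewrite ler_peMr.
rewrite [picard n.+2]/= [picard n.+1 in X in _ - X]/= opprD addrACA subrr add0r.
rewrite -VopB//; last exact: (si n.+1).
rewrite exprSr mulrA; apply: cmodulus_Vop_le_weight => //.
- by rewrite mulr_ge0// exprn_ge0// invr_ge0.
- apply: cintegrableB; [exact: mI|exact: (si n.+1)|exact: si].
Qed.

(** The constant 2 reproduces itself: [Vop v0] contributes [N0] and [Vop (picard n - v0)] half of
    [2 * N0]. The difference with [v0] is estimated because [v0] itself may be unbounded. *)
Let sbound n x : Iopen l x -> cmodulus (picard n x - v0 x) <= 2 * N0 * weight x.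
Proof.
elim: n x => [|n IHn] x Ix.
  rewrite subrr cmodulus0; apply: mulr_ge0; last exact: weight_ge0.
  by rewrite mulr_ge0.
rewrite /= addrC addKr.
have -> : Vop (picard n) x = Vop v0 x + Vop (fun t => picard n t - v0 t) x.
  by rewrite VopB// addrC subrK.
have -> : 2 * N0 * weight x = N0 * weight x + N0 * weight x by ring.
rewrite (le_trans (cmodulusD _ _))// lerD//.
  by rewrite (le_trans (cmodulus_Vop_le_norm1 v0i Ix))// ler_peMr.
have -> : N0 * weight x = (2 * N0 / 2) * weight x by field.
apply: cmodulus_Vop_le_weight => //; first by rewrite mulr_ge0.
by apply: cintegrableB; [exact: mI|exact: si|exact: v0i].
Qed.

Let v x : R[i] := (limn (fun n => Re (picard n x)) +i* limn (fun n => Im (picard n x)))%C.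

Let cvgRe x : Iopen l x -> Re (picard n x) @[n --> \oo] --> Re (v x).
Proof.
move=> Ix; apply: (@cvg_of_geometric_increments _ (N0 * weight x)).
  by rewrite mulr_ge0// expR_ge0.
move=> n; rewrite mulrAC; apply: le_trans (sdiff n Ix).
by rewrite -Re_sub normr_Re_le.
Qed.

Let cvgIm x : Iopen l x -> Im (picard n x) @[n --> \oo] --> Im (v x).
Proof.
move=> Ix; apply: (@cvg_of_geometric_increments _ (N0 * weight x)).
  by rewrite mulr_ge0// expR_ge0.
move=> n; rewrite mulrAC; apply: le_trans (sdiff n Ix).
by rewrite -Im_sub normr_Im_le.
Qed.

Let mv : cmeasurable_on IR v.
Proof.
split.
- apply: (measurable_fun_cvg (h := fun n x => Re (picard n x))) => //.
  by move=> n; have [] := cintegrable_cmeasurable (si n).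
- apply: (measurable_fun_cvg (h := fun n x => Im (picard n x))) => //.
  by move=> n; have [] := cintegrable_cmeasurable (si n).
Qed.

(** [sbound] passes to the limit in each component, which doubles its constant. *)
Let vbound x : Iopen l x -> cmodulus (v x - v0 x) <= 4 * N0 * weight x.
Proof.
move=> Ix; rewrite (le_trans (cmodulus_le _))//.
have -> : 4 * N0 * weight x = 2 * N0 * weight x + 2 * N0 * weight x by ring.
rewrite Re_sub Im_sub; apply: lerD.
- have H : Re (picard n x) - Re (v0 x) @[n --> \oo] --> Re (v x) - Re (v0 x).
    by apply: cvgB; [exact: cvgRe|exact: cvg_cst].
  rewrite -(cvg_lim _ (cvg_norm H))//; apply: limr_le.
    by apply/cvg_ex; eexists; exact: (cvg_norm H).
  by apply: nearW => n; rewrite -Re_sub (le_trans (normr_Re_le _))// sbound.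
- have H : Im (picard n x) - Im (v0 x) @[n --> \oo] --> Im (v x) - Im (v0 x).
    by apply: cvgB; [exact: cvgIm|exact: cvg_cst].
  rewrite -(cvg_lim _ (cvg_norm H))//; apply: limr_le.
    by apply/cvg_ex; eexists; exact: (cvg_norm H).
  by apply: nearW => n; rewrite -Im_sub (le_trans (normr_Im_le _))// sbound.
Qed.

Let dom x := cmodulus (v0 x) + 4 * N0 * weight x.

Let domi : mu.-integrable IR (EFin \o dom).
Proof. exact: (integrableD mI (cintegrable_norm mI v0i) (bounded_weight (4 * N0))). Qed.

Let vi : cintegrable mu IR v.
Proof.
apply: (@le_cintegrable _ _ _ mu IR _ dom) => //; first exact: mI.
move=> x Ix; have -> : v x = v0 x + (v x - v0 x) by rewrite addrC subrK.
by rewrite (le_trans (cmodulusD _ _))// lerD2l vbound.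
Qed.

(** The limit passes under the integral in [G] by dominated convergence: [dom] is integrable, bounds
    all iterates, and the kernel is bounded by [M]. *)
Let fixv x : Iopen l x -> v x = v0 x + Vop v x.
Proof.
move=> Ix.
have [H1 H2] : Re (G (picard n) x) @[n --> \oo] --> Re (G v x) /\
    Im (G (picard n) x) @[n --> \oo] --> Im (G v x).
  apply: (@cintegral_dominated_cvg _ _ _ mu IR (fun n t => kap g (x, t) * picard n t)
    _ (fun t => M * dom t)).
  - exact: mI.
  - by move=> n; exact: cintegrable_cmeasurable (cintegrable_kap mg gM x (si n)).
  - exact: cintegrable_cmeasurable (cintegrable_kap mg gM x vi).
  - move=> t It; rewrite Re_mul; under eq_fun do rewrite Re_mul.
    by apply: cvgB; apply: cvgMr; [exact: cvgRe|exact: cvgIm].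
  - move=> t It; rewrite Im_mul; under eq_fun do rewrite Im_mul.
    by apply: cvgD; apply: cvgMr; [exact: cvgIm|exact: cvgRe].
  - exact: (integrableZl mI M domi).
  - move=> n t It; rewrite cmodulusM; apply: ler_pM; rewrite ?cmodulus_ge0//.
      exact: cmodulus_kap_le gM _.
    have -> : picard n t = v0 t + (picard n t - v0 t) by rewrite addrC subrK.
    rewrite (le_trans (cmodulusD _ _))// lerD2l (le_trans (sbound n It))//.
    by rewrite ler_wpM2r ?expR_ge0// ler_wpM2r// ler_nat.
apply: complex_eq.
- have c1 := cvgRe Ix; rewrite -(cvg_shiftS (fun n => Re (picard n x))) in c1.
  have c2 : Re (picard n.+1 x) @[n --> \oo] --> Re (v0 x + Vop v x).
    have E n : Re (picard n.+1 x) = Re (v0 x) + a x * Re (G (picard n) x).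
      by rewrite [picard n.+1]/= Re_add Re_Vop.
    under eq_fun do rewrite E.
    rewrite Re_add Re_Vop.
    apply: cvgD; first exact: cvg_cst.
    by apply: cvgMr; exact: H1.
  by rewrite -(cvg_lim _ c1)// (cvg_lim _ c2).
- have c1 := cvgIm Ix; rewrite -(cvg_shiftS (fun n => Im (picard n x))) in c1.
  have c2 : Im (picard n.+1 x) @[n --> \oo] --> Im (v0 x + Vop v x).
    have E n : Im (picard n.+1 x) = Im (v0 x) + a x * Im (G (picard n) x).
      by rewrite [picard n.+1]/= Im_add Im_Vop.
    under eq_fun do rewrite E.
    rewrite Im_add Im_Vop.
    apply: cvgD; first exact: cvg_cst.
    by apply: cvgMr; exact: H2.
  by rewrite -(cvg_lim _ c1)// (cvg_lim _ c2).
Qed.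

(** The last estimate is what later gives boundedness in every [L^p]: up to the multiple [a w] of
    the datum, the solution is bounded by the [L^1] norm of the datum. *)
Lemma volterra_solution : exists v, [/\ cintegrable mu IR v,
  forall x, Iopen l x -> v x = (a x)%:C%C * w x + Vop v x &
  forall x, Iopen l x -> cmodulus (v x - (a x)%:C%C * w x) <=
    4 * C * `|A| * expR (lam * l) * \int[mu]_(t in IR) cmodulus (w t)].
Proof.
exists v; split => // x Ix; apply: (le_trans (vbound Ix)).
apply: (@le_trans _ _ (4 * N0 * expR (lam * l))).
  by rewrite ler_wpM2l ?weight_le// mulr_ge0.
have iw := cintegrable_norm mI wi.
suff H : \int[mu]_(t in IR) cmodulus (v0 t) <= `|A| * \int[mu]_(t in IR) cmodulus (w t).
  rewrite /N0; have E0 := expR_ge0 (lam * l).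
  move: (expR _) E0 => E E0; have -> : 4 * (C * \int[mu]_(t in IR) cmodulus (v0 t)) * E =
    4 * C * E * \int[mu]_(t in IR) cmodulus (v0 t) by ring.
  have -> : 4 * C * `|A| * E * \int[mu]_(t in IR) cmodulus (w t) =
    4 * C * E * (`|A| * \int[mu]_(t in IR) cmodulus (w t)) by ring.
  by rewrite ler_wpM2l// !mulr_ge0// ltW.
rewrite -(RintegralZl `|A| mI iw); apply: le_Rintegral; first exact: mI.
- exact: cintegrable_norm mI v0i.
- exact: (integrableZl mI _ iw).
- move=> t It; rewrite /v0 cmodulusM cmodulus_real ler_wpM2r ?cmodulus_ge0//.
  by rewrite (le_trans (aA It))// ler_norm.
Qed.

End solve.

(** [Vop v] ignores null sets, so it is a fixed point of [Vop] at every point; it is bounded, and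
    iterating the contraction makes its weighted norm 0. *)
Lemma volterra_unique v : cintegrable mu IR v -> ae_eq mu IR v (Vop v) ->
  {ae mu, forall x, Iopen l x -> v x = 0}.
Proof.
move=> vi vV; have Vi := cintegrable_Vop vi.
set N := C * \int[mu]_(t in IR) cmodulus (v t).
have N0 : 0 <= N.
  by rewrite mulr_ge0 ?(ltW C_gt0)// Rintegral_ge0// => t _; exact: cmodulus_ge0.
have fixV x : Vop v x = Vop (Vop v) x by exact: ae_eq_Vop.
have H n x : Iopen l x -> cmodulus (Vop v x) <= N * 2^-1 ^+ n * weight x.
  elim: n x => [|n IHn] x Ix.
    by rewrite expr0 mulr1 (le_trans (cmodulus_Vop_le_norm1 vi Ix))// ler_peMr.
  rewrite fixV exprSr mulrA; apply: cmodulus_Vop_le_weight => //.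
  by rewrite mulr_ge0// exprn_ge0// invr_ge0.
apply: ae_imply vV => x vVx Ix; rewrite vVx//.
apply: cmodulus_eq0; apply/eqP; rewrite eq_le cmodulus_ge0 andbT.
have cv : N * 2^-1 ^+ n * weight x @[n --> \oo] --> (0 : R).
  rewrite -(mul0r (weight x)); apply: cvgMl; rewrite -(mulr0 N); apply: cvgMr.
  apply: cvg_expr; rewrite ger0_norm ?invr_ge0//.
  by rewrite invf_lt1// ltr1n.
by rewrite -(cvg_lim _ cv)//; apply: limr_ge; [apply/cvg_ex; exists 0|apply: nearW => n; exact: H].
Qed.

End volterra.

(** * Operators on Sobolev spaces *)

Section Lp_estimates.
Context {R : realType} (l : R) (p : R).
Hypothesis p1 : 1 <= p.
Local Notation mu := (@lebesgue_measure R).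
Local Notation MR := (measurableTypeR R).
Local Notation IR := (Iopen l : set MR).
Local Notation mI := (measurable_IR l).

Let p_gt0 : 0 < p. Proof. exact: lt_le_trans p1. Qed.

Lemma le_Lnorm_ae (f g : MR -> R) : measurable_fun setT f -> measurable_fun setT g ->
  {ae mu, forall x, `|f x| <= `|g x|} ->
  ('N[mu]_p%:E[EFin \o f] <= 'N[mu]_p%:E[EFin \o g])%E.
Proof.
move=> mf mg fg; rewrite unlock /Lnorm.
have m (h : MR -> R) : measurable_fun setT h ->
    measurable_fun setT (fun x => (`|(EFin \o h) x| `^ p)%E).
  move=> mh; apply/measurable_EFinP.
  apply: (@measurableT_comp _ _ _ _ _ _ (@powR R ^~ p)) => //.
  exact: measurableT_comp.
apply: gt0_ler_poweR.
- by rewrite invr_ge0 ltW.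
- by rewrite in_itv/= leey andbT; apply: integral_ge0 => x _; rewrite lee_fin powR_ge0.
- by rewrite in_itv/= leey andbT; apply: integral_ge0 => x _; rewrite lee_fin powR_ge0.
- apply: ae_ge0_le_integral.
  + by [].
  + by move=> x _; rewrite lee_fin powR_ge0.
  + exact: m.
  + by move=> x _; rewrite lee_fin powR_ge0.
  + exact: m.
  + apply: ae_imply fg => x fgx _; rewrite /= lee_fin.
    by apply: ge0_ler_powR; rewrite ?nnegrE// ltW.
Qed.

Lemma Lnorm_scale (f : MR -> R) (B : R) : measurable_fun setT f -> 0 <= B ->
  ('N[mu]_p%:E[EFin \o (fun x => B * f x)%R])%E = (B%:E * 'N[mu]_p%:E[EFin \o f])%E.
Proof.
move=> mf B0; rewrite unlock /Lnorm.
have m : measurable_fun setT (fun x => (`|(EFin \o f) x| `^ p)%E).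
  apply/measurable_EFinP.
  apply: (@measurableT_comp _ _ _ _ _ _ (@powR R ^~ p)) => //.
  exact: measurableT_comp.
rewrite (_ : (fun x => _) = (fun x => ((B `^ p)%:E * (`|(EFin \o f) x| `^ p))%E)); last first.
  by apply/funext => x; rewrite /= normrM powRM// (ger0_norm B0) EFinM.
have f0 x : [set: MR] x -> (0 <= `|(EFin \o f) x| `^ p)%E.
  by move=> _; rewrite lee_fin powR_ge0.
rewrite (ge0_integralZl_EFin _ measurableT f0 m (powR_ge0 _ _)).
rewrite poweRM ?lee_fin ?powR_ge0//; last first.
  by apply: integral_ge0 => x _; rewrite lee_fin powR_ge0.
by rewrite poweR_EFin -powRrM mulfV ?gt_eqF// powRr1.
Qed.

Lemma Lnorm_indic_lty (r : R) : 0 < r ->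
  ('N[mu]_r%:E[EFin \o (\1_IR : MR -> R)] < +oo)%E.
Proof.
move=> r0; rewrite unlock /Lnorm; apply: poweR_lty.
rewrite (_ : (fun x => _) = EFin \o (\1_IR : MR -> R)); last first.
  apply/funext => x; rewrite /= indicE; case: (x \in _).
    by rewrite normr1 powR1.
  by rewrite normr0 powR0// gt_eqF.
rewrite (@integral_indic _ _ _ mu setT measurableT _ mI) setIT.
exact: mu_IR_lty.
Qed.

Let U (u : R -> R[i]) : MR -> R := (fun x => cmodulus (u x)) \_ IR.

Let mU u : cmeasurable_on IR u -> measurable_fun setT (U u).
Proof. by move=> mu_; exact: (measurable_restrictT _ mI).1 (measurable_cmodulus mu_). Qed.

Let U_ge0 u x : 0 <= U u x.
Proof. by rewrite /U patchE; case: ifP => // _; exact: cmodulus_ge0. Qed.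

Lemma Lp_normE u : Lp_norm mu IR p%:E u = ('N[mu]_p%:E[EFin \o U u])%E.
Proof. by rewrite /Lp_norm restrict_EFin. Qed.

Definition Lp_norm_cst1 : R := fine ('N[mu]_p%:E[EFin \o (\1_IR : MR -> R)])%E.

Lemma Lp_norm_cst1_ge0 : 0 <= Lp_norm_cst1.
Proof. by apply: fine_ge0; exact: Lnorm_ge0. Qed.

(** Minkowski's inequality; the constant [c] has finite [L^p] norm as the interval is bounded. *)
Lemma Lp_norm_le (u f : R -> R[i]) (B c : R) : cmeasurable_on IR u ->
  cmeasurable_on IR f -> 0 <= B -> 0 <= c ->
  {ae mu, forall x, Iopen l x -> cmodulus (f x) <= B * cmodulus (u x) + c} ->
  (Lp_norm mu IR p%:E f <= B%:E * Lp_norm mu IR p%:E u + (c * Lp_norm_cst1)%:E)%E.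
Proof.
move=> mu_ mf B0 c0 H; rewrite !Lp_normE.
have m1 : measurable_fun [set: MR] (\1_IR : MR -> R) by apply: measurable_indic; exact: mI.
have mB : measurable_fun [set: MR] (fun x => B * U u x).
  by apply: measurable_funM; [exact: measurable_cst|exact: mU].
have mc : measurable_fun [set: MR] (fun x => c * \1_IR x).
  by apply: measurable_funM; [exact: measurable_cst|].
have -> : (B%:E * 'N[mu]_p%:E[EFin \o U u])%E = ('N[mu]_p%:E[EFin \o (fun x => B * U u x)%R])%E.
  by rewrite Lnorm_scale//; exact: mU.
have -> : (c * Lp_norm_cst1)%:E = ('N[mu]_p%:E[EFin \o (fun x => c * \1_IR x)%R])%E.
  rewrite Lnorm_scale// EFinM fineK// ge0_fin_numE ?Lnorm_ge0//.
  exact: Lnorm_indic_lty.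
apply: le_trans (minkowski_EFin mu mB mc p1).
apply: le_Lnorm_ae; [exact: mU|exact: measurable_funD|].
apply: ae_imply H => x Hx; rewrite [leLHS]ger0_norm// [leRHS]ger0_norm; last first.
  by rewrite addr_ge0// mulr_ge0.
rewrite /= /U !patchE indicE; case: ifPn => [/set_mem Ix|_].
  by rewrite mulr1 Hx.
by rewrite !mulr0 addr0.
Qed.

(** Hölder's inequality against the indicator of the interval. *)
Lemma in_Lp_cintegrable : exists C1 : R, 0 <= C1 /\ forall u, in_Lp mu IR p%:E u ->
  cintegrable mu IR u /\
  ((\int[mu]_(x in IR) cmodulus (u x))%:E <= C1%:E * Lp_norm mu IR p%:E u)%E.
Proof.
suff [C1 [C10 HC]] : exists C1 : R, 0 <= C1 /\ forall u, cmeasurable_on IR u ->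
    (\int[mu]_x (U u x)%:E <= C1%:E * Lp_norm mu IR p%:E u)%E.
  exists C1; split => // u [mu_ fin]; have := HC _ mu_ => H.
  have Hfin : (\int[mu]_x (U u x)%:E < +oo)%E.
    apply: le_lt_trans H _; have := Lnorm_ge0 mu p%:E ((fun x => (cmodulus (u x))%:E) \_ IR).
    by move: fin; rewrite /Lp_norm; case: (Lnorm _ _ _) => //= r _ _; rewrite -EFinM ltry.
  have iU : mu.-integrable setT (EFin \o U u).
    apply/integrableP; split; first by apply/measurable_EFinP; exact: mU.
    rewrite (eq_integral (fun x => (U u x)%:E))// => x _ /=.
    by rewrite ger0_norm.
  split.
    apply: (@le_cintegrable _ _ _ mu IR _ (fun x => cmodulus (u x))) => //; first exact: mI.
    by apply/integrable_mkcond; [exact: mI|rewrite restrict_EFin].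
  rewrite Rintegral_mkcond -/(U u) /Rintegral fineK//.
  by rewrite ge0_fin_numE// integral_ge0// => x _; rewrite lee_fin.
have NU u : ('N[mu]_1[EFin \o U u])%E = (\int[mu]_x (U u x)%:E)%E.
  by rewrite Lnorm1; apply: eq_integral => x _; rewrite /= ger0_norm.
(* For [p = 1] the conjugate exponent would be infinite, but the two norms coincide. *)
have [p1'|p1'] := eqVneq p 1.
  exists 1; split => // u mu_; rewrite mul1e -NU Lp_normE p1'.
  by [].
have p1s : 1 < p by rewrite lt_neqAle eq_sym p1'.
pose q := p / (p - 1).
have q0 : 0 < q by rewrite divr_gt0// subr_gt0.
have pq : p^-1 + q^-1 = 1.
  by rewrite /q invf_div; field; rewrite gt_eqF.
exists (fine ('N[mu]_q%:E[EFin \o (\1_IR : MR -> R)])%E); split.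
  by apply: fine_ge0; exact: Lnorm_ge0.
move=> u mu_; rewrite -NU fineK; last first.
  by rewrite ge0_fin_numE ?Lnorm_ge0//; exact: Lnorm_indic_lty.
rewrite Lp_normE muleC.
have m1 : measurable_fun [set: MR] (\1_IR : MR -> R) by apply: measurable_indic; exact: mI.
have := hoelder mu (mU mu_) m1 p_gt0 q0 pq; apply: le_trans.
rewrite le_eqVlt; apply/orP; left; apply/eqP; apply: eq_Lnorm => x /=.
congr (_%:E); rewrite /U !patchE indicE; case: ifP => _; rewrite ?mulr1 ?mul0r//.
Qed.

End Lp_estimates.

(** * Operators determined by their action on derivatives *)

Section primitive_operators.
Context {R : realType} (l : R) (p : R).
Hypothesis p1 : 1 <= p.
Local Notation mu := (@lebesgue_measure R).
Local Notation MR := (measurableTypeR R).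
Local Notation IR := (Iopen l : set MR).
Local Notation mI := (measurable_IR l).
Local Notation cint := (cintegrable mu IR).
Local Notation wd := (weak_deriv l).

(** [in_W1] provides some weak derivative in [L^p]; the chosen representative [weak_deriv] agrees
    with it almost everywhere and inherits its integrability. *)
Lemma in_W1_weak_deriv u : in_W1 l p%:E u ->
  [/\ in_Lp mu IR p%:E u, cint u, is_weak_deriv l u (wd u),
      in_Lp mu IR p%:E (wd u) & cint (wd u)].
Proof.
move=> [uL [v vL uv]]; have [C1 [_ H]] := in_Lp_cintegrable l p1.
have [ui _] := H _ uL; have uw := weak_derivP uv; have := weak_deriv_eq uv => E.
have wL : in_Lp mu IR p%:E (wd u).
  have mw : cmeasurable_on IR (wd u) by case: uw => _ [[m1 _ _] [m2 _ _]] _.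
  have [mv vfin] := vL; split => //.
  apply: le_lt_trans (Lp_norm_le p1 (B := 1) (c := 0) mv mw _ _ _) _ => //.
    by apply: ae_imply E => x /[apply] ->; rewrite mul1r addr0.
  by rewrite mul1e mul0r adde0.
by split => //; have [] := H _ wL.
Qed.

Lemma W1_intro u v : in_Lp mu IR p%:E u -> in_Lp mu IR p%:E v -> is_weak_deriv l u v ->
  in_W1 l p%:E u.
Proof. by move=> uL vL uv; split => //; exists v. Qed.

Lemma in_Lp_le (B c : R) u f : 0 <= B -> 0 <= c -> in_Lp mu IR p%:E u ->
  cmeasurable_on IR f ->
  {ae mu, forall x, Iopen l x -> cmodulus (f x) <= B * cmodulus (u x) + c} ->
  in_Lp mu IR p%:E f.
Proof.
move=> B0 c0 [mu_ ufin] mf H; split => //.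
apply: le_lt_trans (Lp_norm_le p1 mu_ mf B0 c0 H) _.
have := Lnorm_ge0 mu p%:E ((fun x => (cmodulus (u x))%:E) \_ IR).
by move: ufin; rewrite /Lp_norm; case: (Lnorm _ _ _) => //= r _ _; rewrite -EFinM -EFinD ltry.
Qed.

Lemma in_LpD (c : R[i]) u v : in_Lp mu IR p%:E u -> in_Lp mu IR p%:E v ->
  in_Lp mu IR p%:E (fun x => c * u x + v x).
Proof.
move=> uL vL; have [mu_ _] := uL; have [mv _] := vL.
have mcu : cmeasurable_on IR (fun x => c * u x).
  by apply: cmeasurableM => //; exact: cmeasurable_cst.
have ms : cmeasurable_on IR (fun x => c * u x + v x) by exact: cmeasurableD.
split=> //.
pose w x : R[i] := (cmodulus (u x) + cmodulus (v x))%:C%C.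
have mU := measurable_cmodulus mu_; have mV := measurable_cmodulus mv.
have mw : cmeasurable_on IR w by apply: cmeasurable_real; exact: measurable_funD.
have wfin : (Lp_norm mu IR p%:E w < +oo)%E.
  rewrite Lp_normE.
  have mPU : measurable_fun [set: MR] ((fun x => cmodulus (u x)) \_ IR).
    exact: (measurable_restrictT _ mI).1.
  have mPV : measurable_fun [set: MR] ((fun x => cmodulus (v x)) \_ IR).
    exact: (measurable_restrictT _ mI).1.
  have E x : ((fun x => cmodulus (w x)) \_ IR) x =
      ((fun x => cmodulus (u x)) \_ IR) x + ((fun x => cmodulus (v x)) \_ IR) x.
    rewrite !patchE; case: ifP => _; last by rewrite addr0.
    by rewrite /w cmodulus_real ger0_norm// addr_ge0// cmodulus_ge0.
  rewrite (_ : EFin \o _ = EFin \o (((fun x => cmodulus (u x)) \_ IR) \+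
      ((fun x => cmodulus (v x)) \_ IR))%R); last first.
    by apply/funext => x; exact: (congr1 EFin (E x)).
  apply: le_lt_trans (minkowski_EFin mu mPU mPV p1) _.
  have [_ f1] := uL; have [_ f2] := vL.
  by rewrite -!restrict_EFin; exact: lte_add_pinfty.
have wL : in_Lp mu IR p%:E w by split.
have c0 : 0 <= cmodulus c + 1 by rewrite addr_ge0// cmodulus_ge0.
suff : in_Lp mu IR p%:E (fun x => c * u x + v x) by case.
apply: (@in_Lp_le (cmodulus c + 1) 0 w) => //.
apply: aeW => x _; rewrite addr0 /w cmodulus_real.
have U0 := cmodulus_ge0 (u x); have V0 := cmodulus_ge0 (v x); have C0 := cmodulus_ge0 c.
rewrite (le_trans (cmodulusD _ _))// cmodulusM ger0_norm ?addr_ge0//.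
move: (cmodulus c) (cmodulus (u x)) (cmodulus (v x)) U0 V0 C0 => C U V U0 V0 C0.
have := mulr_ge0 C0 V0; lra.
Qed.

Lemma in_W1D (c : R[i]) u v : in_W1 l p%:E u -> in_W1 l p%:E v ->
  in_W1 l p%:E (fun x => c * u x + v x) /\
  ae_eq mu IR (wd (fun x => c * u x + v x)) (fun x => c * wd u x + wd v x).
Proof.
move=> /in_W1_weak_deriv[uL ui uw uwL uwi] /in_W1_weak_deriv[vL vi vw vwL vwi].
have H : is_weak_deriv l (fun x => c * u x + v x) (fun x => c * wd u x + wd v x).
  exact: (is_weak_derivD (cintegrableZ c mI ui) (cintegrableZ c mI uwi) vi vwi
    (is_weak_derivZ c ui uwi uw) vw).
split; last exact: weak_deriv_eq H.
exact: W1_intro (in_LpD c uL vL) (in_LpD c uwL vwL) H.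
Qed.

Lemma weak_deriv_ae u v : in_W1 l p%:E u -> in_W1 l p%:E v -> ae_eq mu IR u v ->
  ae_eq mu IR (wd u) (wd v).
Proof.
move=> /in_W1_weak_deriv[uL ui uw uwL uwi] /in_W1_weak_deriv[vL vi vw vwL vwi] uv.
apply: (weak_deriv_unique _ vw); apply: (is_weak_deriv_ae vi uwi uv _ uw).
exact: aeW.
Qed.

(** An operator [u |-> u + prim (H u' - u')] keeps the value at [0] and acts on
    derivatives as [H]: inverting it amounts to inverting [H], a rule which needs
    only be controlled in [L^1] up to a pointwise multiple of its argument. *)
Definition derivative_rule (H : (R -> R[i]) -> R -> R[i]) :=
  [/\ forall v, cint v -> cint (H v),
      exists B c : R, [/\ 0 <= B, 0 <= c & forall v x, cint v -> Iopen l x ->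
        cmodulus (H v x) <= B * cmodulus (v x) + c * \int[mu]_(t in IR) cmodulus (v t)],
      forall (c : R[i]) v w, cint v -> cint w ->
        ae_eq mu IR (H (fun x => c * v x + w x)) (fun x => c * H v x + H w x) &
      forall v w, cint v -> cint w -> ae_eq mu IR v w -> ae_eq mu IR (H v) (H w)].

Definition has_derivative_rule (T : (R -> R[i]) -> R -> R[i]) H :=
  forall u x, in_W1 l p%:E u -> Iopen l x ->
    T u x = u x + prim l (fun t => H (wd u) t - wd u t) x.

Lemma in_W1_derivative_rule T H u : derivative_rule H -> has_derivative_rule T H ->
  in_W1 l p%:E u -> is_weak_deriv l (T u) (H (wd u)).
Proof.
move=> [Hi _ _ _] TH uW; have [uL ui uw uwL uwi] := in_W1_weak_deriv uW.
have di : cint (fun t => H (wd u) t - wd u t) := cintegrableB mI (Hi _ uwi) uwi.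
have Pi := cintegrable_prim di.
have D := is_weak_derivD ui uwi Pi di uw (is_weak_deriv_prim di).
have Ti : cint (fun x => u x + prim l (fun t => H (wd u) t - wd u t) x) :=
  cintegrableD mI ui Pi.
apply: is_weak_deriv_ae D; last 2 first.
- by apply: aeW => x Ix; rewrite TH.
- by apply: aeW => x Ix; rewrite addrC subrK.
- have [T1 T2] := Ti; split; [move: T1|move: T2]; apply: eq_integrable => //;
    try exact: mI; by move=> x /set_mem Ix; rewrite /= TH.
- exact: Hi.
Qed.

Lemma W1_bounded_derivative_rule T H : derivative_rule H -> has_derivative_rule T H ->
  W1_bounded l p%:E T.
Proof.
move=> rH TH; have [Hi [B [c [B0 c0 HB]]] Hlin Hae] := rH.
have [C1 [C10 HC1]] := in_Lp_cintegrable l p1.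
pose m := fine (mu IR).
have m0 : 0 <= m by apply: fine_ge0; exact: measure_ge0.
(* The correction is at most twice the integral of [|H u' - u'|], and the integrand is at most
   [(B + 1) |u'|] plus [c] times the [L^1] norm of [u']; integrating the constant gives the factor
   [m]. *)
pose k := 2 * (B + 1 + c * m).
have k0 : 0 <= k by rewrite mulr_ge0// !addr_ge0// mulr_ge0.
have bound u x : in_W1 l p%:E u -> Iopen l x ->
    cmodulus (T u x) <= 1 * cmodulus (u x) + k * \int[mu]_(t in IR) cmodulus (wd u t).
  move=> uW Ix; have [uL ui uw uwL uwi] := in_W1_weak_deriv uW.
  have di : cint (fun t => H (wd u) t - wd u t) := cintegrableB mI (Hi _ uwi) uwi.
  rewrite (TH _ _ uW Ix) (le_trans (cmodulusD _ _))// mul1r lerD2l.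
  rewrite (le_trans (cmodulus_prim_le _ di))// /k -mulrA ler_pM2l//.
  set I := \int[mu]_(t in IR) cmodulus (wd u t).
  have iw := cintegrable_norm mI uwi.
  have i1 : mu.-integrable IR (EFin \o (fun t => (B + 1) * cmodulus (wd u t))).
    exact: (integrableZl mI _ iw).
  have i2 : mu.-integrable IR (EFin \o (fun t : MR => c * I)).
    by apply: (@bounded_integrable_itv _ _ `|c * I| `]- l, l[) => //; exact: mu_IR_lty.
  apply: (@le_trans _ _ (\int[mu]_(t in IR) ((B + 1) * cmodulus (wd u t) + c * I))).
    apply: le_Rintegral; first exact: mI.
    - exact: cintegrable_norm mI di.
    - exact: (integrableD mI i1 i2).
    - move=> t It; rewrite (le_trans (cmodulusB _ _))//.
      by rewrite mulrDl mul1r addrAC lerD2r HB.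
  rewrite (RintegralD mI i1 i2) (RintegralZl _ mI iw) Rintegral_cst//; last exact: mI.
  rewrite -/I -/m le_eqVlt; apply/orP; left; apply/eqP; ring.
have TW u : in_W1 l p%:E u -> in_W1 l p%:E (T u).
  move=> uW; have [uL ui uw uwL uwi] := in_W1_weak_deriv uW.
  have TD := in_W1_derivative_rule rH TH uW.
  have I0 : 0 <= \int[mu]_(t in IR) cmodulus (wd u t).
    by apply: Rintegral_ge0 => t _; exact: cmodulus_ge0.
  apply: (W1_intro _ _ TD).
    apply: (@in_Lp_le 1 (k * \int[mu]_(t in IR) cmodulus (wd u t)) u) => //.
    + by rewrite mulr_ge0.
    + by case: TD => [[[m1 _ _] [m2 _ _]] _ _].
    + by apply: aeW => x Ix; exact: bound.
  apply: (@in_Lp_le B (c * \int[mu]_(t in IR) cmodulus (wd u t)) (wd u)) => //.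
  + by rewrite mulr_ge0.
  + by case: TD => [_ [[m1 _ _] [m2 _ _]] _].
  + by apply: aeW => x Ix; exact: HB.
split => //.
- move=> u v uW vW uv; have [uL ui uw uwL uwi] := in_W1_weak_deriv uW.
  have [vL vi vw vwL vwi] := in_W1_weak_deriv vW.
  have E := weak_deriv_ae uW vW uv.
  apply: ae_imply uv => x uvx Ix; rewrite (TH _ _ uW Ix) (TH _ _ vW Ix) (uvx Ix).
  suff -> : prim l (fun t => H (wd u) t - wd u t) x =
    prim l (fun t => H (wd v) t - wd v t) x by [].
  apply: ae_eq_prim.
  + exact: (cintegrableB mI (Hi _ uwi) uwi).
  + exact: (cintegrableB mI (Hi _ vwi) vwi).
  + by apply: ae_imply2 (Hae _ _ uwi vwi E) E => t h1 h2 It; rewrite h1// h2.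
- move=> d u v uW vW; have [sW sE] := in_W1D d uW vW.
  have [uL ui uw uwL uwi] := in_W1_weak_deriv uW.
  have [vL vi vw vwL vwi] := in_W1_weak_deriv vW.
  have [sL si sw swL swi] := in_W1_weak_deriv sW.
  apply: aeW => x Ix; rewrite (TH _ _ sW Ix) (TH _ _ uW Ix) (TH _ _ vW Ix).
  have i1 : cint (fun t => H (wd u) t - wd u t) := cintegrableB mI (Hi _ uwi) uwi.
  have i2 : cint (fun t => H (wd v) t - wd v t) := cintegrableB mI (Hi _ vwi) vwi.
  have i3 : cint (fun t => d * (H (wd u) t - wd u t)) := cintegrableZ d mI i1.
  have ci : cint (fun t => d * wd u t + wd v t) :=
    cintegrableD mI (cintegrableZ d mI uwi) vwi.
  rewrite mulrDr -(primZ d x i1) addrACA -(primD x i3 i2).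
  suff -> : prim l (fun t => H (wd (fun x => d * u x + v x)) t -
      wd (fun x => d * u x + v x) t) x =
    prim l (fun t => d * (H (wd u) t - wd u t) + (H (wd v) t - wd v t)) x by [].
  apply: ae_eq_prim.
  + exact: (cintegrableB mI (Hi _ swi) swi).
  + exact: (cintegrableD mI i3 i2).
  + apply: ae_imply2 (ae_imply2 (fun t h1 h2 => conj h1 h2)
      (Hae _ _ swi ci sE) (Hlin d _ _ uwi vwi)) sE => t [h1 h2] h3 It.
    by rewrite (h1 It) (h2 It) (h3 It); ring.
(* The sum of the coefficients in the bounds of [T u] and of its derivative, once [C1] has turned
   the [L^1] norm of [u'] into its [L^p] norm. *)
exists (1 + k * C1 * Lp_norm_cst1 l p + B + c * C1 * Lp_norm_cst1 l p) => u uW.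
have [uL ui uw uwL uwi] := in_W1_weak_deriv uW.
have TD := in_W1_derivative_rule rH TH uW.
have [TL Ti Tw TwL Twi] := in_W1_weak_deriv (TW _ uW).
have [_ HI] := HC1 _ uwL.
have I0 : 0 <= \int[mu]_(t in IR) cmodulus (wd u t).
  by apply: Rintegral_ge0 => t _; exact: cmodulus_ge0.
have b1 : (Lp_norm mu IR p%:E (T u) <= 1%:E * Lp_norm mu IR p%:E u +
    (k * \int[mu]_(t in IR) cmodulus (wd u t) * Lp_norm_cst1 l p)%:E)%E.
  apply: Lp_norm_le => //; [by case: uL|by case: TL|by rewrite mulr_ge0|].
  by apply: aeW => x Ix; exact: bound.
have b2 : (Lp_norm mu IR p%:E (wd (T u)) <= B%:E * Lp_norm mu IR p%:E (wd u) +
    (c * \int[mu]_(t in IR) cmodulus (wd u t) * Lp_norm_cst1 l p)%:E)%E.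
  apply: Lp_norm_le => //; [by case: uwL|by case: TwL|by rewrite mulr_ge0|].
  apply: ae_imply (weak_deriv_eq TD) => x E Ix; rewrite E//; exact: HB.
rewrite /W1_norm; apply: le_trans (leeD b1 b2) _.
have [_ f1] := uL; have [_ f2] := uwL.
have g1 : (0 <= Lp_norm mu IR p%:E u)%E by exact: Lnorm_ge0.
have g2 : (0 <= Lp_norm mu IR p%:E (wd u))%E by exact: Lnorm_ge0.
have L0 := Lp_norm_cst1_ge0 l p; move: (Lp_norm_cst1 l p) L0 => L L0.
move: (\int[mu]_(t in IR) cmodulus (wd u t)) I0 HI => I I0.
move: (Lp_norm mu IR p%:E u) (Lp_norm mu IR p%:E (wd u)) f1 f2 g1 g2.
move=> [U| |] [V| |] // _ _; rewrite !lee_fin => U0 V0 IV.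
have h1 : k * I * L <= k * C1 * L * V.
  have -> : k * C1 * L * V = k * (C1 * V) * L by ring.
  by rewrite ler_wpM2r// ler_wpM2l.
have h2 : c * I * L <= c * C1 * L * V.
  have -> : c * C1 * L * V = c * (C1 * V) * L by ring.
  by rewrite ler_wpM2r// ler_wpM2l.
have e1 : 0 <= k * C1 * L := mulr_ge0 (mulr_ge0 k0 C10) L0.
have e2 : 0 <= c * C1 * L := mulr_ge0 (mulr_ge0 c0 C10) L0.
move: (k * C1 * L) (c * C1 * L) h1 h2 e1 e2 => X Y h1 h2 e1 e2.
have := mulr_ge0 e1 U0; have := mulr_ge0 e2 U0; have := mulr_ge0 B0 U0.
move: (k * I * L) (c * I * L) h1 h2 => X' Y' h1 h2.
nra.
Qed.

(** As [(T u)' = H u'] and [H' (H u') = u'], the correction made by [S] is the primitive of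
    [u' - H u'], which cancels the one made by [T]. *)
Lemma derivative_rule_inverse T S H H' : derivative_rule H -> derivative_rule H' ->
  has_derivative_rule T H -> has_derivative_rule S H' ->
  (forall v, cint v -> ae_eq mu IR (H' (H v)) v) ->
  forall u, in_W1 l p%:E u -> ae_eq mu IR (S (T u)) u.
Proof.
move=> rH rH' TH SH inv u uW.
have [uL ui uw uwL uwi] := in_W1_weak_deriv uW.
have [TWP _ _ _] := W1_bounded_derivative_rule rH TH; have TuW := TWP _ uW.
have [TL Ti Tw TwL Twi] := in_W1_weak_deriv TuW.
have E := weak_deriv_eq (in_W1_derivative_rule rH TH uW).
have [Hi _ _ _] := rH; have [Hi' _ _ Hae'] := rH'.
have Hui := Hi _ uwi.
have E2 := Hae' _ _ Twi Hui E; have E3 := inv _ uwi.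
have i1 : cint (fun t => H (wd u) t - wd u t) := cintegrableB mI Hui uwi.
have i2 : cint (fun t => wd u t - H (wd u) t) := cintegrableB mI uwi Hui.
apply: aeW => x Ix; rewrite (SH _ _ TuW Ix) (TH _ _ uW Ix).
have -> : prim l (fun t => H' (wd (T u)) t - wd (T u) t) x =
    prim l (fun t => wd u t - H (wd u) t) x.
  apply: ae_eq_prim.
  + exact: (cintegrableB mI (Hi' _ Twi) Twi).
  + exact: i2.
  + apply: ae_imply2 (ae_imply2 (fun t h1 h2 => conj h1 h2) E E2) E3 => t [h1 h2] h3 It.
    by rewrite (h2 It) (h3 It) (h1 It).
rewrite -addrA -(primD x i1 i2) (_ : (fun s => _) = (fun=> 0)); last first.
  by apply/funext => t; ring.
rewrite /prim (_ : (fun s => _) = (fun=> 0)); last by apply/funext => s; rewrite mulr0.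
by rewrite cintegral0 addr0.
Qed.

End primitive_operators.

(** * The rule of the transmutation operator and its inverse *)

Section derivative_rules.
Context {R : realType} (l : R).
Local Notation mu := (@lebesgue_measure R).
Local Notation MR := (measurableTypeR R).
Local Notation IR := (Iopen l : set MR).
Local Notation mI := (measurable_IR l).
Local Notation cint := (cintegrable mu IR).

Variables (g : R * R -> R[i]) (M : R) (a : R -> R) (A Mk : R).
Hypothesis mg : cmeasurable_on [set: MR * MR] g.
Hypothesis gM : forall z, cmodulus (g z) <= M.
Hypothesis ma : measurable_fun IR a.
Hypothesis aA : forall x, Iopen l x -> `|a x| <= A.
Hypothesis a_gt0 : forall x, Iopen l x -> 0 < a x.
Hypothesis mai : cmeasurable_on IR (fun x => ((a x)^-1)%:C%C).
Hypothesis aMk : forall x, Iopen l x -> `|1 - (a x)^-1| <= Mk.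

Local Notation G := (Gop l g).
Local Notation V := (Vop l g a).

Lemma GopD c v w x : cint v -> cint w ->
  G (fun t => c * v t + w t) x = c * G v x + G w x.
Proof.
move=> vi wi; have i1 := cintegrable_kap mg gM x vi; have i2 := cintegrable_kap mg gM x wi.
rewrite /Gop -(cintegralZ c mI i1) -(cintegralD mI (cintegrableZ c mI i1) i2).
by congr cintegral; apply/funext => t; ring.
Qed.

Lemma ae_eq_Gop v w x : cint v -> cint w -> ae_eq mu IR v w -> G v x = G w x.
Proof.
move=> vi wi vw; apply: ae_eq_cintegral; first exact: mI.
- exact: cintegrable_cmeasurable (cintegrable_kap mg gM x vi).
- exact: cintegrable_cmeasurable (cintegrable_kap mg gM x wi).
- by apply: ae_imply vw => t vwt It; rewrite (vwt It).
Qed.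

Lemma cmodulus_Gop_le v x : cint v ->
  cmodulus (G v x) <= 2 * M * \int[mu]_(t in IR) cmodulus (v t).
Proof.
move=> vi; have iv := cintegrable_norm mI vi.
rewrite -mulrA -(RintegralZl M mI iv); apply: cmodulus_cintegral_le; first exact: mI.
- exact: cintegrable_cmeasurable (cintegrable_kap mg gM x vi).
- move=> t _; rewrite cmodulusM ler_wpM2r ?cmodulus_ge0//.
  exact: cmodulus_kap_le gM _.
- exact: (integrableZl mI M iv).
Qed.

Definition coef (t : R) : R[i] := (1 - (a t)^-1)%:C%C.

(** This is [v / a - G v], in the form delivered by the kernel: [coef] is the diagonal value of [K],
    for which a bound is at hand. *)
Definition direct_rule (v : R -> R[i]) (t : R) : R[i] :=
  v t - (coef t * v t + G v t).

Lemma cintegrable_coefM v : cint v -> cint (fun t => coef t * v t).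
Proof.
apply: (@cintegrableM_bounded _ _ _ mu IR coef v Mk); first exact: mI.
- rewrite (_ : coef = (fun t => 1 - ((a t)^-1)%:C%C)).
    by apply: cmeasurableB => //; exact: cmeasurable_cst.
  by apply/funext => t; rewrite /coef rmorphB.
- by move=> t It; rewrite cmodulus_real aMk.
Qed.

Lemma direct_ruleP : derivative_rule l direct_rule.
Proof.
have M0 : 0 <= M by exact: le_trans (cmodulus_ge0 _) (gM (0, 0)).
split.
- move=> v vi; apply: (cintegrableB mI vi).
  exact: (cintegrableD mI (cintegrable_coefM vi) (cintegrable_Gop mg gM vi)).
- exists (1 + `|Mk|), (2 * M); split; [by rewrite addr_ge0|by rewrite mulr_ge0|].
  move=> v x vi Ix; rewrite /direct_rule (le_trans (cmodulusB _ _))//.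
  rewrite mulrDl mul1r -addrA lerD2l (le_trans (cmodulusD _ _))//.
  apply: lerD; last exact: cmodulus_Gop_le.
  rewrite cmodulusM cmodulus_real ler_wpM2r ?cmodulus_ge0//.
  by rewrite (le_trans (aMk Ix))// ler_norm.
- move=> c v w vi wi; apply: aeW => x _.
  by rewrite /direct_rule GopD//; ring.
- move=> v w vi wi vw; have E x := ae_eq_Gop x vi wi vw.
  by apply: ae_imply vw => x vwx Ix; rewrite /direct_rule (vwx Ix) E.
Qed.

Lemma volterra_unique2 v1 v2 w1 w2 : cint v1 -> cint v2 -> ae_eq mu IR w1 w2 ->
  (forall x, Iopen l x -> v1 x = (a x)%:C%C * w1 x + V v1 x) ->
  (forall x, Iopen l x -> v2 x = (a x)%:C%C * w2 x + V v2 x) ->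
  ae_eq mu IR v1 v2.
Proof.
move=> v1i v2i w12 e1 e2; have di := cintegrableB mI v1i v2i.
have H : ae_eq mu IR (fun t => v1 t - v2 t) (V (fun t => v1 t - v2 t)).
  apply: ae_imply w12 => x w12x Ix.
  by rewrite (VopB a mg gM x v1i v2i) (e1 _ Ix) (e2 _ Ix) (w12x Ix); ring.
have := volterra_unique mg gM ma aA di H; apply: ae_imply => x dx Ix.
by apply/eqP; rewrite -subr_eq0; apply/eqP; exact: dx.
Qed.

(** The constant of [volterra_solution], with the values of its local [C] and [lam] written out. *)
Definition Vconst : R :=
  4 * (2 * `|A| * M + 1) * `|A| * expR (4 * (2 * `|A| * M + 1) * l).

Definition volterra_solves (w v : R -> R[i]) :=
  [/\ cint v, forall x, Iopen l x -> v x = (a x)%:C%C * w x + V v x &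
    forall x, Iopen l x -> cmodulus (v x - (a x)%:C%C * w x) <=
      Vconst * \int[mu]_(t in IR) cmodulus (w t)].

(** A choice of one solution for each datum. The estimate is part of [volterra_solves] so that it
    holds for the chosen solution. *)
Definition inverse_rule (w : R -> R[i]) : R -> R[i] :=
  xget (fun=> 0) [set v | volterra_solves w v].

Lemma inverse_ruleE w : cint w -> volterra_solves w (inverse_rule w).
Proof.
move=> wi; have [v vP] := volterra_solution mg gM ma aA wi.
by apply: (@xgetPex _ _ [set v | volterra_solves w v]); exists v.
Qed.

(** Linearity and compatibility with almost everywhere equality are not visible in a choice; both
    follow from uniqueness, since the two sides solve the same equation. *)
Lemma inverse_ruleP : derivative_rule l inverse_rule.
Proof.
have M0 : 0 <= M by exact: le_trans (cmodulus_ge0 _) (gM (0, 0)).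
split.
- by move=> w /inverse_ruleE[].
- exists `|A|, Vconst; split => //; first by rewrite !mulr_ge0 ?expR_ge0// addr_ge0// !mulr_ge0.
  move=> w x /inverse_ruleE[_ _ H] Ix; have -> : inverse_rule w x =
    (a x)%:C%C * w x + (inverse_rule w x - (a x)%:C%C * w x) by rewrite addrC subrK.
  rewrite (le_trans (cmodulusD _ _))// lerD ?H// cmodulusM cmodulus_real.
  by rewrite ler_wpM2r ?cmodulus_ge0// (le_trans (aA Ix))// ler_norm.
- move=> c v w vi wi; have [Hi He _] := inverse_ruleE (cintegrableD mI (cintegrableZ c mI vi) wi).
  have [vi' ve _] := inverse_ruleE vi; have [wi' we _] := inverse_ruleE wi.
  have ci := cintegrableD mI (cintegrableZ c mI vi') wi'.
  apply: (volterra_unique2 (w1 := fun x => c * v x + w x)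
    (w2 := fun x => c * v x + w x) Hi ci _ He); first by apply: aeW.
  move=> x Ix; rewrite (ve _ Ix) (we _ Ix) /Vop (GopD c x vi' wi').
  move: (G _ x) (G _ x) => h k; ring.
- move=> v w vi wi vw.
  have [vi' ve _] := inverse_ruleE vi; have [wi' we _] := inverse_ruleE wi.
  exact: (volterra_unique2 vi' wi' vw ve we).
Qed.

(** After multiplication by [a], the definition of [direct_rule v] says that [v] solves the Volterra
    equation with datum [direct_rule v]; uniqueness concludes. *)
Lemma inverse_ruleK v : cint v -> ae_eq mu IR (inverse_rule (direct_rule v)) v.
Proof.
move=> vi; have [Hi _ _ _] := direct_ruleP; have [i1 e1 _] := inverse_ruleE (Hi _ vi).
apply: (volterra_unique2 i1 vi _ e1 (w2 := direct_rule v)); first by apply: aeW.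
move=> x Ix; have ax : (a x)%:C%C != 0 :> R[i].
  by apply/eqP => /(congr1 (@complex.Re R))/= /eqP; rewrite gt_eqF// a_gt0.
rewrite /direct_rule /Vop /coef rmorphB fmorphV /=.
by field.
Qed.

Lemma direct_ruleK w : cint w -> ae_eq mu IR (direct_rule (inverse_rule w)) w.
Proof.
move=> wi; have [i1 e1 _] := inverse_ruleE wi.
apply: aeW => x Ix; have ax : (a x)%:C%C != 0 :> R[i].
  by apply/eqP => /(congr1 (@complex.Re R))/= /eqP; rewrite gt_eqF// a_gt0.
rewrite /direct_rule; have := e1 _ Ix; rewrite /Vop /coef rmorphB fmorphV /=.
move: (inverse_rule w x) (G _ x) => v h ->.
by field.
Qed.

End derivative_rules.

Theorem theorem29 (R : realType) (l : R) (a : R -> R)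
    (e : R[i] -> R -> R[i]) (K : R * R -> R[i]) (p : R) :
  0 < l ->
  impedance l a ->
  (forall rho : R[i], is_solution l a rho (e rho)) ->
  is_kernel l a e K ->
  1 <= p ->
  W1_invertible l p%:E (transmutation l K).
Proof.
move=> l0 [[aW ca] a0 _ [mai _] _] _ [KW cK _ diag anti] p1.
have [g [M [mg gM incr]]] := kernel_increments KW cK.
have [[mK _] _ _] := KW.
have [A aA'] := continuous_bounded_itv ca.
have aA x : Iopen l x -> `|a x| <= A.
  by move=> Ix; apply: aA'; exact: Iopen_sub_closed.
have [M1 HM1] := continuous_bounded_square cK.1.
have [M2 HM2] := continuous_bounded_square cK.2.
have KM z : Omega_closed l z -> cmodulus (K z) <= M1 + M2.
  by move=> Oz; rewrite (le_trans (cmodulus_le _))// lerD ?HM1 ?HM2.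
have ma : measurable_fun (Iopen l : set (measurableTypeR R)) a.
  by have [[[m1 _] _] _] := aW.
(* The diagonal condition turns the bound on [K] into one on [1/a], up to the endpoints of the
   interval. *)
have aMk x : Iopen l x -> `|1 - (a x)^-1| <= M1 + M2.
  move=> Ix; have xI : Iclosed l x by exact: Iopen_sub_closed.
  by rewrite -cmodulus_real -diag//; apply: KM.
have rH := direct_ruleP mg gM mai aMk.
have rH' := inverse_ruleP mg gM ma aA.
pose S u x := u x + prim l (fun t => inverse_rule l g M a A (weak_deriv l u) t -
  weak_deriv l u t) x.
have hT : has_derivative_rule l p (transmutation l K) (direct_rule l g a).
  move=> u x uW Ix; have [_ _ _ _ wi] := in_W1_weak_deriv p1 uW.
  rewrite (transmutationE mg gM incr diag anti mK KM mai Ix wi); congr (_ + _).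
  (* The correction is subtracted in [transmutation] but added in [has_derivative_rule]: the sign is
     moved inside the primitive, where [H u' - u'] is minus [coef u' + G u']. *)
  rewrite -mulN1r -primZ; last first.
    apply: (cintegrableD (measurable_IR l)); last exact: (cintegrable_Gop mg gM wi).
    exact: (cintegrable_coefM mai aMk wi).
  by congr (prim l _ x); apply/funext => t; rewrite /direct_rule /coef; ring.
have hS : has_derivative_rule l p S (inverse_rule l g M a A) by [].
split; first exact: (W1_bounded_derivative_rule p1 rH hT).
exists S; split; first exact: (W1_bounded_derivative_rule p1 rH' hS).
- move=> u uW; apply: (derivative_rule_inverse p1 rH rH' hT hS) => // v vi.
  exact: (inverse_ruleK mg gM ma aA a0 mai aMk vi).
- move=> u uW; apply: (derivative_rule_inverse p1 rH' rH hS hT) => // v vi.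
  exact: (direct_ruleK mg gM ma aA a0 vi).
Qed.
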